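(* Assume the growth condition and the dynamics condition on the data $(\ell,g,A,B)$. Let $(N_t^n)_n,(N_s^n)_n$ be sequences of positive integers with $N_s^n\ge N_t^n$, and let $(m_n)_n\subset C([0,T];\mathcal P_1(\mathbb R^d))$, be such that, as $n\to\infty$, $N_t^n\to\infty$, $N_s^n\to\infty$, $N_t^n/N_s^n\to0$, and $m_n\to m^*$ in $C([0,T];\mathcal P_1(\mathbb R^d))$ for some $m^*\in C([0,T];\mathcal P_1(\mathbb R^d))$. Set $\mathcal I^n=\{0,\dots,N_t^n\}$, $t^n_k=kT/N^n_t$, and let $\mathcal S_k^n$ ($k\in\mathcal I^n$) and $\mathcal V^n$ be, respectively, the grids and the solution of the fully discrete scheme associated with the parameters $(N_t^n,N_s^n)$ and with $m=m_n$. Then $$\sup\left\{\left|\mathcal V^n_k(x)-v[m^*](t^n_k,x)\right|\;:\;k\in\mathcal I^n,\ x\in\mathcal S^n_k\right\}\xrightarrow[n\to\infty]{}0,$$ where $v[m^*]$ is the value function associated with $m^*$.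
   Context: **Notation.** $|\cdot|$ is the infinity norm on $\mathbb R^n$ and $\overline B_\infty(0,R)$ the closed ball of radius $R$ centred at $0$. $\mathcal P_1(\mathbb R^d)$ is the set of Borel probability measures with finite first moment, with the Wasserstein distance $d_1(\mu_1,\mu_2)=\inf_{\mu\in\Pi(\mu_1,\mu_2)}\int|x-y|\,d\mu(x,y)$, where $\Pi(\mu_1,\mu_2)$ is the set of $\mu\in\mathcal P_1(\mathbb R^d\times\mathbb R^d)$ with marginals $\mu_1,\mu_2$. $C([0,T];\mathcal P_1(\mathbb R^d))$ has the uniform distance. **Data.** $T>0$, $\ell:[0,T]\times\mathbb R^r\times\mathbb R^d\times\mathcal P_1(\mathbb R^d)\to\mathbb R$, $g:\mathbb R^d\times\mathcal P_1(\mathbb R^d)\to\mathbb R$, $A:[0,T]\times\mathbb R^d\to\mathbb R^d$, $B:[0,T]\to\mathbb R^{d\times r}$. $C^*>0$ is a fixed real number (radius of the initial grid; in the paper a ball of radius $C^*$ contains the support of the initial distribution). *Growth condition.* $\ell,g$ are continuous and there are $p\in]1,\infty[$ and positive constants $C_{\ell,1},\dots,C_{\ell,4},C_{g,1},C_{g,2},C_{g,3}$ such that for all $(t,a,x,\mu)$ and all $y\in\mathbb R^d$: $C_{\ell,1}|a|^p-C_{\ell,2}\le\ell(t,a,x,\mu)\le C_{\ell,3}(1+|a|^p+|x|^p)$; $-C_{g,1}\le g(x,\mu)\le C_{g,2}(1+|x|^p)$; $|\ell(t,a,x,\mu)-\ell(t,a,y,\mu)|\le C_{\ell,4}(1+|x|^{p-1}+|y|^{p-1}+|a|^{p-1})|x-y|$;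 $|g(x,\mu)-g(y,\mu)|\le C_{g,3}(1+|x|^{p-1}+|y|^{p-1})|x-y|$. *Dynamics condition.* $A,B$ are continuous; there is $L_A>0$ with $|A(t,x)-A(t,y)|\le L_A|x-y|$ for all $t,x,y$; $r\le d$ and there are $\{i_1,\dots,i_r\}\subset\{1,\dots,d\}$ such that for all $t\in[0,T]$ the rows $i_1,\dots,i_r$ of $B(t)$ are linearly independent. **Value function.** For $m\in C([0,T];\mathcal P_1(\mathbb R^d))$, $(t,x)\in[0,T]\times\mathbb R^d$ and $\alpha\in L^p([t,T];\mathbb R^r)$ let $\gamma^{t,x,\alpha}$ be the unique solution of $\dot\gamma(s)=A(s,\gamma(s))+B(s)\alpha(s)$ for a.e. $s\in]t,T[$, $\gamma(t)=x$. Then $$v[m](t,x)=\inf_{\alpha\in L^p([t,T];\mathbb R^r)}\Big\{\int_t^T\ell(s,\alpha(s),\gamma^{t,x,\alpha}(s),m(s))\,ds+g(\gamma^{t,x,\alpha}(T),m(T))\Big\}.$$ Under the growth and dynamics conditions there is $C_{\mathrm b}>0$, independent of $(t,x,m)$, such that $v[m](t,x)$ is always attained at some $\alpha^*$ with $|\alpha^*(s)|\le C_{\mathrm b}(1+|\gamma^{t,x,\alpha^*}(s)|)$ for a.e. $s\in[t,T]$; such a $C_{\mathrm b}$ is fixed. **Grids.** For positive integers $N_s\ge N_t$ set $\Delta t=T/N_t$, $\Delta x=1/N_s$, $\mathcal I=\{0,\dots,N_t\}$, $\mathcal I^*=\mathcal I\setminus\{N_t\}$, $t_k=k\Delta t$,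 $\mathcal G_q=\{i\Delta x: i\in\mathbb Z^q\}$, $\mathcal G=\mathcal G_d=\mathcal G_r\times\mathcal G_{d-r}$. The coordinates are ordered so that, writing $x=(\mathrm x_1,\mathrm x_2)\in\mathbb R^r\times\mathbb R^{d-r}$, $A=(A_1,A_2)$, $B=\binom{B_1}{B_2}$ accordingly, $B_1(t)\in\mathbb R^{r\times r}$ is invertible for all $t$. $(\beta_{\mathrm x_2})_{\mathrm x_2\in\mathcal G_{d-r}}$ is a $\mathbb Q_1$ basis on a regular mesh with vertices $\mathcal G_{d-r}$: each $\beta_{\mathrm x_2}\ge0$ is polynomial of partial degree at most $1$ on each mesh element, $\beta_{\mathrm x_2}(\mathrm x_2)=1$, $\beta_{\mathrm x_2}(\mathrm y_2)=0$ for $\mathrm y_2\in\mathcal G_{d-r}\setminus\{\mathrm x_2\}$, $\sum_{\mathrm x_2}\beta_{\mathrm x_2}\equiv1$; and $\mathrm{supp}(\beta_{\mathrm x_2})\subseteq\{\mathrm y_2:|\mathrm y_2-\mathrm x_2|\le C_I\Delta x\}$ with $C_I>0$ independent of $\Delta x$. For $k\in\mathcal I^*$, $x\in\mathbb R^d$, $\mathrm y_1\in\mathcal G_r$ put $$\alpha(k,x,\mathrm y_1)=B_1(t_k)^{-1}\Big[\tfrac{\mathrm y_1-\mathrm x_1}{\Delta t}-A_1(t_k,x)\Big],\qquad \mathbf y_2(k,x,\mathrm y_1)=\mathrm x_2+\Delta t\,[A_2(t_k,x)+B_2(t_k)\alpha(k,x,\mathrm y_1)],$$ $\mathcal S^1_{k+1}(x)=\{\mathrm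 y_1\in\mathcal G_r:|\alpha(k,x,\mathrm y_1)|\le C_{\mathrm b}(1+|x|)\}$, $\mathcal S^2_{k+1}(x,\mathrm y_1)=\{\mathrm y_2\in\mathcal G_{d-r}:\mathbf y_2(k,x,\mathrm y_1)\in\mathrm{supp}\,\beta_{\mathrm y_2}\}$, $\mathcal S_{k+1}(x)=\{(\mathrm y_1,\mathrm y_2):\mathrm y_1\in\mathcal S^1_{k+1}(x),\mathrm y_2\in\mathcal S^2_{k+1}(x,\mathrm y_1)\}$, $\mathcal S_0=\mathcal G\cap\overline B_\infty(0,C^* )$, $\mathcal S_{k+1}=\bigcup_{x\in\mathcal S_k}\mathcal S_{k+1}(x)$. The sets $\mathcal S_{k+1}(x)$, $x\in\mathcal S_k$, are nonempty when $\Delta x/\Delta t$ is small enough (hence for $n$ large in the claim), so the scheme below is then well defined. For $F\subseteq\mathcal G_{d-r}$ and $\varphi:F\to\mathbb R$, $I_F[\varphi](\mathrm y_2)=\sum_{\mathrm x_2\in F}\beta_{\mathrm x_2}(\mathrm y_2)\varphi(\mathrm x_2)$. **Fully discrete scheme.** Given $m\in C([0,T];\mathcal P_1(\mathbb R^d))$, its solution $\mathcal V$ is defined by $\mathcal V_{N_t}(x)=g(x,m(T))$ for $x\in\mathcal S_{N_t}$ and, for $k\in\mathcal I^*$, $x\in\mathcal S_k$, $$\mathcal V_k(x)=\min_{\mathrm y_1\in\mathcal S^1_{k+1}(x)}\Big\{\Delta t\,\ell(t_k,\alpha(k,x,\mathrm y_1),x,m(t_k))+I_{\mathcal S^2_{k+1}(x,\mathrm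 y_1)}[\mathcal V_{k+1}(\mathrm y_1,\cdot)](\mathbf y_2(k,x,\mathrm y_1))\Big\}.$$ *)

(* Defs.v *)
From HB Require Import structures.
From mathcomp Require Import all_boot all_order all_algebra.
From mathcomp Require Import all_classical all_reals all_analysis.

Set Implicit Arguments.
Unset Strict Implicit.
Unset Printing Implicit Defensive.
Import Order.TTheory GRing.Theory Num.Theory.
Import numFieldNormedType.Exports.
Local Open Scope classical_set_scope.
Local Open Scope ring_scope.

Notation borel V := (g_sigma_algebraType (@open V)).

(* R^n is 'cV[R]_n: its norm in the library is the maximum of the absolute
   values of the entries, and the norm on a product is the maximum of the two
   norms, so that V * V again carries the infinity norm. *)

Record P1 (R : realType) (V : normedModType R) := MkP1 {
  P1_prob :> probability (borel V) R ;
  P1_moment : (\int[P1_prob]_x `|(x : V)|%:E < +oo)%E }.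

Definition coupling (R : realType) (V : normedModType R) (mu1 mu2 : P1 V)
    (mu : P1 (V * V)%type) : Prop :=
  forall X : set (borel V), measurable X ->
    mu (fst @^-1` X) = mu1 X /\ mu (snd @^-1` X) = mu2 X.

Definition d1 (R : realType) (V : normedModType R) (mu1 mu2 : P1 V) : \bar R :=
  ereal_inf [set (\int[mu]_z `|(z : (V * V)%type).1 - z.2|%:E)%E
            | mu in coupling mu1 mu2].

(* An element of C([0,T]; P_1) is a total function of time, of which only the
   values on [0,T] are ever used. *)
Definition continuous_flow (R : realType) (V : normedModType R) (T : R)
    (m : R -> P1 V) : Prop :=
  forall t, t \in `[0, T] -> forall e, 0 < e ->
    exists2 delta, 0 < delta &
      forall s, s \in `[0, T] -> `|s - t| < delta -> (d1 (m t) (m s) < e%:E)%E.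

Definition dC (R : realType) (V : normedModType R) (T : R)
    (m1 m2 : R -> P1 V) : \bar R :=
  ereal_sup [set d1 (m1 t) (m2 t) | t in [set` `[0, T]]].

(* The state space R^d is R^r x R^(d-r), with q = d - r; the constraint r <= d
   is built into the dimension r + q. *)
Record control_data (R : realType) (r q : nat) := ControlData {
  horizon : R ;
  ell : R -> 'cV[R]_r -> 'cV[R]_(r + q) -> P1 'cV[R]_(r + q) -> R ;
  gT : 'cV[R]_(r + q) -> P1 'cV[R]_(r + q) -> R ;
  drift : R -> 'cV[R]_(r + q) -> 'cV[R]_(r + q) ;
  ctrl : R -> 'M[R]_(r + q, r) }.

Section data_conditions.
Context (R : realType) (r q : nat) (D : control_data R r q).
Local Notation T := (horizon D).
Local Notation state := 'cV[R]_(r + q).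

Definition ell_continuous : Prop :=
  forall t (a : 'cV[R]_r) (x : state) (mu : P1 state), t \in `[0, T] ->
  forall e, 0 < e -> exists2 delta, 0 < delta &
    forall t' (a' : 'cV[R]_r) (x' : state) (mu' : P1 state), t' \in `[0, T] ->
      `|t' - t| < delta -> `|a' - a| < delta -> `|x' - x| < delta ->
      (d1 mu mu' < delta%:E)%E ->
      `|ell D t' a' x' mu' - ell D t a x mu| < e.

Definition gT_continuous : Prop :=
  forall (x : state) (mu : P1 state) e, 0 < e ->
  exists2 delta, 0 < delta &
    forall (x' : state) (mu' : P1 state), `|x' - x| < delta ->
      (d1 mu mu' < delta%:E)%E -> `|gT D x' mu' - gT D x mu| < e.

Definition growth_bounds (p Cl1 Cl2 Cl3 Cl4 Cg1 Cg2 Cg3 : R) : Prop :=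
  (forall t (a : 'cV[R]_r) (x y : state) (mu : P1 state), t \in `[0, T] ->
    [/\ Cl1 * `|a| `^ p - Cl2 <= ell D t a x mu,
        ell D t a x mu <= Cl3 * (1 + `|a| `^ p + `|x| `^ p) &
        `|ell D t a x mu - ell D t a y mu| <=
          Cl4 * (1 + `|x| `^ (p - 1) + `|y| `^ (p - 1) + `|a| `^ (p - 1))
              * `|x - y| ])
  /\
  (forall (x y : state) (mu : P1 state),
    [/\ - Cg1 <= gT D x mu,
        gT D x mu <= Cg2 * (1 + `|x| `^ p) &
        `|gT D x mu - gT D y mu| <=
          Cg3 * (1 + `|x| `^ (p - 1) + `|y| `^ (p - 1)) * `|x - y| ]).

Definition growth_condition (p : R) : Prop :=
  [/\ 1 < p, ell_continuous, gT_continuous &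
      exists Cl1 Cl2 Cl3 Cl4 Cg1 Cg2 Cg3 : R,
        [/\ [/\ 0 < Cl1, 0 < Cl2, 0 < Cl3 & 0 < Cl4],
            [/\ 0 < Cg1, 0 < Cg2 & 0 < Cg3] &
            growth_bounds p Cl1 Cl2 Cl3 Cl4 Cg1 Cg2 Cg3]].

Definition dynamics_condition : Prop :=
  [/\ {within [set z : (R * state)%type | z.1 \in `[0, T]],
        continuous (fun z : (R * state)%type => drift D z.1 z.2)},
      {within [set` `[0, T]], continuous (ctrl D)},
      exists2 LA : R, 0 < LA &
        forall t (x y : state), t \in `[0, T] ->
          `|drift D t x - drift D t y| <= LA * `|x - y| &
      exists i : 'I_r -> 'I_(r + q), forall t, t \in `[0, T] ->
        row_free (rowsub i (ctrl D t)) ].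

Definition A1 t x : 'cV[R]_r := usubmx (drift D t x).
Definition A2 t x : 'cV[R]_q := dsubmx (drift D t x).
Definition B1 t : 'M[R]_r := usubmx (ctrl D t).
Definition B2 t : 'M[R]_(q, r) := dsubmx (ctrl D t).

Definition coordinates_ordered : Prop :=
  forall t, t \in `[0, T] -> B1 t \in unitmx.

End data_conditions.

Definition absolutely_continuous (R : realType) (V : normedModType R) (a b : R)
    (f : R -> V) : Prop :=
  forall e, 0 < e -> exists2 delta, 0 < delta &
    forall (n : nat) (u w : 'I_n -> R),
      (forall i, a <= u i /\ u i <= w i /\ w i <= b) ->
      trivIset setT (fun i => [set` `]u i, w i[ ]) ->
      \sum_(i < n) (w i - u i) < delta ->
      \sum_(i < n) `|f (w i) - f (u i)| < e.

Section value_function.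
Context (R : realType) (r q : nat) (D : control_data R r q) (p : R).
Local Notation T := (horizon D).
Local Notation state := 'cV[R]_(r + q).
Local Notation leb := (@lebesgue_measure R).

Definition Lp_control (t : R) (alpha : R -> 'cV[R]_r) : Prop :=
  measurable_fun [set` `[t, T]] (alpha : R -> borel 'cV[R]_r) /\
  (\int[leb]_(s in [set` `[t, T]]) (`|alpha s| `^ p)%:E < +oo)%E.

(* Solutions of the state equation are meant in the sense of Caratheodory. The
   value function below takes the infimum over pairs of a control and its
   (unique) trajectory. *)
Definition trajectory (t : R) (x : state) (alpha : R -> 'cV[R]_r)
    (gam : R -> state) : Prop :=
  [/\ absolutely_continuous t T gam,
      {ae leb, forall s : R, s \in `]t, T[ ->
        is_derive s (1 : R) gam (drift D s (gam s) + ctrl D s *m alpha s)} &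
      gam t = x].

Definition cost (m : R -> P1 state) (t : R) (alpha : R -> 'cV[R]_r)
    (gam : R -> state) : \bar R :=
  (\int[leb]_(s in [set` `[t, T]]) (ell D s (alpha s) (gam s) (m s))%:E
   + (gT D (gam T) (m T))%:E)%E.

Definition value (m : R -> P1 state) (t : R) (x : state) : \bar R :=
  ereal_inf [set J | exists alpha gam,
    [/\ Lp_control t alpha, trajectory t x alpha gam &
        J = cost m t alpha gam]].

(* Optimal controls exist and satisfy a bound with a constant Cb that depends
   neither on m nor on (t, x). *)
Definition control_bound (Cb : R) : Prop :=
  0 < Cb /\
  forall (m : R -> P1 state) (t : R) (x : state),
    continuous_flow T m -> t \in `[0, T] ->
    exists alpha gam,
      [/\ Lp_control t alpha, trajectory t x alpha gam,
          cost m t alpha gam = value m t x &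
          {ae leb, forall s : R, s \in `[t, T] ->
            `|alpha s| <= Cb * (1 + `|gam s|)}].

End value_function.

Definition grid (R : realType) (n : nat) (dx : R) : set 'cV[R]_n :=
  range (fun i : 'cV[int]_n => dx *: map_mx intr i).

Definition mesh_cell (R : realType) (n : nat) (dx : R) (i : 'cV[int]_n) :
    set 'cV[R]_n :=
  [set y | forall j, (i j 0)%:~R * dx <= y j 0 <= ((i j 0)%:~R + 1) * dx].

(* A polynomial of partial degree at most 1 in y_0, ..., y_(n-1) is a linear
   combination of the squarefree monomials prod_(j in J) y_j. *)
Definition multiaffine_on (R : realType) (n : nat) (K : set 'cV[R]_n)
    (f : 'cV[R]_n -> R) : Prop :=
  exists c : {set 'I_n} -> R, forall y, K y ->
    f y = \sum_(J : {set 'I_n}) c J * \prod_(j in J) y j 0.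

Definition supp (R : realType) (V : normedModType R) (f : V -> R) : set V :=
  closure [set y | f y != 0].

(* beta is indexed by its vertex; only its values at vertices in the grid
   matter. The sum in Q1_unity is locally finite by Q1_supp. *)
Record Q1_basis (R : realType) (n : nat) (CI dx : R)
    (beta : 'cV[R]_n -> 'cV[R]_n -> R) : Prop := {
  Q1_ge0 : forall x, grid dx x -> forall y, 0 <= beta x y ;
  Q1_poly : forall x, grid dx x ->
    forall i, multiaffine_on (mesh_cell dx i) (beta x) ;
  Q1_vertex : forall x, grid dx x -> beta x x = 1 ;
  Q1_other : forall x y, grid dx x -> grid dx y -> y != x -> beta x y = 0 ;
  Q1_unity : forall y, \sum_(x \in grid dx) beta x y = 1 ;
  Q1_supp : forall x, grid dx x ->
    supp (beta x) `<=` [set y | `|y - x| <= CI * dx] }.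

(* The minimum of E, with value 0 when E has none. *)
Definition minimum (R : realType) (E : set R) : R :=
  xget 0 [set z | E z /\ lbound E z].

Section scheme.
Context (R : realType) (r q : nat) (D : control_data R r q).
Context (Cb Cstar : R) (beta : 'cV[R]_q -> 'cV[R]_q -> R) (Nt Ns : nat).
Local Notation T := (horizon D).
Local Notation state := 'cV[R]_(r + q).

Definition time_step : R := T / Nt%:R.
Definition space_step : R := 1 / Ns%:R.
Definition time (k : nat) : R := k%:R * time_step.

Definition alpha_ (k : nat) (x : state) (y1 : 'cV[R]_r) : 'cV[R]_r :=
  invmx (B1 D (time k)) *m
    (time_step^-1 *: (y1 - usubmx x) - A1 D (time k) x).

Definition y2_ (k : nat) (x : state) (y1 : 'cV[R]_r) : 'cV[R]_q :=
  dsubmx x +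
    time_step *: (A2 D (time k) x + B2 D (time k) *m alpha_ k x y1).

(* S1_ k x, S2_ k x y1 and Ssucc k x are S^1_(k+1)(x), S^2_(k+1)(x, y1) and
   S_(k+1)(x): k is the index of the time at which x is reached. *)
Definition S1_ (k : nat) (x : state) : set 'cV[R]_r :=
  [set y1 | grid space_step y1 /\ `|alpha_ k x y1| <= Cb * (1 + `|x|)].

Definition S2_ (k : nat) (x : state) (y1 : 'cV[R]_r) : set 'cV[R]_q :=
  [set y2 | grid space_step y2 /\ supp (beta y2) (y2_ k x y1)].

Definition Ssucc (k : nat) (x : state) : set state :=
  [set y | S1_ k x (usubmx y) /\ S2_ k x (usubmx y) (dsubmx y)].

Fixpoint S_ (k : nat) : set state :=
  if k is k'.+1 then \bigcup_(x in S_ k') Ssucc k' x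
  else grid space_step `&` [set x | `|x| <= Cstar].

Definition interp (F : set 'cV[R]_q) (phi : 'cV[R]_q -> R) (y2 : 'cV[R]_q) : R :=
  \sum_(x2 \in F) beta x2 y2 * phi x2.

Definition scheme_step (m : R -> P1 state) (k : nat) (W : state -> R)
    (x : state) : R :=
  minimum [set time_step * ell D (time k) (alpha_ k x y1) x (m (time k))
               + interp (S2_ k x y1) (fun y2 => W (col_mx y1 y2)) (y2_ k x y1)
          | y1 in S1_ k x].

(* Backward induction on the number j = Nt - k of remaining time steps. *)
Fixpoint scheme_rev (m : R -> P1 state) (j : nat) : state -> R :=
  if j is j'.+1 then scheme_step m (Nt - j) (scheme_rev m j')
  else fun x => gT D x (m T).

Definition scheme (m : R -> P1 state) (k : nat) : state -> R :=
  scheme_rev m (Nt - k).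

Lemma scheme_last m x : scheme m Nt x = gT D x (m T).
Proof. by rewrite /scheme subnn. Qed.

Lemma scheme_rec m k x : (k < Nt)%N ->
  scheme m k x = scheme_step m k (scheme m k.+1) x.
Proof.
move=> kN; have e1 : (Nt - k = (Nt - k.+1).+1)%N by rewrite subnSK.
have e2 : (Nt - (Nt - k.+1).+1 = k)%N by rewrite -e1 subKn// ltnW.
rewrite /scheme e1.
by transitivity (scheme_step m (Nt - (Nt - k.+1).+1) (scheme_rev m (Nt - k.+1)) x);
  last rewrite e2.
Qed.

End scheme.

(* Main.v *)
Require Import Defs.
From HB Require Import structures.
From mathcomp Require Import all_boot all_order all_algebra.
From mathcomp Require Import all_classical all_reals all_analysis.
From mathcomp Require Import measurable_realfun ring lra.
Import Order.TTheory GRing.Theory Num.Theory.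
Import numFieldNormedType.Exports.
Local Open Scope classical_set_scope.
Local Open Scope ring_scope.

Set Implicit Arguments.
Unset Strict Implicit.
Unset Printing Implicit Defensive.

(* Both inequalities compare the discrete dynamics with the controlled equation by
   a Gronwall argument.

   Lower bound: keeping the minimizing control and, among the vertices used by the
   interpolation, one of least value, the scheme contains an Euler path whose cost
   is at most V_k(x). Its piecewise constant control drives a trajectory close to
   that path, so that v(t_k, x) is at most V_k(x) plus a small error.

   Upper bound: an optimal control is approximated in L^1 by a continuous one with
   almost optimal cost. Truncated to the admissible size and rounded so that the
   next point is a vertex, it steers every point of a thin tube around its
   trajectory into the next section of the tube, whatever vertices the
   interpolation uses; hence V_k is at most the cost of that trajectory plus a
   small error on the whole tube. As v(s, y) exceeds v(t, x) by little when s <= t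
   and (s, y) is close to (t, x), finitely many tubes suffice. *)

(** * Vectors and integrals *)

(** The set of admissible controls moves with the state: a control admissible at a point y of the
    trajectory may be too large at a nearby x. Truncating it costs about [Cb] times the distance;
    being linear, this cost only raises the Gronwall rate of the tube. Rounding to the grid costs a
    multiple of dx/h = (Nt/Ns)/T, and this is one place where Nt/Ns -> 0 enters; the other is the
    interpolation shift CI dx, summed over Nt steps. The continuous controls have no common modulus
    of continuity, so the mesh required by a tube depends on its trajectory. The width of the tube
    does not, and this is why a finite net gives a common mesh. Moduli of the costs are taken at the
    limit flow, with the measure free near it; passing from mu(t0) to m_n(t) through mu(t) is what
    calls for the triangle inequality for [d1]. The running cost along a merely measurable control
    is never shown to be measurable: it is only compared with measurable majorants or minorants. *)

Section max_norm.
Context {R : realType}.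
Implicit Types (m n r q : nat).

Lemma mx_norm_coord m n (x : 'M[R]_(m, n)) i j : `|x i j| <= `|x|.
Proof.
rewrite [leRHS]/Num.norm /= mx_normrE.
by apply/bigmax_geP; right; exists (i, j).
Qed.

Lemma mx_norm_le m n (x : 'M[R]_(m, n)) (c : R) :
  0 <= c -> (forall i j, `|x i j| <= c) -> `|x| <= c.
Proof.
move=> c0 xc; rewrite [leLHS]/Num.norm /= mx_normrE.
by apply/bigmax_leP; split => // -[i j] _; exact: xc.
Qed.

Lemma cV_norm_le n (x : 'cV[R]_n) (c : R) :
  0 <= c -> (forall i, `|x i 0| <= c) -> `|x| <= c.
Proof. by move=> c0 xc; apply: mx_norm_le => // i j; rewrite ord1. Qed.

Lemma norm_mulmx m n (M : 'M[R]_(m, n)) (v : 'cV[R]_n) :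
  `|M *m v| <= n%:R * `|M| * `|v|.
Proof.
apply: cV_norm_le => [|i]; first by rewrite !mulr_ge0.
rewrite mxE (le_trans (ler_norm_sum _ _ _))//.
have -> : n%:R * `|M| * `|v| = \sum_(j < n) (`|M| * `|v|).
  by rewrite sumr_const card_ord -mulrA mulr_natl.
by apply: ler_sum => j _; rewrite normrM ler_pM// mx_norm_coord.
Qed.

Lemma norm_usubmx r q (x : 'cV[R]_(r + q)) : `|usubmx x| <= `|x|.
Proof. by apply: mx_norm_le => // i j; rewrite mxE mx_norm_coord. Qed.

Lemma norm_usubmx_mx r q m (x : 'M[R]_(r + q, m)) : `|usubmx x| <= `|x|.
Proof. by apply: mx_norm_le => // i j; rewrite mxE mx_norm_coord. Qed.

Lemma norm_split_le r q (x : 'cV[R]_(r + q)) (c : R) :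
  `|usubmx x| <= c -> `|dsubmx x| <= c -> `|x| <= c.
Proof.
move=> uc dc; apply: cV_norm_le => [|i]; first exact: le_trans uc.
rewrite -[x]vsubmxK mxE; case: splitP => j _.
  by apply: le_trans uc; rewrite mx_norm_coord.
by apply: le_trans dc; rewrite mx_norm_coord.
Qed.

Definition clamp (a b s : R) : R := Num.max a (Num.min b s).

(** In the maximum norm a closed ball is a cube, so truncating each coordinate retracts onto it and
    does not increase the distance to any of its points. *)
Definition clampv n (c : R) (v : 'cV[R]_n) : 'cV[R]_n :=
  map_mx (clamp (- c) c) v.

Lemma clamp_itv (a b s : R) : a <= b -> a <= clamp a b s <= b.
Proof. by move=> ab; rewrite /clamp le_max lexx ge_max ab ge_min lexx. Qed.

Lemma clamp_in (a b s : R) : a <= b -> clamp a b s \in `[a, b].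
Proof. by move=> ab; rewrite in_itv /= clamp_itv. Qed.

Lemma clamp_id (a b s : R) : a <= s <= b -> clamp a b s = s.
Proof. by move=> /andP[h1 h2]; rewrite /clamp (min_idPr h2) (max_idPr h1). Qed.

Lemma clamp_lip (a b s t : R) : `|clamp a b s - clamp a b t| <= `|s - t|.
Proof.
rewrite /clamp /Num.min /Num.max ler_norml.
have := ler_norm (s - t); have := ler_norm (t - s); rewrite (distrC t) => ? ?.
by case: (ltP b s) => ?; case: (ltP b t) => ?; case: ltP => ?; case: ltP => ?; lra.
Qed.

Lemma clamp_dist (b s t : R) : 0 <= b -> `|t| <= b -> `|clamp (- b) b s - t| <= `|s - t|.
Proof.
move=> b0 tb; rewrite -{1}(@clamp_id (- b) b t); first exact: clamp_lip.
by rewrite -ler_norml.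
Qed.

Lemma clamp_excess (b c s : R) : 0 <= b -> `|s| <= c -> b <= c ->
  `|clamp (- b) b s - s| <= c - b.
Proof.
move=> b0 + bc; rewrite !ler_norml /clamp /Num.min /Num.max => /andP[? ?].
by case: (ltP b s) => ?; case: ltP => ?; lra.
Qed.

Lemma norm_clampv n (c : R) (v : 'cV[R]_n) : 0 <= c -> `|clampv c v| <= c.
Proof.
by move=> c0; apply: cV_norm_le => // i; rewrite mxE ler_norml clamp_itv// ge0_cp.
Qed.

Lemma clampv_id n (c : R) (v : 'cV[R]_n) : `|v| <= c -> clampv c v = v.
Proof.
move=> vc; apply/colP => i; rewrite mxE clamp_id// -ler_norml.
by rewrite (le_trans _ vc)// mx_norm_coord.
Qed.

Lemma clampv_dist n (c : R) (v w : 'cV[R]_n) : 0 <= c -> `|w| <= c ->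
  `|clampv c v - w| <= `|v - w|.
Proof.
move=> c0 wc; apply: cV_norm_le => // i; rewrite !mxE.
apply: le_trans (clamp_dist _ c0 _) _.
  by rewrite (le_trans _ wc)// mx_norm_coord.
by have := mx_norm_coord (v - w) i 0; rewrite !mxE.
Qed.

Lemma clampv_excess n (c b : R) (v : 'cV[R]_n) : 0 <= c -> `|v| <= b -> c <= b ->
  `|clampv c v - v| <= b - c.
Proof.
move=> c0 vb cb; apply: cV_norm_le => [|i]; first by rewrite subr_ge0.
rewrite !mxE; apply: clamp_excess => //.
by rewrite (le_trans _ vb)// mx_norm_coord.
Qed.

Lemma clamp_continuous (a b : R) : continuous (clamp a b).
Proof.
move=> s; apply: (@continuous_max _ _ (fun=> a) (Num.min b) s).
  exact: cst_continuous.
by apply: (@continuous_min _ _ (fun=> b) id s); [exact: cst_continuous|exact: cvg_id].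
Qed.

Lemma cV_continuous (T : topologicalType) n (f : T -> 'cV[R]_n) :
  (forall i, continuous (fun s => f s i 0)) -> continuous f.
Proof.
move=> cf s; apply/cvgrPdist_le => e e0.
have : \forall t \near s, forall i, `|f s i 0 - f t i 0| <= e.
  apply: filter_forall => i.
  by have /cvgrPdist_le := cf i s; apply.
apply: filterS => t ft; apply: cV_norm_le; first exact: ltW.
by move=> i; rewrite !mxE.
Qed.

Lemma continuous_coord (T : topologicalType) m n (f : T -> 'M[R]_(m, n)) i j :
  continuous f -> continuous (fun s => f s i j).
Proof. move=> cf s.
by apply: (@continuous_comp _ _ _ f (fun M : 'M[R]_(m, n) => M i j) s); [exact: cf|exact: coord_continuous]. Qed.

End max_norm.

(** * Bounded measurable functions and their integrals *)

Section bounded_measurable.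
Context {R : realType}.
Local Notation leb := (@lebesgue_measure R).
Implicit Types f g : R -> R.

(** Asked on the whole line, so that integrability on every compact interval comes without side
    conditions. *)
Definition bm f := measurable_fun [set: R] f /\ exists M, forall s, `|f s| <= M.

Definition Int (a b : R) f : R := \int[leb]_(s in `[a, b]) f s.

Lemma bm_cst (c : R) : bm (fun=> c).
Proof. by split; [exact: measurable_cst|exists `|c|]. Qed.

Lemma bmD f g : bm f -> bm g -> bm (fun s => f s + g s).
Proof.
move=> [mf [M fM]] [mg [N gN]]; split; first exact: measurable_funD.
by exists (M + N) => s; rewrite (le_trans (ler_normD _ _))// lerD.
Qed.

Lemma bmN f : bm f -> bm (fun s => - f s).
Proof.
move=> [mf [M fM]]; split; first exact: measurableT_comp.
by exists M => s; rewrite normrN.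
Qed.

Lemma bmB f g : bm f -> bm g -> bm (fun s => f s - g s).
Proof. by move=> bf bg; apply: bmD => //; exact: bmN. Qed.

Lemma bmM f g : bm f -> bm g -> bm (fun s => f s * g s).
Proof.
move=> [mf [M fM]] [mg [N gN]]; split; first exact: measurable_funM.
by exists (M * N) => s; rewrite normrM ler_pM.
Qed.

Lemma bm_sum (I : Type) (l : seq I) (F : I -> R -> R) :
  (forall i, bm (F i)) -> bm (fun s => \sum_(i <- l) F i s).
Proof.
move=> bF; elim: l => [|i l ih].
  by under eq_fun do rewrite big_nil; exact: bm_cst.
by under eq_fun do rewrite big_cons; exact: bmD.
Qed.

Lemma bm_norm f : bm f -> bm (fun s => `|f s|).
Proof.
move=> [mf [M fM]]; split; first exact: measurableT_comp.
by exists M => s; rewrite normr_id.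
Qed.

Lemma bm_continuous f : continuous f -> (exists M, forall s, `|f s| <= M) -> bm f.
Proof.
move=> cf bf; by split => //; exact: continuous_measurable_fun.
Qed.

Lemma bm_integrable (a b : R) f : bm f -> leb.-integrable `[a, b] (EFin \o f).
Proof.
move=> [mf [M fM]]; apply: measurable_bounded_integrable => //.
- by rewrite /= lebesgue_measure_itv /=; case: ifPn; rewrite ?ltry.
- exact: measurable_funTS.
- exists M; split; first exact: num_real.
  by move=> x Mx y /= _; exact: le_trans (fM y) (ltW Mx).
Qed.

Lemma Int_cst (a b c : R) : a <= b -> Int a b (fun=> c) = c * (b - a).
Proof.
move=> ab; rewrite /Int Rintegral_cst//= lebesgue_measure_itv /= lte_fin.
by case: ltgtP ab => // -> _; rewrite subrr.
Qed.

Lemma IntD (a b : R) f g : bm f -> bm g ->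
  Int a b (fun s => f s + g s) = Int a b f + Int a b g.
Proof. by move=> bf bg; rewrite /Int RintegralD//; exact: bm_integrable. Qed.

Lemma IntB (a b : R) f g : bm f -> bm g ->
  Int a b (fun s => f s - g s) = Int a b f - Int a b g.
Proof. by move=> bf bg; rewrite /Int RintegralB//; exact: bm_integrable. Qed.

Lemma IntZ (a b k : R) f : bm f -> Int a b (fun s => k * f s) = k * Int a b f.
Proof. by move=> bf; rewrite /Int RintegralZl//; exact: bm_integrable. Qed.

Lemma Int_eq (a b : R) f g : (forall s, a <= s <= b -> f s = g s) ->
  Int a b f = Int a b g.
Proof.
by move=> fg; apply: eq_Rintegral => s; rewrite inE /= in_itv /= => /fg.
Qed.

Lemma Int_le (a b : R) f g : bm f -> bm g ->
  (forall s, a <= s <= b -> f s <= g s) -> Int a b f <= Int a b g.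
Proof.
move=> bf bg fg; apply: le_Rintegral; [by []|exact: bm_integrable|exact: bm_integrable|].
by move=> s /=; rewrite in_itv /= => /fg.
Qed.

(** The right endpoint is negligible, and is left out because step functions jump there. *)
Lemma Int_le_co (a b : R) f g : bm f -> bm g ->
  (forall s, a <= s < b -> f s <= g s) -> Int a b f <= Int a b g.
Proof.
move=> bf bg fg.
have ico h : bm h -> leb.-integrable `[a, b[ (EFin \o h).
  move=> bh; apply: integrableS (bm_integrable a b bh) => //.
  by apply: subset_itvl; rewrite bnd_simp.
rewrite /Int -!Rintegral_itv_bndo_bndc; [|exact: ico|exact: ico].
apply: le_Rintegral; [by []|exact: ico|exact: ico|].
by move=> s /=; rewrite in_itv /= => /fg.
Qed.

Lemma Int_norm (a b : R) f : bm f -> `|Int a b f| <= Int a b (fun s => `|f s|).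
Proof. by move=> bf; apply: le_normr_Rintegral => //; exact: bm_integrable. Qed.

Lemma Int_bound_co (a b M : R) f : a <= b -> bm f ->
  (forall s, a <= s < b -> `|f s| <= M) -> `|Int a b f| <= M * (b - a).
Proof.
move=> ab bf fM; apply: le_trans (Int_norm _ _ bf) _; rewrite -Int_cst//.
by apply: Int_le_co => //; [exact: bm_norm|exact: bm_cst].
Qed.

Lemma Int_bound (a b M : R) f : a <= b -> bm f ->
  (forall s, a <= s <= b -> `|f s| <= M) -> `|Int a b f| <= M * (b - a).
Proof.
move=> ab bf fM; apply: Int_bound_co => // s /andP[h1 h2].
by apply: fM; rewrite h1 ltW.
Qed.

Lemma Int_chasles (a b c : R) f : a <= b -> b <= c -> bm f ->
  Int a c f = Int a b f + Int b c f.
Proof.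
move=> ab bc bf; apply/eqP; rewrite addrC -subr_eq; apply/eqP.
rewrite /Int Rintegral_itvB ?bnd_simp//; last exact: bm_integrable.
rewrite Rintegral_itv_obnd_cbnd//.
apply: integrableS (bm_integrable b c bf) => //.
by apply: subset_itvr; rewrite bnd_simp.
Qed.

Lemma Int_aa (a : R) f : bm f -> Int a a f = 0.
Proof. by move=> bf; rewrite /Int set_itv1 Rintegral_set1. Qed.

Lemma Int_dev (a b c e : R) f : a <= b -> bm f ->
  (forall s, a <= s < b -> `|f s - c| <= e) ->
  `|Int a b f - (b - a) * c| <= (b - a) * e.
Proof.
move=> ab bf fe; rewrite (mulrC _ c) -Int_cst// -IntB//; last exact: bm_cst.
rewrite (mulrC _ e); apply: Int_bound_co => //.
by apply: bmB => //; exact: bm_cst.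
Qed.

Lemma Int_lipschitz (t a b M : R) f : bm f -> (forall s, `|f s| <= M) ->
  t <= a -> a <= b -> `|Int t b f - Int t a f| <= M * (b - a).
Proof.
move=> bf fM ta ab; rewrite (@Int_chasles t a b)// addrAC subrr add0r.
by apply: Int_bound => // s _.
Qed.

Lemma Int_derive (t : R) f : bm f ->
  {ae leb, forall s : R, t < s -> is_derive s (1 : R) (fun s => Int t s f) (f s)}.
Proof.
move=> bf.
have locf : locally_integrable [set: R] f.
  split; [by case: bf|exact: openT|] => K _ cK.
  have [M [_ KM]] := compact_bounded cK.
  have KM1 : K `<=` `[- (M + 1), M + 1].
    move=> x /(KM (M + 1)) xM; rewrite /= in_itv /= -ler_norml; apply: xM.
    by rewrite ltrDl.
  have /integrableP[_] := bm_integrable (- (M + 1)) (M + 1) bf.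
  apply: le_lt_trans; apply: ge0_subset_integral => //.
  - exact: compact_measurable.
  - apply/measurable_EFinP; apply: measurableT_comp => //.
    by case: bf => mf _; exact: measurable_funTS.
have := FTC1 (a := BLeft t) (fun y => bm_integrable t y bf) locf.
apply: filterS; first exact: (ae_filter_ringOfSetsType leb).
move=> s /= + ts; case=> [|df <-]; first by rewrite lte_fin.
by rewrite derive1E; apply/derivableP.
Qed.

(* The integral of a nonnegative function is a supremum over simple functions
   below it, so that no measurability is required. *)
Lemma le_integral_nonmeasurable d (U : measurableType d)
    (mu : {measure set U -> \bar R}) (D : set U) (F G : U -> \bar R) :
  (forall x, D x -> (F x <= G x)%E) ->
  (\int[mu]_(x in D) F x <= \int[mu]_(x in D) G x)%E.
Proof.
move=> FG; rewrite (integral_mkcond D F) (integral_mkcond D G) /integral !patch_setT.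
have FGr x : ((F \_ D) x <= (G \_ D) x)%E.
  by rewrite !patchE; case: ifPn => //; rewrite inE => /FG.
apply: leeB; apply: ereal_sup_le => _ [h hf <-]; exists h => // x; apply: le_trans (hf x) _.
- by apply: (@funepos_le _ _ setT); rewrite ?inE// => y _; exact: FGr.
- by apply: (@funeneg_le _ _ setT); rewrite ?inE// => y _; exact: FGr.
Qed.

End bounded_measurable.

(** * Coordinatewise integrals of vector-valued functions *)

Section vector_integral.
Context {R : realType} (n : nat).
Implicit Types f g : R -> 'cV[R]_n.

Definition vbm f := forall i, bm (fun s => f s i 0).

Definition vint (a b : R) f : 'cV[R]_n := \col_i Int a b (fun s => f s i 0).

Lemma vbm_bounded f : vbm f -> exists2 M : R, 0 <= M & forall s, `|f s| <= M.
Proof.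
move=> bf.
have /choice[M fM] : forall i, exists M : R, forall s, `|f s i 0| <= M.
  by move=> i; have [_] := bf i.
exists (\sum_i `|M i|); first exact: sumr_ge0.
move=> s; apply: cV_norm_le => [|i]; first exact: sumr_ge0.
rewrite (bigD1 i)//= (le_trans (fM i s))// (le_trans (ler_norm _))//.
by rewrite lerDl sumr_ge0.
Qed.

Lemma vbm_norm f : vbm f -> bm (fun s => `|f s|).
Proof.
move=> bf; have [M _ fM] := vbm_bounded bf; split; last first.
  by exists M => s; rewrite normr_id.
have -> : (fun s => `|f s|) = (fun s => \big[Num.max/0]_(i < n) `|f s i 0|).
  apply/funext => s; apply/eqP; rewrite eq_le; apply/andP; split.
    apply: cV_norm_le => [|i]; first by apply/bigmax_geP; left.
    by apply/bigmax_geP; right; exists i.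
  by apply/bigmax_leP; split => // i _; exact: mx_norm_coord.
elim: (index_enum _) => [|i l ih].
  by under eq_fun do rewrite big_nil; exact: measurable_cst.
under eq_fun do rewrite big_cons.
apply: measurable_maxr => //.
by have [mf _] := bf i; exact: measurableT_comp.
Qed.

Lemma vbmB f g : vbm f -> vbm g -> vbm (fun s => f s - g s).
Proof. by move=> bf bg i; under eq_fun do rewrite !mxE; exact: bmB. Qed.

Lemma vbm_continuous f : continuous f -> (exists M : R, forall s, `|f s| <= M) ->
  vbm f.
Proof.
move=> cf [M fM] i; apply: bm_continuous; first exact: continuous_coord.
by exists M => s; rewrite (le_trans _ (fM s))// mx_norm_coord.
Qed.

Lemma vintB (a b : R) f g : vbm f -> vbm g ->
  vint a b (fun s => f s - g s) = vint a b f - vint a b g.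
Proof.
move=> bf bg; apply/colP => i; rewrite !mxE -IntB//.
by apply: Int_eq => s _; rewrite !mxE.
Qed.

Lemma vint_chasles (a b c : R) f : a <= b -> b <= c -> vbm f ->
  vint a c f = vint a b f + vint b c f.
Proof. by move=> ab bc bf; apply/colP => i; rewrite !mxE (@Int_chasles _ a b c). Qed.

Lemma vint_aa (a : R) f : vbm f -> vint a a f = 0.
Proof. by move=> bf; apply/colP => i; rewrite !mxE Int_aa. Qed.

Lemma vint_le (a b : R) f (phi : R -> R) : a <= b -> vbm f -> bm phi ->
  (forall s, a <= s <= b -> `|f s| <= phi s) -> `|vint a b f| <= Int a b phi.
Proof.
move=> ab bf bphi fphi; apply: cV_norm_le => [|i].
  by apply: Rintegral_ge0 => s /=; rewrite in_itv /= => /fphi; exact: le_trans.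
rewrite mxE (le_trans (Int_norm _ _ _))//; apply: Int_le => //; first exact: bm_norm.
by move=> s /fphi; apply: le_trans; exact: mx_norm_coord.
Qed.

Lemma vint_bound_co (a b M : R) f : a <= b -> vbm f ->
  (forall s, a <= s < b -> `|f s| <= M) -> 0 <= M -> `|vint a b f| <= M * (b - a).
Proof.
move=> ab bf fM M0; apply: cV_norm_le => [|i]; first by rewrite mulr_ge0// subr_ge0.
rewrite mxE; apply: Int_bound_co => // s /fM; apply: le_trans.
exact: mx_norm_coord.
Qed.

Lemma vint_dev (a b e : R) f v : a <= b -> vbm f -> 0 <= e ->
  (forall s, a <= s < b -> `|f s - v| <= e) ->
  `|vint a b f - (b - a) *: v| <= (b - a) * e.
Proof.
move=> ab bf e0 fe; apply: cV_norm_le => [|i]; first by rewrite mulr_ge0// subr_ge0.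
rewrite !mxE; apply: Int_dev => // s /fe; apply: le_trans.
by have := mx_norm_coord (f s - v) i 0; rewrite !mxE.
Qed.

Lemma vint_lipschitz (t a b M : R) f : vbm f -> (forall s, `|f s| <= M) ->
  t <= a -> a <= b -> `|vint t b f - vint t a f| <= M * (b - a).
Proof.
move=> bf fM ta ab; have M0 : 0 <= M by exact: le_trans (fM 0).
rewrite (@vint_chasles t a b)// addrAC subrr add0r.
by apply: vint_bound_co.
Qed.

End vector_integral.

(** * Caratheodory equations *)

Section weights.
Context {R : realType}.
Implicit Types K t T s : R.

(** Clamping time makes the weight bounded on the whole line, hence [bm]. *)
Definition expw K t T s : R := expR (K * (clamp t T s - t)).

Lemma expw_continuous K t T : continuous (expw K t T).
Proof.
move=> s; apply: (@continuous_comp _ _ _ (fun s => K * (clamp t T s - t)) expR).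
  by apply: cvgM; [exact: cvg_cst|apply: cvgB; [exact: clamp_continuous|exact: cvg_cst]].
exact: continuous_expR.
Qed.

Lemma expw_ge1 K t T s : 0 <= K -> t <= T -> 1 <= expw K t T s.
Proof.
move=> K0 tT; rewrite -expR0 ler_expR mulr_ge0// subr_ge0.
by case/andP: (clamp_itv s tT).
Qed.

Lemma expw_le K t T s : 0 <= K -> t <= T -> expw K t T s <= expR (K * (T - t)).
Proof.
move=> K0 tT; rewrite ler_expR ler_wpM2l// lerD2r.
by case/andP: (clamp_itv s tT).
Qed.

Lemma bm_expw K t T : 0 <= K -> t <= T -> bm (expw K t T).
Proof.
move=> K0 tT; apply: bm_continuous; first exact: expw_continuous.
exists (expR (K * (T - t))) => s; rewrite ger0_norm ?expR_ge0//.
exact: expw_le.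
Qed.

(** Integration gains the factor 1/K. With K = 2L this halves an error that has been multiplied by
    the Lipschitz constant L; Gronwall's inequality and Picard's iteration both rest on it. *)
Lemma Int_expw K t T s : 0 < K -> t <= s <= T ->
  Int t s (expw K t T) <= expw K t T s / K.
Proof.
move=> K0 /andP[ts sT]; have tT := le_trans ts sT.
have [ts'|st] := ltP t s; last first.
  have -> : s = t by apply/eqP; rewrite eq_le st.
  by rewrite Int_aa ?divr_ge0 ?expR_ge0//; [exact: ltW|apply: bm_expw => //; exact: ltW].
pose F u := expR (K * (u - t)) * K^-1.
have dF (u : R) : is_derive u (1 : R) F (expR (K * (u - t))).
  have d1 : is_derive u (1 : R) (fun u : R => K * (u - t)) K.
    by apply: is_derive_eq; rewrite /= subr0 [_ *: _]mulr1.
  have d2 := @is_derive1_comp R expR (fun u : R => K * (u - t)) u _ _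
    (is_derive_expR (K * (u - t))) d1.
  apply: is_derive_eq; rewrite scaler0 add0r.
  by rewrite /GRing.scale /= mulrC -mulrA mulfV ?mulr1// gt_eqF.
have cF (u : R) : {for u, continuous F}.
  by apply: differentiable_continuous; apply/derivable1_diffP; case: (dF u).
have -> : Int t s (expw K t T) = Int t s (fun u => expR (K * (u - t))).
  apply: Int_eq => u /andP[tu us]; rewrite /expw clamp_id// tu.
  exact: le_trans us sT.
have -> : expw K t T s = expR (K * (s - t)) by rewrite /expw clamp_id// ts.
rewrite /Int /Rintegral (@continuous_FTC2 _ _ F)//.
- by rewrite -EFinB /= lerBlDr lerDl divr_ge0 ?expR_ge0 ?ltW.
- apply: continuous_subspaceT => u.
  apply: (@continuous_comp _ _ _ (fun u : R => K * (u - t)) expR).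
    by apply: cvgM; [exact: cvg_cst|apply: cvgB; [exact: cvg_id|exact: cvg_cst]].
  exact: continuous_expR.
- split; first by move=> u _; case: (dF u).
    by apply: cvg_at_right_filter; exact: cF.
  by apply: cvg_at_left_filter; exact: cF.
- by move=> u _; rewrite derive1E; case: (dF u).
Qed.

Lemma expn2_small (C e : R) : 0 < e -> exists n, C / 2 ^+ n < e.
Proof.
move=> e0; exists (Num.bound `|C / e|).
rewrite ltr_pdivrMr ?exprn_gt0// mulrC -ltr_pdivrMr//.
apply: le_lt_trans (ler_norm _) _.
apply: lt_trans (archi_boundP (normr_ge0 (C / e))) _.
by rewrite -natrX ltr_nat ltn_expl.
Qed.

(** The excess of f over [2 * a * W] starts from a crude bound [M0] of f. Substituting the current
    bound into the hypothesis halves it and adds a, and since W >= 1 this halves the excess. The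
    factor 2 and the rate 2L are the price of avoiding differentiation. *)
Lemma gronwall t T (a L : R) (f : R -> R) : 0 <= a -> 0 < L -> t <= T -> bm f ->
  (forall s, t <= s <= T -> f s <= a + L * Int t s f) ->
  forall s, t <= s <= T -> f s <= 2 * a * expw (2 * L) t T s.
Proof.
move=> a0 L0 tT bf fa.
pose W := expw (2 * L) t T.
have L20 : 0 < 2 * L by rewrite mulr_gt0.
have bW : bm W by apply: bm_expw => //; exact: ltW.
have W1 s : 1 <= W s by apply: expw_ge1 => //; exact: ltW.
have [_ [M0 fM0]] := bf.
have M00 : 0 <= M0 by exact: le_trans (fM0 0).
have H k s : t <= s <= T -> f s <= (2 * a + M0 / 2 ^+ k) * W s.
  elim: k s => [|k ih] s sT.
    rewrite expr0 divr1 (le_trans (ler_norm _))// (le_trans (fM0 s))//.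
    by rewrite (@le_trans _ _ (2 * a + M0))// ?ler_peMr// ?lerDr ?addr_ge0// mulr_ge0.
  apply: (le_trans (fa _ sT)).
  have /andP[ts sT'] := sT.
  have : Int t s f <= (2 * a + M0 / 2 ^+ k) * (W s / (2 * L)).
    apply: (@le_trans _ _ (Int t s (fun u => (2 * a + M0 / 2 ^+ k) * W u))).
      apply: Int_le => //.
        by apply: bmM => //; exact: bm_cst.
      by move=> u /andP[tu us]; apply: ih; rewrite tu (le_trans us).
    rewrite IntZ//; apply: ler_wpM2l; last exact: Int_expw.
    by rewrite addr_ge0// ?mulr_ge0// divr_ge0// exprn_ge0.
  move=> /(ler_wpM2l (ltW L0)) /(lerD (lexx a)) /le_trans; apply.
  have -> : L * ((2 * a + M0 / 2 ^+ k) * (W s / (2 * L))) =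
            (a + M0 / 2 ^+ k.+1) * W s.
    by rewrite exprS; field; rewrite expf_neq0//= gt_eqF.
  rewrite -subr_ge0.
  have -> : (2 * a + M0 / 2 ^+ k.+1) * W s - (a + (a + M0 / 2 ^+ k.+1) * W s)
    = a * (W s - 1) by ring.
  by rewrite mulr_ge0// subr_ge0.
move=> s sT; apply/ler_addgt0Pr => e e0.
have [k ke] := expn2_small (M0 * W s) e0.
apply: (le_trans (H k s sT)); rewrite mulrDl lerD2l ltW//.
by rewrite mulrAC.
Qed.

End weights.

(** * Existence, bounds and stability of solutions *)

Section ode.
Context {R : realType} (n : nat).
Local Notation V := 'cV[R]_n.
Implicit Types (F : R -> V -> V) (gam : R -> V) (t T s : R).

(** Measurability is asked along continuous curves only: this is what the integral equation needs
    and what a continuous drift plus a measurable control provides. *)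
Record ode_field (L M : R) F : Prop := {
  ode_lip : forall s y z, `|F s y - F s z| <= L * `|y - z| ;
  ode_bnd : forall s, `|F s 0| <= M ;
  ode_meas : forall gam, continuous gam ->
    forall i, measurable_fun setT (fun s => F s (gam s) i 0) }.

Definition cb gam := continuous gam /\ exists M : R, forall s, `|gam s| <= M.

(** The curve is bounded and continuous on the whole line, although the equation is imposed on
    [[t, T]] only; integrands along it are then [vbm] without restricting the domain. *)
Definition sol F t T (x : V) gam :=
  cb gam /\ forall s, t <= s <= T -> gam s = x + vint t s (fun u => F u (gam u)).

Lemma cb_vbm gam : cb gam -> vbm gam.
Proof. by move=> [cg bg]; exact: vbm_continuous. Qed.

Lemma ode_growth L M F : ode_field L M F -> forall s y, `|F s y| <= M + L * `|y|.
Proof.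
move=> HF s y; rewrite -[F s y](subrK (F s 0)) addrC.
apply: le_trans (ler_normD _ _) _; apply: lerD; first exact: (ode_bnd HF).
by apply: le_trans (ode_lip HF _ _ _) _; rewrite subr0.
Qed.

Lemma ode_vbm L M F gam : 0 <= L -> ode_field L M F -> cb gam ->
  vbm (fun s => F s (gam s)).
Proof.
move=> L0 HF [cg [N gN]] i; split; first exact: (ode_meas HF).
exists (M + L * N) => s; apply: le_trans (mx_norm_coord _ _ _) _.
by apply: le_trans (ode_growth HF _ _) _; rewrite lerD2l ler_wpM2l.
Qed.

(** Each lower end of the intervals of radius [C / 2 ^+ j] about [u j] is below each upper end, so
    the supremum of the lower ends lies in all of them. The rate comes with the limit. *)
Lemma limit_geometric (u : nat -> R) (C : R) :
  (forall k j, (j <= k)%N -> `|u k - u j| <= C / 2 ^+ j) ->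
  exists l, forall j, `|u j - l| <= C / 2 ^+ j.
Proof.
move=> uC; pose A := [set u j - C / 2 ^+ j | j in [set: nat]].
have ub k : ubound A (u k + C / 2 ^+ k).
  move=> _ [j _ <-]; have /orP[jk|kj] := leq_total j k.
    have := uC _ _ jk; rewrite ler_norml => /andP[? ?].
    have : 0 <= C / 2 ^+ k by apply: le_trans (uC k k _).
    by move=> ?; lra.
  have := uC _ _ kj; rewrite ler_norml => /andP[? ?].
  have : 0 <= C / 2 ^+ j by apply: le_trans (uC j j _).
  by move=> ?; lra.
have hsA : has_sup A by split; [exists (u 0%N - C / 2 ^+ 0), 0%N|exists (u 0%N + C / 2 ^+ 0)].
exists (sup A) => j; rewrite distrC ler_norml lerBlDl lerBrDl; apply/andP; split.
  by apply: sup_upper_bound => //; exists j.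
by apply: ge_sup; [case: hsA|exact: ub].
Qed.

Lemma limit_geometric_vec (g : nat -> V) (C : R) : 0 <= C ->
  (forall k j, (j <= k)%N -> `|g k - g j| <= C / 2 ^+ j) ->
  exists l, forall j, `|g j - l| <= C / 2 ^+ j.
Proof.
move=> C0 gC.
have /choice[l lE] : forall i, exists l, forall j, `|g j i 0 - l| <= C / 2 ^+ j.
  move=> i; apply: limit_geometric => k j /gC; apply: le_trans.
  by have := mx_norm_coord (g k - g j) i 0; rewrite !mxE.
exists (\col_i l i) => j; apply: cV_norm_le; first by rewrite divr_ge0// exprn_ge0.
by move=> i; rewrite !mxE.
Qed.

Lemma clamp_mono t T : {homo clamp t T : s s' / s <= s'}.
Proof.
move=> s s' ss'; rewrite /clamp le_max2// le_min ge_min lexx/= .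
by rewrite ge_min ss' orbT.
Qed.

Lemma lipschitz_continuous (g : R -> V) (N : R) :
  (forall s s', s <= s' -> `|g s' - g s| <= N * (s' - s)) -> continuous g.
Proof.
move=> gN s; apply/cvgrPdist_lt => e e0.
have N0 : 0 <= N.
  by have := gN 0 1 ler01; rewrite subr0 mulr1; exact: le_trans.
near=> u.
have -> : `|g s - g u| = `|g (Num.max s u) - g (Num.min s u)|.
  by rewrite /Num.max /Num.min; case: ltP => //; rewrite distrC.
apply: le_lt_trans (gN _ _ _) _; first by rewrite ge_min le_max lexx.
have -> : Num.max s u - Num.min s u = `|s - u|.
  rewrite /Num.max /Num.min; case: ltP => su; last by rewrite ger0_norm// subr_ge0.
  by rewrite distrC gtr0_norm// subr_gt0.
apply: (@le_lt_trans _ _ ((N + 1) * `|s - u|)).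
  by rewrite ler_wpM2r// lerDl.
rewrite -ltr_pdivlMl ?ltr_wpDl//.
near: u; apply: (@cvgr_dist_lt _ _ _ (nbhs s) _ id) => //.
by rewrite mulr_gt0// invr_gt0 ltr_wpDl.
Unshelve. all: by end_near. Qed.

Lemma vint_primitive_cb t T (x : V) (f : R -> V) : t <= T -> vbm f ->
  cb (fun s => x + vint t (clamp t T s) f).
Proof.
move=> tT bf; have [M M0 fM] := vbm_bounded bf.
have lip s s' : s <= s' ->
    `|(x + vint t (clamp t T s') f) - (x + vint t (clamp t T s) f)| <= M * (s' - s).
  move=> ss'; rewrite opprD addrACA subrr add0r.
  have /andP[ts sT] := clamp_itv s tT.
  apply: le_trans (vint_lipschitz bf fM ts (clamp_mono _ _ ss')) _.
  rewrite ler_wpM2l//; apply: le_trans (ler_norm _) _.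
  by apply: le_trans (clamp_lip _ _ _ _) _; rewrite ger0_norm// subr_ge0.
split; first exact: lipschitz_continuous lip.
exists (`|x| + M * (T - t)) => s; apply: le_trans (ler_normD _ _) _.
have /andP[ts sT] := clamp_itv s tT.
rewrite lerD2l; apply: (@le_trans _ _ (M * (clamp t T s - t))).
  by apply: vint_bound_co => // u _; exact: fM.
by rewrite ler_wpM2l// lerD2r.
Qed.

Lemma cb_uniform_limit (g : nat -> R -> V) gam (C : R) :
  (forall j, cb (g j)) -> (forall s j, `|g j s - gam s| <= C / 2 ^+ j) -> cb gam.
Proof.
move=> cg gC; split; last first.
  have [_ [M gM]] := cg 0%N; exists (M + C) => s.
  rewrite -[gam s](subrK (g 0%N s)) addrC (le_trans (ler_normD _ _))// lerD//.
  by rewrite distrC; have := gC s 0%N; rewrite expr0 divr1.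
move=> s; apply/cvgrPdist_lt => e e0.
have [j je] := expn2_small C (divr_gt0 e0 (ltr0Sn R 2)).
have [cj _] := cg j.
near=> u.
have -> : gam s - gam u = (gam s - g j s) + (g j s - g j u) + (g j u - gam u).
  by rewrite !addrA !subrK.
have : `|g j s - g j u| < e / 3.
  near: u; have /cvgrPdist_lt := cj s; apply; exact: divr_gt0.
have := gC s j; have := gC u j; rewrite (distrC (g j s)).
have := ler_normD ((gam s - g j s) + (g j s - g j u)) (g j u - gam u).
have := ler_normD (gam s - g j s) (g j s - g j u).
by move=> *; lra.
Unshelve. all: by end_near. Qed.

(* Picard iteration, contracting by 1/2 for the norm weighted by exp(-2L(s-t)). *)
Lemma ode_exists (L M : R) F t T (x : V) : 0 < L -> t <= T -> ode_field L M F ->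
  exists gam, sol F t T x gam.
Proof.
move=> L0 tT HF.
have HFb g : cb g -> vbm (fun u => F u (g u)) by exact: ode_vbm (ltW L0) HF.
pose P (g : R -> V) s := x + vint t (clamp t T s) (fun u => F u (g u)).
pose g_ := fix g_ k := if k is j.+1 then P (g_ j) else (fun=> x).
have cg k : cb (g_ k).
  elim: k => [|k ih] /=; last exact: vint_primitive_cb (HFb _ ih).
  by split; [exact: cst_continuous|exists `|x|].
pose D := (M + L * `|x|) * (T - t).
have M0 : 0 <= M by apply: le_trans (ode_bnd HF 0).
have D0 : 0 <= D by rewrite mulr_ge0 ?subr_ge0// addr_ge0// mulr_ge0// ltW.
pose W := expw (2 * L) t T.
have L20 : 0 < 2 * L by rewrite mulr_gt0.
have bW : bm W by apply: bm_expw => //; exact: ltW.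
have W1 s : 1 <= W s by apply: expw_ge1 => //; exact: ltW.
have Wc s : W (clamp t T s) = W s.
  by rewrite /W /expw [in LHS]clamp_id//; exact: clamp_itv.
have step k s : `|g_ k.+1 s - g_ k s| <= D / 2 ^+ k * W s.
  elim: k s => [|k ih] s.
    rewrite /= /P addrAC subrr add0r expr0 divr1.
    have /andP[ts sT] := clamp_itv s tT.
    apply: (@le_trans _ _ ((M + L * `|x|) * (clamp t T s - t))).
      apply: vint_bound_co => //; first exact: (HFb _ (cg 0%N)).
        by move=> u _; exact: (ode_growth HF).
      by rewrite addr_ge0// mulr_ge0// ltW.
    apply: (@le_trans _ _ D); last by rewrite ler_peMr.
    by rewrite ler_wpM2l ?lerD2r// addr_ge0// mulr_ge0// ltW.
  have -> : g_ k.+2 s - g_ k.+1 s =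
      vint t (clamp t T s) (fun u => F u (g_ k.+1 u) - F u (g_ k u)).
    by rewrite vintB; [rewrite /= /P opprD addrACA subrr add0r|exact: HFb (cg k.+1)|exact: HFb (cg k)].
  have /andP[ts sT] := clamp_itv s tT.
  apply: (@le_trans _ _ (Int t (clamp t T s) (fun u => (L * (D / 2 ^+ k)) * W u))).
    apply: vint_le => //.
    - by apply: vbmB; apply: HFb.
    - by apply: bmM => //; exact: bm_cst.
    - move=> u _; apply: le_trans (ode_lip HF _ _ _) _.
      by rewrite -mulrA ler_wpM2l// ltW.
  rewrite IntZ//; have := @Int_expw R (2 * L) t T (clamp t T s) L20.
  rewrite -/W Wc clamp_itv// => /(_ isT).
  have c0 : 0 <= L * (D / 2 ^+ k) by rewrite mulr_ge0 ?divr_ge0 ?exprn_ge0// ltW.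
  move=> /(ler_wpM2l c0) /le_trans; apply.
  rewrite le_eqVlt; apply/orP; left; apply/eqP; rewrite exprS; field.
  by rewrite expf_neq0//= gt_eqF.
(* Replacing the weight by its maximum turns the weighted contraction into a geometric bound uniform
   in time. *)
pose E := D * expR (2 * L * (T - t)).
have E0 : 0 <= E by rewrite mulr_ge0// expR_ge0.
have stepE k s : `|g_ k.+1 s - g_ k s| <= E / 2 ^+ k.
  apply: le_trans (step k s) _; rewrite /E [leRHS]mulrAC.
  by rewrite ler_wpM2l ?divr_ge0 ?exprn_ge0// expw_le// ltW.
have E20 : 0 <= 2 * E by rewrite mulr_ge0.
have cauchy s k j : (j <= k)%N -> `|g_ k s - g_ j s| <= (2 * E) / 2 ^+ j.
  move=> /subnK <-; move: (k - j)%N => i {k}.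
  (* Subtracting the remaining tail makes the induction telescope. *)
  have : `|g_ (i + j)%N s - g_ j s| <= (2 * E) / 2 ^+ j - (2 * E) / 2 ^+ (i + j).
    elim: i => [|i ih]; first by rewrite add0n !subrr normr0.
    rewrite addSn -[g_ _.+1 s](subrK (g_ (i + j)%N s)) -addrA.
    apply: le_trans (ler_normD _ _) _.
    have := stepE (i + j)%N s; rewrite exprS.
    have -> : 2 * E / (2 * 2 ^+ (i + j)) = E / 2 ^+ (i + j).
      by field; rewrite expf_neq0.
    have -> : E / 2 ^+ (i + j) = 2 * E / 2 ^+ (i + j) - E / 2 ^+ (i + j).
      by field; rewrite expf_neq0.
    by move=> h; lra.
  have : 0 <= 2 * E / 2 ^+ (i + j) by rewrite divr_ge0// exprn_ge0.
  by move=> ? ?; lra.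
have /choice[gam gamE] : forall s, exists l, forall j, `|g_ j s - l| <= (2 * E) / 2 ^+ j.
  by move=> s; apply: limit_geometric_vec => // k j; exact: cauchy.
have cgam : cb gam by exact: cb_uniform_limit cg gamE.
exists gam; split=> // s /andP[ts sT].
(* No limit is taken under the integral: the limit curve and its Picard image are both compared with
   [g_ j.+1], at a distance of order 2^-j. *)
apply/eqP; rewrite -subr_eq0 -normr_eq0 eq_le normr_ge0 andbT.
apply/ler_addgt0Pr => e e0; rewrite add0r.
have [j je] := expn2_small (2 * E * (1 + L * (T - t))) e0.
have PE : g_ j.+1 s - (x + vint t s (fun u => F u (gam u))) =
    vint t s (fun u => F u (g_ j u) - F u (gam u)).
  rewrite vintB; [|exact: HFb (cg j)|exact: HFb].
  by rewrite /= /P clamp_id ?ts// opprD addrACA subrr add0r.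
rewrite -[gam s](subrK (g_ j.+1 s)) -addrA PE.
apply: le_trans (ler_normD _ _) _.
have h1 : `|gam s - g_ j.+1 s| <= 2 * E / 2 ^+ j.
  rewrite distrC; apply: le_trans (gamE s j.+1) _.
  rewrite ler_wpM2l// lef_pV2 ?posrE ?exprn_gt0//.
  by rewrite exprS ler_peMl// ?exprn_ge0// ler1n.
have h2 : `|vint t s (fun u => F u (g_ j u) - F u (gam u))| <=
    L * (2 * E / 2 ^+ j) * (s - t).
  apply: vint_bound_co => //.
  - by apply: vbmB; apply: HFb.
  - move=> u _; apply: le_trans (ode_lip HF _ _ _) _.
    by rewrite ler_wpM2l// ltW.
  - by rewrite mulr_ge0 ?divr_ge0 ?exprn_ge0// ltW.
apply: ltW; apply: le_lt_trans (lerD h1 h2) _; apply: le_lt_trans je.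
have -> : 2 * E * (1 + L * (T - t)) / 2 ^+ j =
   2 * E / 2 ^+ j + L * (2 * E / 2 ^+ j) * (T - t) by ring.
rewrite lerD2l ler_wpM2l ?lerD2r//.
by rewrite mulr_ge0 ?divr_ge0 ?exprn_ge0// ltW.
Qed.

Lemma sol_bound (L M : R) F t T (x : V) gam : 0 < L -> t <= T -> ode_field L M F ->
  sol F t T x gam -> forall s, t <= s <= T ->
  `|gam s| <= 2 * (`|x| + M * (T - t)) * expR (2 * L * (T - t)).
Proof.
move=> L0 tT HF [cg gE] s sT.
have M0 : 0 <= M by apply: le_trans (ode_bnd HF 0).
have bg := vbm_norm (cb_vbm cg).
have a0 : 0 <= `|x| + M * (T - t) by rewrite addr_ge0// mulr_ge0// subr_ge0.
have /(_ s sT) : forall s, t <= s <= T -> `|gam s| <=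
    2 * (`|x| + M * (T - t)) * expw (2 * L) t T s.
  apply: (@gronwall _ t T _ L (fun s => `|gam s|)) => // u /andP[tu uT].
  rewrite [in leLHS]gE ?tu// (le_trans (ler_normD _ _))// -addrA lerD2l.
  apply: (@le_trans _ _ (Int t u (fun v => M + L * `|gam v|))).
    apply: vint_le => //; first exact: (ode_vbm (ltW L0) HF cg).
      by apply: bmD; [exact: bm_cst|apply: bmM => //; exact: bm_cst].
    by move=> v _; exact: (ode_growth HF).
  rewrite IntD//; [|exact: bm_cst|by apply: bmM => //; exact: bm_cst].
  rewrite Int_cst// IntZ// lerD2r ler_wpM2l// lerD2r//.
move=> /le_trans; apply; rewrite ler_wpM2l ?mulr_ge0// expw_le//.
by rewrite mulr_ge0// ltW.
Qed.

(** Neither curve has to solve the equation; only the difference of their residuals is bounded. This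
    covers a change of control, where one curve solves another field, as well as a change of initial
    point. *)
Lemma sol_stable (L M : R) F t T (gam del : R -> V) (a : R) :
  0 < L -> t <= T -> ode_field L M F -> cb gam -> cb del -> 0 <= a ->
  (forall s, t <= s <= T ->
    `|(gam s - vint t s (fun u => F u (gam u))) -
      (del s - vint t s (fun u => F u (del u)))| <= a) ->
  forall s, t <= s <= T -> `|gam s - del s| <= 2 * a * expR (2 * L * (T - t)).
Proof.
move=> L0 tT HF cg cd a0 H s sT.
have b : bm (fun s => `|gam s - del s|).
  by apply: vbm_norm; apply: vbmB; exact: cb_vbm.
have /(_ s sT) : forall s, t <= s <= T -> `|gam s - del s| <=
    2 * a * expw (2 * L) t T s.
  apply: (@gronwall _ t T _ L (fun s => `|gam s - del s|)) => // u /andP[tu uT].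
  have vg := ode_vbm (ltW L0) HF cg; have vd := ode_vbm (ltW L0) HF cd.
  have -> : gam u - del u =
     (gam u - vint t u (fun u => F u (gam u)) -
      (del u - vint t u (fun u => F u (del u)))) +
     vint t u (fun v => F v (gam v) - F v (del v)).
    rewrite vintB//; apply/colP => i; rewrite !mxE; ring.
  rewrite (le_trans (ler_normD _ _))// lerD ?H ?tu//.
  rewrite -IntZ//; apply: vint_le => //; first exact: vbmB.
    by apply: bmM => //; exact: bm_cst.
  by move=> v _; exact: (ode_lip HF).
move=> /le_trans; apply; rewrite ler_wpM2l ?mulr_ge0// expw_le//.
by rewrite mulr_ge0// ltW.
Qed.

End ode.

(** * Absolutely continuous curves *)

Section absolute_continuity.
Context {R : realType}.
Local Notation leb := (@lebesgue_measure R).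

Lemma is_derive_linear_bound (V : normedModType R) (h : R -> V) (c : R) (v : V) (e : R) :
  is_derive c (1 : R) h v -> 0 < e ->
  exists2 eta, 0 < eta & forall s, `|s - c| < eta ->
    `|h s - h c - (s - c) *: v| <= e * `|s - c|.
Proof.
move=> [dh <-] e0; have /cvgrPdist_le := dh; move=> /(_ e e0).
move=> /nbhs_ballP[eta /= eta0 H]; exists eta => // s sc.
have [->|sc0] := eqVneq s c; first by rewrite !subrr scale0r subr0 !normr0 mulr0.
have := H (s - c); rewrite -ball_normE /ball_ /= sub0r normrN subr_eq0.
move=> /(_ sc sc0).
rewrite [_ *: 1]mulr1 subrK -/(derive h c 1) => {}H.
have -> : h s - h c - (s - c) *: 'D_1 h c =
   - ((s - c) *: ('D_1 h c - (s - c)^-1 *: (h s - h c))).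
  by rewrite scalerBr scalerA mulfV ?subr_eq0// scale1r opprB.
by rewrite normrN normrZ mulrC ler_wpM2r.
Qed.

Lemma is_derive_coord n (g : R -> 'cV[R]_n) (c : R) v i :
  is_derive c (1 : R) g v -> is_derive c (1 : R) (fun s => g s i 0) (v i 0).
Proof.
move=> dg.
have H : (h^-1 *: (g (h *: 1 + c) i 0 - g c i 0)) @[h --> (0 : R)^'] --> v i 0.
  apply/cvgrPdist_le => e e0.
  have [eta eta0 He] := is_derive_linear_bound dg e0.
  near=> h.
  have h0 : h != 0 by near: h; exact: nbhs_dnbhs_neq.
  have : `|h *: 1 + c - c| < eta.
    rewrite addrK [_ *: 1]mulr1; near: h.
    apply/nbhs_ballP; exists eta => // y /=.
    by rewrite -ball_normE /ball_ /= sub0r normrN.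
  move=> /He; rewrite addrK [h *: 1]mulr1.
  have := mx_norm_coord (g (h + c) - g c - h *: v) i 0; rewrite !mxE => h1 h2.
  have {h1 h2} := le_trans h1 h2.
  have -> : v i 0 - h^-1 *: (g (h + c) i 0 - g c i 0) =
    - h^-1 * (g (h + c) i 0 - g c i 0 - h * v i 0).
    have -> : h^-1 *: (g (h + c) i 0 - g c i 0) = h^-1 * (g (h + c) i 0 - g c i 0) by [].
    by field.
  rewrite normrM normrN normfV => hh.
  by rewrite mulrC ler_pdivrMr ?normr_gt0.
split; first by apply/cvg_ex; exists (v i 0).
exact: cvg_lim.
Unshelve. all: by end_near. Qed.

(** Let c be the supremum of the points where Q holds. The step leads from points just left of c to
    c and to points just right of it, so Q holds at c, and beyond it if c < b. *)
Lemma real_induction (a b : R) (Q : R -> Prop) : a <= b -> Q a ->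
  (forall c, a <= c <= b -> exists2 eta, 0 < eta & forall s s', a <= s <= c ->
    c <= s' <= b -> c - eta < s -> s' < c + eta -> Q s -> Q s') ->
  Q b.
Proof.
move=> ab Qa step.
pose S := [set s | a <= s <= b /\ Q s].
have Sa : S a by split; rewrite ?lexx.
have ubS : ubound S b by move=> s [/andP[]].
have hS : has_sup S by split; [exists a|exists b].
pose c := sup S.
have ac : a <= c by exact: sup_upper_bound.
have cb : c <= b by apply: ge_sup => //; exists a.
have [|eta eta0 H] := step c; first by rewrite ac.
have [s [/andP[sa sb] Qs] cs] := sup_adherent eta0 hS.
have sc : s <= c by apply: sup_upper_bound => //; split => //; rewrite sa.
have {}H s' : c <= s' <= b -> s' < c + eta -> Q s'.
  by move=> cs'b s'c; apply: (H s s') => //; rewrite sa.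
have [cltb|bc] := ltP c b; last first.
  by apply: H; [rewrite cb lexx|lra].
pose s' := Num.min b (c + eta / 2).
have cs' : c < s' by rewrite lt_min cltb ltrDl divr_gt0.
have s'b : s' <= b by rewrite ge_min lexx.
have Qs' : Q s'.
  apply: H; first by rewrite ltW.
  by rewrite gt_min ltrD2l ltr_pdivrMr// ltr_pMr// ltr1n orbT.
have : s' <= c by apply: sup_upper_bound => //; split => //; rewrite s'b (le_trans ac (ltW cs')).
by rewrite leNgt cs'.
Qed.

(** The bad points are covered by an open set U of measure below the threshold of absolute
    continuity. Going from left to right, U is crossed by recording the interval just travelled;
    elsewhere the zero derivative gives an increment of at most e times the length. The recorded
    intervals have small total length, hence small total variation. Real induction takes the place
    of a covering lemma. *)
Lemma ac_constant (a b : R) (h : R -> R) : a <= b ->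
  absolutely_continuous a b h ->
  {ae leb, forall s : R, s \in `]a, b[ -> is_derive s (1 : R) h 0} ->
  h b = h a.
Proof.
move=> ab ach [N [mN N0 HN]].
apply/eqP; rewrite -subr_eq0 -normr_eq0 eq_le normr_ge0 andbT.
apply/ler_addgt0Pr => e0 e00; rewrite add0r.
pose e := e0 / (b - a + 1).
have ba1 : 0 < b - a + 1 by rewrite ltr_wpDl// subr_ge0.
have e_gt0 : 0 < e by rewrite divr_gt0.
have [del del0 Hdel] := ach e e_gt0.
(* The endpoints are added because the derivative is known in the open interval only. *)
pose A := N `|` [set a; b].
have mA : measurable A by apply: measurableU => //; exact: measurableU.
have A0 : leb A = 0%E.
  apply/eqP; rewrite eq_le measure_ge0 andbT.
  apply: (@le_trans _ _ (leb N + leb [set a; b])%E).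
    by apply: measureU2 => //; exact: measurableU.
  rewrite N0 add0e; apply: (@le_trans _ _ (leb [set a] + leb [set b])%E).
    exact: measureU2.
  by rewrite !lebesgue_measure_set1 add0e.
have Aoo : (leb A < +oo)%E by rewrite A0 ltry.
have [U [oU AU Ud]] : exists U : set R, [/\ open U, A `<=` U & (leb U < del%:E)%E].
  have [U [oU AU Ud]] := @lebesgue_regularity_outer R A del mA Aoo del0.
  exists U; split => //.
  have mU : measurable U by exact: open_measurable.
  apply: (@le_lt_trans _ _ (leb A + leb (U `\` A))%E).
    by rewrite -{1}(setDUK AU); apply: measureU2 => //; exact: measurableD.
  by rewrite A0 add0e.
have mU : measurable U by exact: open_measurable.
have bU : bm (\1_U : R -> R).
  split; first exact: measurable_indic.
  by exists 1 => s; rewrite indicE; case: (s \in U); rewrite ?normr1 ?normr0.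
(* Budget for the total length of the intervals recorded up to s. *)
pose lam s := Int a s (\1_U : R -> R).
have Int1 s s' : s <= s' -> (forall u, s <= u <= s' -> U u) ->
    Int s s' (\1_U : R -> R) = s' - s.
  move=> ss' HU; rewrite -[RHS]mul1r -Int_cst//; apply: Int_eq => u /HU Uu.
  by rewrite indicE mem_set.
have lamS s s' : a <= s -> s <= s' -> lam s <= lam s'.
  move=> as_ ss'; rewrite /lam (@Int_chasles _ a s s')// lerDl.
  by apply: Rintegral_ge0 => u _; rewrite indicE.
have lamb : lam b < del.
  rewrite -lte_fin; apply: le_lt_trans Ud.
  rewrite /lam /Int /Rintegral fineK; last first.
    by apply: integrable_fin_num => //; exact: bm_integrable.
  have -> : (\int[leb]_(x in `[a, b]) (\1_U x)%:E = leb (U `&` `[a, b]))%E.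
    exact: integral_indic.
  by apply: le_measure; rewrite ?inE//; exact: measurableI.
pose Q s := exists n (u w : nat -> R),
  [/\ forall i, (i < n)%N -> a <= u i /\ u i <= w i /\ w i <= s,
      forall i j, (i < j < n)%N -> w i <= u j,
      \sum_(i < n) (w i - u i) <= lam s &
      `|h s - h a| <= e * (s - a) + \sum_(i < n) `|h (w i) - h (u i)| ].
have : Q b.
  apply: (real_induction ab).
    exists 0%N, (fun=> a), (fun=> a); split => //.
    - by rewrite big_ord0 /lam Int_aa.
    - by rewrite big_ord0 !subrr mulr0 normr0 addr0.
  move=> c /andP[ac cb].
  have [Uc|Uc] := pselect (U c).
    have /nbhs_ballP[eta /= eta0 Beta] : nbhs c U by exact: open_nbhs_nbhs.
    exists eta => // s s' /andP[as_ sc] /andP[cs' s'b] ces sce.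
    have ss' := le_trans sc cs'.
    have sU u : s <= u <= s' -> U u.
      move=> /andP[su us']; apply: Beta; rewrite -ball_normE /ball_ /= ltr_norml.
      by apply/andP; split; lra.
    move=> [n [u [w [H1 H2 H3 H4]]]].
    pose u' i := if (i < n)%N then u i else s.
    pose w' i := if (i < n)%N then w i else s'.
    have E (F : R -> R -> R) : \sum_(i < n.+1) F (w' i) (u' i) =
        \sum_(i < n) F (w i) (u i) + F s' s.
      rewrite big_ord_recr /= /w' /u' ltnn; congr (_ + _).
      by apply: eq_bigr => i _; rewrite ltn_ord.
    exists n.+1, u', w'; split.
    - move=> i _; rewrite /u' /w'; case: ifPn => [/H1[? [? ?]]|_]; last by [].
      by split => //; split => //; lra.
    - move=> i j /andP[ij]; rewrite ltnS => jn; rewrite /u' /w' (leq_trans ij jn).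
      case: ifPn => jn'; first by apply: H2; rewrite ij.
      by have [_ []] := H1 _ (leq_trans ij jn).
    - rewrite (E (fun x y => x - y)) /lam (@Int_chasles _ a s s')// (Int1 s s' ss' sU).
      by apply: lerD.
    - rewrite (E (fun x y => `|h x - h y|)).
      have -> : h s' - h a = (h s - h a) + (h s' - h s) by ring.
      apply: le_trans (ler_normD _ _) _.
      have : e * (s - a) <= e * (s' - a) by rewrite ler_wpM2l// ?lerD2r// ltW.
      move: H4; set X := \sum_(i < n) _; set Y := `|h s' - h s|.
      by move=> ? ?; lra.
  have NA : ~ N c by move=> Nc; apply: Uc; apply: AU; left.
  have ca : c != a by apply/eqP => ca; apply: Uc; apply: AU; right; left.
  have cb' : c != b by apply/eqP => cb'; apply: Uc; apply: AU; right; right.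
  have dc : is_derive c (1 : R) h 0.
    apply: contrapT => ndc; apply: NA; apply: HN => /= H; apply: ndc; apply: H.
    by rewrite in_itv /= lt_neqAle eq_sym ca ac lt_neqAle cb' cb.
  have [eta eta0 Heta] := is_derive_linear_bound dc e_gt0.
  exists eta => // s s' /andP[as_ sc] /andP[cs' s'b] ces sce.
  have ss' := le_trans sc cs'.
  move=> [n [u [w [H1 H2 H3 H4]]]]; exists n, u, w; split => //.
  - by move=> i /H1[? [? ?]]; split => //; split => //; exact: le_trans ss'.
  - by apply: le_trans H3 _; exact: lamS.
  - have -> : h s' - h a = (h s - h a) + ((h s' - h c) - (h s - h c)) by ring.
    have h1 : `|h s' - h c| <= e * (s' - c).
      have := Heta s'; rewrite scaler0 subr0 ger0_norm ?subr_ge0//; apply; lra.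
    have h2 : `|h s - h c| <= e * (c - s).
      have := Heta s; rewrite scaler0 subr0 ler0_norm ?subr_le0// opprB; apply; lra.
    have h3 := ler_normD (h s - h a) ((h s' - h c) - (h s - h c)).
    have h4 := ler_normB (h s' - h c) (h s - h c).
    move: H4; set X := \sum_(i < n) _ => h5.
    by apply: le_trans h3 _; lra.
move=> [n [u [w [H1 H2 H3 H4]]]].
have H5 : \sum_(i < n) `|h (w i) - h (u i)| < e.
  apply: (Hdel n (fun i => u i) (fun i => w i)).
  - by move=> i; apply: H1; exact: ltn_ord.
  - apply/trivIsetP => i j _ _ ij; rewrite -subset0 => x [].
    rewrite /= !in_itv /= => /andP[ui wi] /andP[uj wj].
    have [lij|lji|/val_inj] := ltngtP (val i) (val j); last by move/eqP; rewrite (negbTE ij).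
      have := H2 i j; rewrite lij ltn_ord => /(_ isT); lra.
    have := H2 j i; rewrite lji ltn_ord => /(_ isT); lra.
  - exact: le_lt_trans H3 lamb.
apply: le_trans H4 _; apply: (@le_trans _ _ (e * (b - a) + e)).
  by rewrite lerD2l ltW.
by rewrite -{2}[e]mulr1 -mulrDr /e divfK// gt_eqF.
Qed.

(** A coordinate of gam minus the primitive of f has zero derivative almost everywhere, and is
    absolutely continuous because the primitive of a bounded function is Lipschitz. *)
Lemma ac_integral n (t T : R) (gam f : R -> 'cV[R]_n) :
  absolutely_continuous t T gam -> vbm f ->
  {ae leb, forall s : R, s \in `]t, T[ -> is_derive s (1 : R) gam (f s)} ->
  forall s, t <= s <= T -> gam s = gam t + vint t s f.
Proof.
move=> acg bf dg s /andP[ts sT]; apply/colP => i; rewrite !mxE.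
pose h u := gam u i 0 - Int t u (fun u => f u i 0).
have bfi := bf i; have [_ [M fM]] := bfi.
have M0 : 0 <= M by exact: le_trans (fM 0).
have : h s = h t.
  apply: ac_constant => //.
    move=> e e0; have [|del del0 Hd] := acg (e / 2); first by rewrite divr_gt0.
    exists (Num.min del (e / 2 / (M + 1))).
      by rewrite lt_min del0 !divr_gt0// ltr_wpDl.
    move=> k u w uw tr; rewrite lt_min => /andP[s1 s2].
    have uw' j : t <= u j /\ u j <= w j /\ w j <= T.
      by have [? [? ?]] := uw j; do ! split => //; exact: le_trans sT.
    have := Hd k u w uw' tr s1 => h1.
    apply: (@le_lt_trans _ _ (\sum_(j < k) `|gam (w j) - gam (u j)| +
                              M * \sum_(j < k) (w j - u j))).
      rewrite mulr_sumr -big_split /=; apply: ler_sum => j _.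
      have [tu [uwj _]] := uw j.
      have -> : h (w j) - h (u j) = (gam (w j) - gam (u j)) i 0 -
         (Int t (w j) (fun u => f u i 0) - Int t (u j) (fun u => f u i 0)).
        by rewrite /h !mxE; ring.
      apply: le_trans (ler_normB _ _) _; apply: lerD; first exact: mx_norm_coord.
      exact: Int_lipschitz.
    have : M * \sum_(j < k) (w j - u j) <= e / 2.
      apply: (@le_trans _ _ ((M + 1) * \sum_(j < k) (w j - u j))).
        rewrite ler_wpM2r ?lerDl// sumr_ge0// => j _.
        by have [_ [? _]] := uw j; rewrite subr_ge0.
      by rewrite -ler_pdivlMl ?ltr_wpDl// mulrC ltW.
    by move: h1; move=> ? ?; lra.
  have Hi := @Int_derive R t _ bfi.
  have dg' : \forall u \ae leb, (u \in `]t, T[ -> is_derive u (1 : R) gam (f u)) /\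
     (t < u -> is_derive u (1 : R) (fun s : R => Int t s (fun u => f u i 0)) (f u i 0)).
    by apply: filterI => //; exact: (ae_filter_ringOfSetsType leb).
  apply: filterS dg'; first exact: (ae_filter_ringOfSetsType leb).
  move=> u [d1 d2] uts; move: (uts); rewrite in_itv /= => /andP[tu us].
  have uT : u \in `]t, T[ by rewrite in_itv /= tu (lt_le_trans us).
  have d3 := is_derive_coord i (d1 uT); have d4 := d2 tu.
  have -> : h = (fun s => gam s i 0) - (fun s => Int t s (fun u => f u i 0)).
    by apply/funext => z.
  by have := is_deriveB d3 d4; rewrite subrr.
rewrite /h Int_aa// subr0 => <-; ring.
Qed.

End absolute_continuity.

(** * Approximation by continuous functions in mean *)

Section L1_approximation.
Context {R : realType}.
Local Notation leb := (@lebesgue_measure R).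

Lemma cvge0_lt (u : nat -> \bar R) (e : R) :
  u n @[n --> \oo] --> 0%E -> 0 < e -> \forall n \near \oo, (u n < e%:E)%E.
Proof.
move=> uc e0; apply: (uc [set y | (y < e%:E)%E]); rewrite /= /nbhs /=.
exists e => //= y; rewrite /ball_ /= sub0r normrN lte_fin.
by move=> /(le_lt_trans (ler_norm _)).
Qed.

Lemma bm_approx (f : R -> R) (t T e : R) : bm f -> 0 < e ->
  exists2 c : R -> R, continuous c & (exists M, forall s, `|c s| <= M) /\
    Int t T (fun s => `|f s - c s|) <= e.
Proof.
move=> bf e0; have [mf [M fM]] := bf.
have [tT|Tt] := leP t T; last first.
  exists (fun=> 0); first exact: cst_continuous.
  split; first by exists 0 => s; rewrite normr0.
  by rewrite /Int set_itv_ge ?bnd_simp -?ltNge// Rintegral_set0 ltW.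
have M0 : 0 <= M by exact: le_trans (fM 0).
have Too : (leb `[t, T]%classic < +oo)%E.
  by rewrite /= lebesgue_measure_itv /=; case: ifPn; rewrite ?ltry.
have [g [cg ig gf]] := @approximation_continuous_integrable R `[t, T]%classic f
  (measurable_itv _) Too (bm_integrable t T bf).
have [n Hn] : exists n, (\int[leb]_(z in `[t, T]) `|(f z - g n z)%:E| < e%:E)%E.
  have [n _ Hn] := cvge0_lt gf e0.
  by exists n; exact: Hn (leqnn n).
(* Truncating to the range of f does not increase the distance to f; freezing the function outside
   [[t, T]] makes it continuous and bounded on the line. *)
pose c s := clamp (- M) M (g n (clamp t T s)).
have cM s : `|c s| <= M by rewrite ler_norml clamp_itv// ge0_cp.
have cc : continuous c.
  move=> s; apply: (@continuous_comp _ _ _ (g n \o clamp t T) (clamp (- M) M)).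
    apply: (@continuous_comp _ _ _ (clamp t T) (g n)); first exact: clamp_continuous.
    exact: cg.
  exact: clamp_continuous.
exists c => //; split; first by exists M.
have bc : bm c by apply: bm_continuous => //; exists M.
rewrite -lee_fin; apply: le_trans (ltW Hn).
rewrite /Int /Rintegral fineK; last first.
  by apply: integrable_fin_num => //; apply: bm_integrable; apply: bm_norm; exact: bmB.
apply: le_integral_nonmeasurable => s /=; rewrite in_itv /= => /andP[ts sT].
rewrite lee_fin distrC [leRHS]distrC /c (@clamp_id _ t T) ?ts//.
exact: clamp_dist.
Qed.

Lemma vbm_approx n (f : R -> 'cV[R]_n) (t T e : R) : vbm f -> 0 < e ->
  exists2 c : R -> 'cV[R]_n, cb c & Int t T (fun s => `|f s - c s|) <= e.
Proof.
move=> bf e0.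
(* [n.+1] in place of n allows dimension zero. *)
have e1 : 0 < e / n.+1%:R by rewrite divr_gt0.
have /choice[c Hc] : forall i, exists c : R -> R, continuous c /\
    (exists M, forall s, `|c s| <= M) /\
    Int t T (fun s => `|f s i 0 - c s|) <= e / n.+1%:R.
  by move=> i; have [c ? [? ?]] := bm_approx t T (bf i) e1; exists c.
have bc i : bm (c i) by have [? [? _]] := Hc i; exact: bm_continuous.
pose g s : 'cV[R]_n := \col_i c i s.
have bg : vbm g by move=> i; under eq_fun do rewrite mxE.
have cg : cb g.
  split; last by have [M _ gM] := vbm_bounded bg; exists M.
  apply: cV_continuous => i; under eq_fun do rewrite mxE.
  by have [] := Hc i.
exists g => //.
have bi i : bm (fun s => `|f s i 0 - c i s|) by apply: bm_norm; exact: bmB.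
apply: (@le_trans _ _ (Int t T (fun s => \sum_i `|f s i 0 - c i s|))).
  apply: Int_le.
  - by apply: vbm_norm; exact: vbmB.
  - exact: bm_sum.
  move=> s _; apply: cV_norm_le => [|i]; first exact: sumr_ge0.
  by rewrite !mxE (bigD1 i)//= lerDl sumr_ge0.
have -> : Int t T (fun s => \sum_i `|f s i 0 - c i s|) =
    \sum_i Int t T (fun s => `|f s i 0 - c i s|).
  elim: (index_enum _) => [|i l ih].
    rewrite big_nil -[RHS](mul0r (Int t T (fun=> 0))) -IntZ; last exact: bm_cst.
    by apply: Int_eq => s _; rewrite big_nil mul0r.
  rewrite big_cons -ih -IntD//; last exact: bm_sum.
  by apply: Int_eq => s _; rewrite big_cons.
apply: (@le_trans _ _ (\sum_(i < n) (e / n.+1%:R))).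
  by apply: ler_sum => i _; have [_ []] := Hc i.
rewrite sumr_const card_ord -mulrnAr -[leRHS]mulr1 ler_pM2l//.
by rewrite -mulr_natr mulrC ler_pdivrMr// mul1r ler_nat.
Qed.

End L1_approximation.

(** * The triangle inequality for d1 *)

Section borel.
Context {R : realType}.

Lemma measurable_open (V : normedModType R) (A : set V) : open A ->
  measurable (A : set (borel V)).
Proof. by move=> oA; apply: sub_sigma_algebra. Qed.

Lemma continuous_measurable_borel (V W : normedModType R) (f : V -> W) :
  continuous f -> measurable_fun setT (f : borel V -> borel W).
Proof.
move=> /continuousP cf; apply: (@measurability _ _ (borel V) (borel W) setT (f : borel V -> borel W) open);
  first by [].
move=> _ [B oB <-]; rewrite setTI; apply: measurable_open; exact: cf.
Qed.

Lemma continuous_measurable_real (V : normedModType R) (f : V -> R) :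
  continuous f -> measurable_fun setT (f : borel V -> R).
Proof.
move=> /continuousP cf; apply: (measurability _ (RGenOpens.measurableE R)).
move=> _ [_ [a [b ->]] <-]; rewrite setTI; apply: measurable_open.
by apply: cf; exact: interval_open.
Qed.

End borel.

(** * A countable partition into small cubes *)

Section cells.
Context {R : realType} (d : nat).
Local Notation V := 'cV[R]_d.

(** Half-open cubes of side e, numbered through their integer corner; a number that codes no corner
    labels an empty cell. *)
Definition cell_index (e : R) (y : V) : nat :=
  pickle (\col_i Num.floor (y i 0 / e) : 'cV[int]_d).

Definition cell (e : R) (k : nat) : set V := [set y | cell_index e y = k].

Lemma cell_diam (e : R) k (y z : V) : 0 < e -> cell e k y -> cell e k z ->
  `|y - z| <= e.
Proof.
move=> e0 <- /(pcan_inj pickleK) /colP H; apply: cV_norm_le => [|i]; first exact: ltW.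
have := H i; rewrite !mxE => Hi.
have := floor_itv (y i 0 / e); have := floor_itv (z i 0 / e).
rewrite Hi; set f := (Num.floor _)%:~R; rewrite intrD -/f.
rewrite !ler_pdivlMr// !ltr_pdivrMr// => /andP[a1 a2] /andP[b1 b2].
rewrite ler_norml; apply/andP; split; lra.
Qed.

Lemma cell_measurable (e : R) k : 0 < e -> measurable (cell e k : set (borel V)).
Proof.
move=> e0; case E : (unpickle k : option 'cV[int]_d) => [z|]; last first.
  rewrite (_ : cell e k = set0)//; apply/seteqP; split => // y /= ky.
  by move: E; rewrite -ky pickleK.
have [kz|kz] := eqVneq (pickle z) k; last first.
  rewrite (_ : cell e k = set0)//; apply/seteqP; split => // y /= ky.
  by move: E kz; rewrite -ky pickleK => -[<-]; rewrite /cell_index eqxx.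
have -> : cell e k = \bigcap_(i in [set: 'I_d])
    ((fun y : V => y i 0 / e) @^-1` [set` `[(z i 0)%:~R, (z i 0 + 1)%:~R[]).
  apply/seteqP; split => y /=.
    rewrite /cell /= -kz => /(pcan_inj pickleK) yz i _ /=.
    by rewrite in_itv /= -yz mxE floor_itv.
  move=> H; rewrite /cell /= -kz; congr pickle; apply/colP => i; rewrite mxE.
  by apply: floor_def; have := H i I; rewrite /= in_itv.
apply: fin_bigcap_measurable => // i _.
rewrite -[X in measurable X]setTI.
have : measurable_fun setT ((fun y : V => y i 0 / e) : borel V -> R).
  have ci : continuous (fun y : V => y i 0) by move=> y; exact: coord_continuous.
  apply: continuous_measurable_real => y.
  by apply: (@continuousM _ _ (fun y : V => y i 0) (fun=> e^-1) y); [exact: ci|exact: cst_continuous].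
by apply => //; exact: measurable_itv.
Qed.

Lemma cell_cover (e : R) : \bigcup_k cell e k = [set: V].
Proof. by apply/seteqP; split => // y _; exists (cell_index e y). Qed.

Lemma cell_trivIset (e : R) : trivIset setT (cell e : nat -> set V).
Proof. apply/trivIsetP => i j _ _ ij; rewrite -subset0 => y [] /= yi yj.
by rewrite -yi -yj eqxx in ij. Qed.

(** An open subset of V * V is the union of the products of cells that it contains, over the mesh
    sizes 1/(n+1). The union is countable, so measurability for the product topology reduces to
    rectangles. *)
Lemma measurable_pairing dis (Z : measurableType dis) (f g : Z -> V) :
  measurable_fun setT (f : Z -> borel V) ->
  measurable_fun setT (g : Z -> borel V) ->
  measurable_fun setT ((fun z => (f z, g z)) : Z -> borel (V * V)%type).
Proof.
move=> mf mg.
apply: (@measurability _ _ _ (borel (V * V)%type) setT (fun z => (f z, g z)) open); first by [].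
move=> _ [U oU <-]; rewrite setTI.
pose e (n : nat) : R := n.+1%:R^-1.
have e0 n : 0 < e n by rewrite invr_gt0.
pose P (t : nat * nat * nat) := (cell (e t.1.1) t.1.2) `*` (cell (e t.1.1) t.2).
pose J := [set t | P t `<=` U].
have -> : (fun z => (f z, g z)) @^-1` U = \bigcup_(t in J)
    (f @^-1` cell (e t.1.1) t.1.2 `&` g @^-1` cell (e t.1.1) t.2).
  apply/seteqP; split => z /=; last by move=> [t Jt [h1 h2]]; apply: Jt; split.
  move=> Uz.
  have /nbhs_ballP[eta /= eta0 B] : nbhs (f z, g z) U by exact: open_nbhs_nbhs.
  have [n ne] : exists n, e n < eta.
    exists (Num.bound eta^-1); rewrite invf_plt ?posrE//.
    apply: lt_le_trans (archi_boundP _) _; first by rewrite invr_ge0 ltW.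
    by rewrite ler_nat.
  exists ((n, cell_index (e n) (f z)), cell_index (e n) (g z)) => // -[y y'] [/= h1 h2].
  apply: B; split => /=; rewrite -ball_normE /ball_ /=; apply: le_lt_trans ne.
    by apply: (@cell_diam _ (cell_index (e n) (f z))).
  by apply: (@cell_diam _ (cell_index (e n) (g z))).
rewrite bigcup_mkcond; apply: countable_bigcupT_measurable => // t; case: ifPn => // _.
by apply: measurableI; rewrite -[X in measurable X]setTI; [apply: mf|apply: mg] => //;
  exact: cell_measurable.
Qed.

End cells.

Section pairs.
Context {R : realType} (d : nat).
Local Notation V := 'cV[R]_d.
Local Notation B2 := (borel (V * V)%type).

Lemma measurable_snd_borel : measurable_fun setT (snd : B2 -> borel V).
Proof. by apply: continuous_measurable_borel => z; exact: cvg_snd. Qed.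

Lemma measurable_fst_borel : measurable_fun setT (fst : B2 -> borel V).
Proof. by apply: continuous_measurable_borel => z; exact: cvg_fst. Qed.

(** Let z = ((x, y), (x', y')), with (x, y) drawn from a coupling of a and b, and (x', y') from a
    coupling of c and b. Then (x, x') couples a and c, while y and y' both have law b and should
    nearly coincide. *)
Definition outer_pair (z : B2 * B2) : B2 := (z.1.1, z.2.1).

Lemma measurable_outer_pair : measurable_fun setT outer_pair.
Proof.
apply: measurable_pairing.
  by apply: measurableT_comp => //; exact: measurable_fst_borel.
by apply: measurableT_comp => //; exact: measurable_fst_borel.
Qed.

Definition inner_pair (z : B2 * B2) : B2 := (z.1.2, z.2.2).

Lemma measurable_inner_pair : measurable_fun setT inner_pair.
Proof.
apply: measurable_pairing.
  by apply: measurableT_comp => //; exact: measurable_snd_borel.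
by apply: measurableT_comp => //; exact: measurable_snd_borel.
Qed.

Definition dist (p : B2) : \bar R := `|(p : (V * V)%type).1 - (p : (V * V)%type).2|%:E.

Lemma measurable_dist : measurable_fun setT dist.
Proof.
apply/measurable_EFinP; apply: continuous_measurable_real => p.
apply: (@continuous_comp _ _ _ (fun p : V * V => p.1 - p.2) (fun x : V => `|x|)).
  by apply: cvgB; [exact: cvg_fst|exact: cvg_snd].
exact: norm_continuous.
Qed.

Lemma measurable_norm_pair :
  measurable_fun setT (fun p : B2 => `|(p : (V * V)%type)|%:E).
Proof.
by apply/measurable_EFinP; apply: continuous_measurable_real; exact: norm_continuous.
Qed.

End pairs.

(** * Gluing two couplings along small cells *)

Section gluing.
Context {R : realType} (d : nat).
Local Notation V := 'cV[R]_d.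
Local Notation B2 := (borel (V * V)%type).
Context (b : P1 V) (pi rho : P1 (V * V)%type) (eta : R).
Context (eta0 : 0 < eta)
  (pib : forall X : set (borel V), measurable X -> pi (snd @^-1` X) = b X)
  (rhob : forall X : set (borel V), measurable X -> rho (snd @^-1` X) = b X).

Definition strip (k : nat) : set B2 := snd @^-1` (cell eta k).

Lemma strip_measurable k : measurable (strip k).
Proof.
rewrite -[X in measurable X]setTI; apply: measurable_snd_borel => //.
exact: cell_measurable.
Qed.

Lemma prob_finite (mu : P1 (V * V)%type) k : (mu (strip k) < +oo)%E.
Proof. by rewrite (le_lt_trans (probability_le1 _ _)) ?ltry//; exact: strip_measurable. Qed.

Lemma strip_weight_ge0 k : 0 <= (fine (b (cell eta k)))^-1.
Proof. by rewrite invr_ge0 fine_ge0. Qed.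

(** Given that both second points fall in cell k, the two pairs are drawn independently; the mass of
    the cell normalizes. If that mass is zero, its inverse is 0 by convention and the product
    vanishes as well. *)
Definition strip_product (k : nat) :=
  mscale (NngNum (strip_weight_ge0 k))
    (mfrestr (strip_measurable k) (prob_finite pi k) \x
     mfrestr (strip_measurable k) (prob_finite rho k))%E.

Definition glued := mseries strip_product 0.

HB.instance Definition _ := Measure.copy glued (mseries strip_product 0).

Lemma stripE (mu : P1 (V * V)%type) k :
  (forall X : set (borel V), measurable X -> mu (snd @^-1` X) = b X) ->
  mu (strip k) = b (cell eta k).
Proof. by move=> H; apply: H; exact: cell_measurable. Qed.

Lemma strip_sum (mu : P1 (V * V)%type) (X : set B2) : measurable X ->
  (\sum_(0 <= k <oo) mu (X `&` strip k) = mu X)%E.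
Proof.
move=> mX.
have -> : X = \bigcup_k (X `&` strip k).
  by rewrite -setI_bigcupr -preimage_bigcup cell_cover preimage_setT setIT.
rewrite measure_semi_bigcup//.
- by apply: eq_eseriesr => k _; rewrite -setI_bigcupr -preimage_bigcup cell_cover preimage_setT setIT.
- by move=> k; apply: measurableI => //; exact: strip_measurable.
- apply: trivIset_setIl; apply/trivIsetP => i j _ _ ij.
  rewrite /strip -preimage_setI; move/trivIsetP : (@cell_trivIset R d eta).
  by move=> /(_ i j I I ij) ->; rewrite preimage_set0.
- by apply: bigcupT_measurable => k; apply: measurableI => //; exact: strip_measurable.
Qed.

Lemma strip_productE k (X Y : set B2) : measurable X -> measurable Y ->
  strip_product k (X `*` Y) =
  ((fine (b (cell eta k)))^-1%:E * (pi (X `&` strip k) * rho (Y `&` strip k)))%E.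
Proof. by move=> mX mY; rewrite /strip_product /mscale /= product_measure1E. Qed.

(** A cell without mass forces x = 0, so the convention for the inverse of 0 does no harm. *)
Lemma weight_cancel (x : \bar R) k : (0 <= x)%E -> (x <= b (cell eta k))%E ->
  ((fine (b (cell eta k)))^-1%:E * (x * b (cell eta k)) = x)%E.
Proof.
have : b (cell eta k) \is a fin_num by apply: fin_num_measure; exact: cell_measurable.
move: (b _) => -[r| |]// _; case: x => [x| |]//; rewrite !lee_fin => x0 xr.
rewrite /= -!EFinM; have [r0|r0] := eqVneq r 0.
  have -> : x = 0 by apply/eqP; rewrite eq_le x0 andbT -r0.
  by rewrite mul0r mulr0.
by congr EFin; field.
Qed.

Lemma glued_fst (X : set B2) : measurable X -> glued (X `*` setT) = pi X.
Proof.
move=> mX; rewrite /glued /mseries -[RHS]strip_sum//; apply: eq_eseriesr => k _.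
apply: (etrans (strip_productE k mX measurableT)); rewrite setTI (stripE _ rhob).
apply: weight_cancel => //; rewrite -(stripE k pib).
by apply: le_measure; rewrite ?inE; [apply: measurableI|..] => //; exact: strip_measurable.
Qed.

Lemma glued_snd (X : set B2) : measurable X -> glued (setT `*` X) = rho X.
Proof.
move=> mX; rewrite /glued /mseries -[RHS]strip_sum//; apply: eq_eseriesr => k _.
apply: (etrans (strip_productE k measurableT mX)).
rewrite setTI (stripE _ pib) [X in (_ * X)%E]muleC.
apply: weight_cancel => //; rewrite -(stripE k rhob).
by apply: le_measure; rewrite ?inE; [apply: measurableI|..] => //; exact: strip_measurable.
Qed.

(** The k-th summand is carried by the pairs with both components in strip k, and D contains none of
    them. *)
Lemma glued_far (D : set (B2 * B2)) : measurable D ->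
  (forall p q k, D (p, q) -> strip k p -> strip k q -> False) -> glued D = 0%E.
Proof.
move=> mD HD; rewrite /glued /mseries eseries0// => k _ _.
rewrite /strip_product /mscale /=.
set m1 := mfrestr _ _; set m2 := mfrestr _ _.
suff E : (m1 \x m2)%E D = 0%E.
  by transitivity ((fine (b (cell eta k)))^-1%:E * (m1 \x m2)%E D)%E => //; rewrite E mule0.
apply/eqP; rewrite eq_le measure_ge0 andbT.
have mS := strip_measurable k.
apply: (@le_trans _ _ ((m1 \x m2)%E ((~` strip k) `*` setT `|` setT `*` (~` strip k)))).
  apply: le_measure; rewrite ?inE//.
    by apply: measurableU; apply: measurableX => //; exact: measurableC.
  move=> [p q] Dpq; have [pk|] := pselect (strip k p); last by left.
  have [qk|] := pselect (strip k q); last by right.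
  by have := HD _ _ _ Dpq pk qk.
apply: le_trans (measureU2 _ _ _) _; try by apply: measurableX => //; exact: measurableC.
have E1 (X Y : set B2) : measurable X -> measurable Y ->
  (m1 \x m2)%E (X `*` Y) = (m1 X * m2 Y)%E by exact: product_measure1E.
apply: (@le_trans _ _ (m1 (~` strip k) * m2 setT + m1 setT * m2 (~` strip k))%E).
  by rewrite le_eqVlt; apply/orP; left; apply/eqP; congr (_ + _)%E; apply: E1 => //;
    exact: measurableC.
by rewrite /m1 /m2 /mfrestr /mrestr /= setICl !measure0 mule0 mul0e adde0.
Qed.

Let glued_setT : glued setT = 1%E.
Proof. by rewrite -setXTT glued_fst// probability_setT. Qed.

HB.instance Definition _ :=
  @Measure_isProbability.Build _ _ R glued glued_setT.

Lemma gluing : exists G : probability (B2 * B2)%type R,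
  [/\ forall X, measurable X -> G (X `*` setT) = pi X,
      forall X, measurable X -> G (setT `*` X) = rho X &
      forall D, measurable D ->
        (forall z, D z -> (eta%:E < dist (inner_pair z))%E) -> G D = 0%E].
Proof.
exists glued; split; [exact: glued_fst|exact: glued_snd|] => D mD HD.
apply: glued_far => // p q k Dpq pk qk.
by have := HD _ Dpq; rewrite /dist lte_fin ltNge (cell_diam eta0 pk qk).
Qed.

End gluing.

(** * The law of the outer pair *)

Section outer_law.
Context {R : realType} (d : nat).
Local Notation V := 'cV[R]_d.
Local Notation B2 := (borel (V * V)%type).
Context (pi rho : P1 (V * V)%type) (eta : R) (G : probability (B2 * B2)%type R).
Context (eta0 : 0 < eta)
  (G1 : forall X, measurable X -> G (X `*` setT) = pi X)
  (G2 : forall X, measurable X -> G (setT `*` X) = rho X)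
  (G3 : forall D, measurable D ->
        (forall z, D z -> (eta%:E < dist (inner_pair z))%E) -> G D = 0%E).

Lemma glued_integral_fst (g : B2 -> \bar R) : measurable_fun setT g ->
  (forall p, (0 <= g p)%E) -> (\int[G]_z g z.1 = \int[pi]_p g p)%E.
Proof.
move=> mg g0.
have mf : measurable_fun setT (fst : B2 * B2 -> B2) by exact: measurable_fst.
have g0' : {in [set: B2], forall y, (0 <= g y)%E} by move=> y _.
apply: (etrans (esym (ge0_integral_pushforward mf G measurableT mg g0'))).
apply: eq_measure_integral => A mA _; rewrite -[RHS]G1//; congr (G _).
by apply/seteqP; split => [[p q]|[p q] []].
Qed.

Lemma glued_integral_snd (g : B2 -> \bar R) : measurable_fun setT g ->
  (forall p, (0 <= g p)%E) -> (\int[G]_z g z.2 = \int[rho]_p g p)%E.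
Proof.
move=> mg g0.
have mf : measurable_fun setT (snd : B2 * B2 -> B2) by exact: measurable_snd.
have g0' : {in [set: B2], forall y, (0 <= g y)%E} by move=> y _.
apply: (etrans (esym (ge0_integral_pushforward mf G measurableT mg g0'))).
apply: eq_measure_integral => A mA _; rewrite -[RHS]G2//; congr (G _).
by apply/seteqP; split => [[p q]|[p q] []].
Qed.

Definition outer_law : probability B2 R :=
  distribution G (@mfun_Sub _ _ _ _ (@outer_pair R d) (mem_set (@measurable_outer_pair R d))).

Lemma outer_law_integral (g : B2 -> \bar R) : measurable_fun setT g ->
  (forall p, (0 <= g p)%E) ->
  (\int[outer_law]_p g p = \int[G]_z g (outer_pair z))%E.
Proof. by move=> mg g0; rewrite ge0_integral_distribution. Qed.

Lemma outer_law_moment : (\int[outer_law]_p `|(p : (V * V)%type)|%:E < +oo)%E.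
Proof.
pose h (p : B2) := `|(p : (V * V)%type)|%:E.
have mh : measurable_fun setT h by exact: measurable_norm_pair.
have h0 p : (0 <= h p)%E by rewrite lee_fin.
have mh1 : measurable_fun setT (fun z : B2 * B2 => h z.1) by exact: measurableT_comp.
have mh2 : measurable_fun setT (fun z : B2 * B2 => h z.2) by exact: measurableT_comp.
rewrite (outer_law_integral mh h0).
apply: (@le_lt_trans _ _ (\int[G]_z (h z.1 + h z.2))%E).
  apply: le_integral_nonmeasurable => -[[x y] [x' y']] _ /=.
  rewrite /h -EFinD lee_fin /outer_pair /= !prod_normE /=.
  rewrite ge_max; apply/andP; split.
    by rewrite (le_trans (_ : _ <= Num.max `|x| `|y|)) ?lerDl ?le_max ?lexx ?normr_ge0.
  by rewrite (le_trans (_ : _ <= Num.max `|x'| `|y'|)) ?lerDr ?le_max ?lexx ?normr_ge0.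
rewrite ge0_integralD//.
rewrite (glued_integral_fst mh h0) (glued_integral_snd mh h0).
by apply: lte_add_pinfty; exact: P1_moment.
Qed.

Definition outer_P1 : P1 (V * V)%type := MkP1 outer_law_moment.

Lemma outer_law_fst (X : set (borel V)) : measurable X ->
  outer_law (fst @^-1` X) = pi (fst @^-1` X).
Proof.
move=> mX; rewrite -G1; last first.
  by rewrite -[X in measurable X]setTI; exact: measurable_fst_borel.
by rewrite /outer_law /= /distribution /pushforward; congr (G _); apply/seteqP; split => [[p q]|[p q] []].
Qed.

Lemma outer_law_snd (X : set (borel V)) : measurable X ->
  outer_law (snd @^-1` X) = rho (fst @^-1` X).
Proof.
move=> mX; rewrite -G2; last first.
  by rewrite -[X in measurable X]setTI; exact: measurable_fst_borel.
by rewrite /outer_law /= /distribution /pushforward; congr (G _); apply/seteqP; split => [[p q]|[p q] []].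
Qed.

Lemma outer_law_cost :
  (\int[outer_law]_p dist p <=
   \int[pi]_p dist p + eta%:E + \int[rho]_p dist p)%E.
Proof.
have md : measurable_fun setT (@dist R d) by exact: measurable_dist.
have d0 (p : B2) : (0 <= dist p)%E by rewrite lee_fin.
rewrite (outer_law_integral md d0).
have mh1 : measurable_fun setT (fun z : B2 * B2 => dist z.1) by exact: measurableT_comp.
have mh2 : measurable_fun setT (fun z : B2 * B2 => dist z.2) by exact: measurableT_comp.
have mhi : measurable_fun setT (fun z : B2 * B2 => dist (inner_pair z)).
  by apply: (measurableT_comp md); exact: measurable_inner_pair.
have mho : measurable_fun setT (fun z : B2 * B2 => dist (outer_pair z)).
  by apply: (measurableT_comp md); exact: measurable_outer_pair.
have me : measurable_fun setT (fun z : B2 * B2 => eta%:E) by exact: measurable_cst.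
have m1e : measurable_fun setT (fun z : B2 * B2 => dist z.1 + eta%:E)%E.
  exact: emeasurable_funD.
apply: (@le_trans _ _ (\int[G]_z (dist z.1 + eta%:E + dist z.2))%E).
  apply: ae_ge0_le_integral => //.
  - by move=> z _; rewrite !adde_ge0// lee_fin ltW.
  - exact: emeasurable_funD.
  have mN : measurable [set z : B2 * B2 | (eta%:E < dist (inner_pair z))%E].
    have -> : [set z : B2 * B2 | (eta%:E < dist (inner_pair z))%E] =
       [set: B2 * B2] `&` (fun z : B2 * B2 => dist (inner_pair z)) @^-1` [set` `]eta%:E, +oo[%O].
      by rewrite setTI; apply/seteqP; split => z /=; rewrite in_itv /= andbT.
    by apply: mhi => //; exact: emeasurable_itv.
  (* Outside this null set the inner points are within eta of each other, and one passes from x to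
     x' through y and y'. *)
  exists [set z : B2 * B2 | (eta%:E < dist (inner_pair z))%E]; split => //.
    by apply: G3.
  move=> [[x y] [x' y']] /= /not_implyP [_ H]; rewrite ltNge; apply/negP => hz; apply: H.
  rewrite -!EFinD lee_fin /=; move: hz; rewrite lee_fin /= => hz.
  have := ler_normD (x - y) (y - y'); have := ler_normD (x - y') (y' - x').
  rewrite !addrA !subrK (distrC y').
  by move=> h1 h2; lra.
rewrite ge0_integralD//; last by move=> z _; rewrite adde_ge0// lee_fin ltW.
rewrite ge0_integralD//; last by move=> z _; rewrite lee_fin ltW.
rewrite (glued_integral_fst md d0) (glued_integral_snd md d0) integral_cst//.
have GT : G [set: (B2 * B2)%type] = 1%E by exact: probability_setT.
by apply: leeD => //; apply: leeD => //; rewrite [X in (_ * X)%E]GT mule1.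
Qed.

End outer_law.

(* The gluing lemma, with the conditional laws given the middle point replaced by
   the conditional laws given a small cell containing it; the cost of this is the
   diameter of the cells, absorbed by the strict inequalities. *)
Lemma d1_triangle (R : realType) (d : nat) (a b c : P1 'cV[R]_d) (e1 e2 : R) :
  (d1 a b < e1%:E)%E -> (d1 c b < e2%:E)%E -> (d1 a c < (e1 + e2)%:E)%E.
Proof.
move=> /ereal_inf_lt[_ [pi cpi <-] Ipi] /ereal_inf_lt[_ [rho crho <-] Irho].
have {Ipi} [i1 Ei1 i1e] : exists2 i1 : R, (\int[pi]_p dist p = i1%:E)%E & i1 < e1.
  have : (0 <= \int[pi]_p dist p)%E by apply: integral_ge0 => p _; rewrite lee_fin.
  by move: Ipi; rewrite -[(\int[pi]_z _)%E]/(\int[pi]_p dist p)%E; case: (integral _ _ _) => [x| |]// => xe _; exists x.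
have {Irho} [i2 Ei2 i2e] : exists2 i2 : R, (\int[rho]_p dist p = i2%:E)%E & i2 < e2.
  have : (0 <= \int[rho]_p dist p)%E by apply: integral_ge0 => p _; rewrite lee_fin.
  by move: Irho; rewrite -[(\int[rho]_z _)%E]/(\int[rho]_p dist p)%E; case: (integral _ _ _) => [x| |]// => xe _; exists x.
(* Half the slack of the two strict inequalities pays for the distance between the inner points. *)
pose eta := (e1 + e2 - i1 - i2) / 2.
have eta0 : 0 < eta by rewrite divr_gt0//; lra.
have [G [G1 G2 G3]] := gluing eta0 (fun X mX => (cpi X mX).2) (fun X mX => (crho X mX).2).
apply: (@le_lt_trans _ _ (i1%:E + eta%:E + i2%:E)%E); last first.
  by rewrite -!EFinD lte_fin /eta; lra.
rewrite -Ei1 -Ei2; apply: le_trans (outer_law_cost eta0 G1 G2 G3).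
apply: ereal_inf_lbound; exists (outer_P1 G1 G2) => // X mX; split.
  by rewrite /= (outer_law_fst G1 mX) (cpi X mX).1.
by rewrite /= (outer_law_snd G2 mX) (crho X mX).1.
Qed.

(** * Uniform continuity of the data *)

Section half_distances.
Context {R : realType} (V : normedZmodType R).
Implicit Types u v w : V.

Lemma lt_dist_half u v w (e : R) : `|u - v| < e / 2 -> `|w - v| < e / 2 -> `|u - w| < e.
Proof.
move=> uv wv; rewrite (splitr e); apply: le_lt_trans (ler_distD v _ _) _.
by rewrite ltrD// distrC.
Qed.

Lemma le_dist_half u v w (e : R) : `|u - v| <= e / 2 -> `|w - v| <= e / 2 -> `|u - w| <= e.
Proof.
move=> uv wv; rewrite (splitr e); apply: le_trans (ler_distD v _ _) _.
by rewrite lerD// distrC.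
Qed.

Lemma lt_dist_double u v w (e : R) : `|u - v| < e -> `|v - w| < e -> `|u - w| < 2 * e.
Proof.
move=> uv vw; apply: le_lt_trans (ler_distD v _ _) _.
by rewrite mulrDl mul1r ltrD.
Qed.

End half_distances.

(** * Compactness *)

Section compactness.
Context {R : realType}.

Lemma cV_ball_compact n (M : R) : compact [set x : 'cV[R]_n | `|x| <= M].
Proof.
have cT : continuous (@trmx R 1 n).
  apply: cV_continuous => i; under eq_fun do rewrite mxE.
  by move=> x; exact: coord_continuous.
have -> : [set x : 'cV[R]_n | `|x| <= M] = @trmx R 1 n @` [set x : 'rV[R]_n | `|x| <= M].
  have tr m k (x : 'M[R]_(m, k)) : `|x^T| <= `|x|.
    by apply: mx_norm_le => // i j; rewrite mxE mx_norm_coord.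
  apply/seteqP; split => [x /= xM|_ [x /= xM <-]].
    by exists x^T; rewrite ?trmxK//=; exact: le_trans (tr _ _ x) xM.
  exact: le_trans (tr _ _ x) xM.
apply: continuous_compact; first exact: continuous_subspaceT.
apply: bounded_closed_compact.
  by exists M; split; [exact: num_real|move=> y My x /= xM; exact: le_trans xM (ltW My)].
have -> : [set x : 'rV[R]_n | `|x| <= M] = (fun x => `|x|) @^-1` [set y | y <= M] by [].
by apply: closed_comp; [move=> x _; exact: norm_continuous|exact: closed_le].
Qed.

(** P survives a decrease of e, so the finitely many thresholds of a cover have a common one.
    Besides moduli of continuity, this yields the bound on the inverse matrices and the common mesh
    for the net of tubes. *)
Lemma compact_uniform (X : topologicalType) (K : set X) (P : R -> X -> Prop) :
  compact K ->
  (forall e e' x, e' <= e -> P e x -> P e' x) ->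
  (forall x, K x -> exists2 e, 0 < e & \forall y \near x, P e y) ->
  exists2 e, 0 < e & forall x, K x -> P e x.
Proof.
move=> /compact_near_coveringP cK mono loc.
have [|e0 /= e00 H] := cK R (0 : R)^'+ P _.
  move=> x Kx; have [e e0 He] := loc x Kx.
  exists ([set y | P e y], [set e' : R | e' < e]); first split => //=.
    by exists e => //= y /=; rewrite sub0r normrN => /(le_lt_trans (ler_norm _)).
  by move=> [y e'] [/= Py e'e]; exact: mono (ltW e'e) Py.
exists (e0 / 2); first by rewrite divr_gt0.
apply: (H (e0 / 2)) => /=; last by rewrite divr_gt0.
by rewrite sub0r normrN gtr0_norm ?divr_gt0// ltr_pdivrMr// ltr_pMr// ltr1n.
Qed.

End compactness.

(** * Moduli of continuity and bounds for the data *)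

Section data.
Context (R : realType) (r q : nat) (D : control_data R r q).
Local Notation T := (horizon D).
Local Notation state := 'cV[R]_(r + q).
Local Notation ctl := 'cV[R]_r.
Context (mu : R -> P1 state) (p : R).
Context (T0 : 0 < T) (mu_cont : continuous_flow T mu).

Let T0' : 0 <= T. Proof. exact: ltW. Qed.

(** The assumptions concern times in [[0, T]] only; composition with [tau] extends the data to the
    line. *)
Definition tau (s : R) : R := clamp 0 T s.

Lemma tau_in s : tau s \in `[0, T].
Proof. exact: clamp_in. Qed.

Lemma tau_id s : 0 <= s <= T -> tau s = s.
Proof. exact: clamp_id. Qed.

Lemma tau_lip s t : `|tau s - tau t| <= `|s - t|.
Proof. exact: clamp_lip. Qed.

(** Read off from the continuity of the flow at s = t, instead of constructing the diagonal
    coupling. *)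
Lemma d1_self t : t \in `[0, T] -> forall e, 0 < e -> (d1 (mu t) (mu t) < e%:E)%E.
Proof.
by move=> tT e e0; have [del del0 H] := mu_cont tT e0; apply: H; rewrite ?subrr ?normr0.
Qed.

(** Only the base point (t, a, x) runs in a compact set, and its measure is [mu t]. The perturbed
    measure nu is compared with [mu t'], which suits a flow uniformly close to mu. *)
Lemma ell_modulus : ell_continuous D -> forall M e, 0 < e ->
  exists2 del, 0 < del & forall t t' (a a' : ctl) (x x' : state) (nu : P1 state),
    t \in `[0, T] -> t' \in `[0, T] -> `|a| <= M -> `|x| <= M ->
    `|t' - t| < del -> `|a' - a| < del -> `|x' - x| < del ->
    (d1 nu (mu t') < del%:E)%E ->
    `|ell D t' a' x' nu - ell D t a x (mu t)| < e.
Proof.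
move=> cell M e e0.
pose P (del : R) (z : R * (ctl * state)) := z.1 \in `[0, T] ->
  forall t' (a' : ctl) (x' : state) (nu : P1 state), t' \in `[0, T] ->
    `|t' - z.1| < del -> `|a' - z.2.1| < del -> `|x' - z.2.2| < del ->
    (d1 nu (mu t') < del%:E)%E ->
    `|ell D t' a' x' nu - ell D z.1 z.2.1 z.2.2 (mu z.1)| < e.
have [|||del del0 H] := @compact_uniform R _ (`[0, T]%classic `*`
  ([set a : ctl | `|a| <= M] `*` [set x : state | `|x| <= M])) P.
- by apply: compact_setX; [exact: segment_compact|apply: compact_setX; exact: cV_ball_compact].
- move=> d d' z d'd Pd zT t' a' x' nu t'T h1 h2 h3 h4; apply: Pd => //.
  + exact: lt_le_trans h1 d'd.
  + exact: lt_le_trans h2 d'd.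
  + exact: lt_le_trans h3 d'd.
  + by apply: lt_le_trans h4 _; rewrite lee_fin.
- move=> [t0 [a0 x0]] /= [t0T _].
  have e2 : 0 < e / 2 by rewrite divr_gt0.
  have [d d_gt0 Hd] := cell t0 a0 x0 (mu t0) t0T _ e2.
  have d2 : 0 < d / 2 by rewrite divr_gt0.
  have [f f0 Hf] := mu_cont t0T d2.
  pose del := Num.min (d / 2) (f / 2).
  have del_gt0 : 0 < del by rewrite lt_min d2 divr_gt0.
  have deld : del <= d / 2 by rewrite ge_min lexx.
  have delf : del <= f / 2 by rewrite ge_min lexx orbT.
  have dd : 2 * del <= d by rewrite mulrC -ler_pdivlMr.
  have df : 2 * del <= f by rewrite mulrC -ler_pdivlMr.
  have dd1 : del <= d by apply: le_trans dd; rewrite ler_peMl ?ler1n// ltW.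
  have df1 : del <= f by apply: le_trans df; rewrite ler_peMl ?ler1n// ltW.
  exists del => //; near=> z => /=.
  have [zt [za zx]] : `|z.1 - t0| < del /\ `|z.2.1 - a0| < del /\ `|z.2.2 - x0| < del.
    near: z; exists (ball t0 del, ball (a0, x0) del); first by split; exact: nbhsx_ballx.
    move=> [u [v w]] [/= h1 [/= h2 h3]]; move: h1 h2 h3; rewrite -!ball_normE /ball_ /=.
    by rewrite ![`|_ - u|]distrC ![`|_ - v|]distrC ![`|_ - w|]distrC.
  move=> zT t' a' x' nu t'T h1 h2 h3 h4.
  have A1 : `|ell D t' a' x' nu - ell D t0 a0 x0 (mu t0)| < e / 2.
    apply: Hd => //.
    + exact: lt_le_trans (lt_dist_double h1 zt) dd.
    + exact: lt_le_trans (lt_dist_double h2 za) dd.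
    + exact: lt_le_trans (lt_dist_double h3 zx) dd.
    (* From [mu t0] to nu through [mu t']: continuity of the flow, then closeness of nu to it. *)
    + rewrite (splitr d); apply: (@d1_triangle _ _ _ (mu t')).
        by apply: Hf => //; exact: lt_le_trans (lt_dist_double h1 zt) df.
      by apply: lt_le_trans h4 _; rewrite lee_fin.
  have A2 : `|ell D z.1 z.2.1 z.2.2 (mu z.1) - ell D t0 a0 x0 (mu t0)| < e / 2.
    apply: Hd => //.
    + exact: lt_le_trans zt dd1.
    + exact: lt_le_trans za dd1.
    + exact: lt_le_trans zx dd1.
    apply: (@lt_trans _ _ (d / 2)%:E); first by apply: Hf => //; exact: lt_le_trans zt df1.
    by rewrite lte_fin ltr_pdivrMr// ltr_pMr// ltr1n.
  exact: lt_dist_half A1 A2.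
exists del => // t t' a a' x x' nu tT t'T aM xM h1 h2 h3 h4.
by apply: (H (t, (a, x))).
Unshelve. all: by end_near. Qed.

Lemma gT_modulus : gT_continuous D -> forall M e, 0 < e ->
  exists2 del, 0 < del & forall (x x' : state) (nu : P1 state),
    `|x| <= M -> `|x' - x| < del -> (d1 nu (mu T) < del%:E)%E ->
    `|gT D x' nu - gT D x (mu T)| < e.
Proof.
move=> cg M e e0.
have TT : T \in `[0, T] by rewrite in_itv /= lexx T0'.
pose P (del : R) (z : state) := forall (x' : state) (nu : P1 state),
    `|x' - z| < del -> (d1 nu (mu T) < del%:E)%E ->
    `|gT D x' nu - gT D z (mu T)| < e.
have [|||del del0 H] := @compact_uniform R _ [set x : state | `|x| <= M] P.
- exact: cV_ball_compact.
- move=> d d' z d'd Pd x' nu h1 h2; apply: Pd => //.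
  + exact: lt_le_trans h1 d'd.
  + by apply: lt_le_trans h2 _; rewrite lee_fin.
- move=> x0 _.
  have e2 : 0 < e / 2 by rewrite divr_gt0.
  have [d d_gt0 Hd] := cg x0 (mu T) _ e2.
  have d2 : 0 < d / 2 by rewrite divr_gt0.
  exists (d / 2) => //; near=> z.
  have zx : `|z - x0| < d / 2.
    near: z; apply/nbhs_ballP; exists (d / 2) => // y.
    by rewrite -ball_normE /ball_ /= distrC.
  move=> x' nu h1 h2.
  have A1 : `|gT D x' nu - gT D x0 (mu T)| < e / 2.
    apply: Hd; first by apply: lt_le_trans (lt_dist_double h1 zx) _; rewrite mulrC divfK.
    by rewrite (splitr d); apply: (@d1_triangle _ _ _ (mu T)) => //; exact: d1_self.
  have A2 : `|gT D z (mu T) - gT D x0 (mu T)| < e / 2.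
    by apply: Hd; [apply: lt_trans zx _; rewrite ltr_pdivrMr// ltr_pMr// ltr1n|exact: d1_self].
  exact: lt_dist_half A1 A2.
by exists del => // x x' nu xM; exact: H.
Unshelve. all: by end_near. Qed.

Lemma within_modulus (X : pseudoMetricType R) (V : normedModType R) (f : X -> V)
    (S K : set X) (e : R) : {within S, continuous f} -> compact K -> K `<=` S -> 0 < e ->
  exists2 del, 0 < del & forall x y, K x -> S y -> ball x del y -> `|f y - f x| <= e.
Proof.
move=> /subspace_continuousP cf cK KS e0.
pose P (del : R) x := S x -> forall y, S y -> ball x del y -> `|f y - f x| <= e.
have [||del del0 H] := @compact_uniform R _ K P cK; last first.
- by exists del => // x y Kx Sy; apply: H => //; exact: KS.
- move=> x0 Kx0; have /cvgrPdist_le := cf x0 (KS _ Kx0).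
  move=> /(_ (e / 2)); rewrite divr_gt0// => /(_ isT).
  rewrite near_withinE => /nbhs_ballP[d /= d0 Hd].
  exists (d / 2); first by rewrite divr_gt0.
  apply/nbhs_ballP; exists (d / 2); rewrite /= ?divr_gt0// => x xx0 Sx y Sy xy.
  have h1 : `|f x0 - f y| <= e / 2.
    by apply: Hd => //; rewrite [d]splitr; exact: ball_triangle xx0 xy.
  have h2 : `|f x0 - f x| <= e / 2.
    apply: Hd => //; apply: le_ball xx0.
    by rewrite ler_pdivrMr// ler_peMr ?ler1n// ltW.
  by apply: (@le_dist_half _ _ _ (f x0)); rewrite distrC.
- move=> d d' x d'd Px Sx y Sy xy; apply: Px => //.
  exact: le_ball d'd _ xy.
Qed.

Section drift_and_control.
Context (LA : R) (LA0 : 0 < LA)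
  (A_lip : forall t (x y : state), t \in `[0, T] ->
          `|drift D t x - drift D t y| <= LA * `|x - y|)
  (A_cont : {within [set z : (R * state)%type | z.1 \in `[0, T]],
        continuous (fun z : (R * state)%type => drift D z.1 z.2)})
  (B_cont : {within [set` `[0, T]], continuous (ctrl D)}).

Lemma drift_modulus M e : 0 < e -> exists2 del, 0 < del &
  forall t t' (x : state), t \in `[0, T] -> t' \in `[0, T] -> `|x| <= M ->
  `|t' - t| < del -> `|drift D t' x - drift D t x| <= e.
Proof.
move=> e0.
have [||del del0 H] := within_modulus (K := `[0, T]%classic `*` [set x : state | `|x| <= M])
    A_cont _ _ e0.
- by apply: compact_setX; [exact: segment_compact|exact: cV_ball_compact].
- by move=> z [].
exists del => // t t' x tT t'T xM tt'.
apply: (H (t, x) (t', x)) => //; split => /=; last exact: ballxx.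
by rewrite -ball_normE /ball_ /= distrC.
Qed.

Lemma ctrl_modulus e : 0 < e -> exists2 del, 0 < del &
  forall t t', t \in `[0, T] -> t' \in `[0, T] ->
  `|t' - t| < del -> `|ctrl D t' - ctrl D t| <= e.
Proof.
move=> e0.
have [||del del0 H] := within_modulus (K := `[0, T]%classic) B_cont _ _ e0.
- exact: segment_compact.
- by [].
exists del => // t t' tT t'T tt'; apply: H => //.
by rewrite -ball_normE /ball_ /= distrC.
Qed.

Lemma drift_continuous_along (gam : R -> state) : continuous gam ->
  continuous (fun s => drift D (tau s) (gam s)).
Proof.
move=> cg s; apply/cvgrPdist_le => e e0.
have e2 : 0 < e / 2 by rewrite divr_gt0.
have [del del0 H] := drift_modulus `|gam s| e2.
near=> u.
have h1 : `|drift D (tau u) (gam s) - drift D (tau s) (gam s)| <= e / 2.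
  apply: H => //; try exact: tau_in.
  apply: le_lt_trans (tau_lip _ _) _; rewrite distrC; near: u.
  exact: (@cvgr_dist_lt _ _ _ (nbhs s) _ id).
have h2 : `|drift D (tau u) (gam u) - drift D (tau u) (gam s)| <= e / 2.
  apply: le_trans (A_lip _ _ (tau_in _)) _; rewrite -ler_pdivlMl// distrC; near: u.
  by have /cvgrPdist_le := cg s; apply; rewrite mulr_gt0// invr_gt0.
rewrite distrC; apply: le_dist_half h2 _.
by rewrite distrC.
Unshelve. all: by end_near. Qed.

Lemma ctrl_continuous : continuous (fun s => ctrl D (tau s)).
Proof.
move=> s; apply/cvgrPdist_le => e e0.
have [del del0 H] := ctrl_modulus e0.
near=> u; rewrite distrC; apply: H; try exact: tau_in.
apply: le_lt_trans (tau_lip _ _) _; rewrite distrC; near: u.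
exact: (@cvgr_dist_lt _ _ _ (nbhs s) _ id).
Unshelve. all: by end_near. Qed.

Lemma drift_growth : exists2 CA, 0 <= CA & forall t (x : state), t \in `[0, T] ->
  `|drift D t x| <= CA + LA * `|x|.
Proof.
have : compact ((fun s => drift D (tau s) 0) @` `[0, T]%classic).
  apply: continuous_compact; last exact: segment_compact.
  apply: continuous_subspaceT; apply: (@drift_continuous_along (fun=> 0)).
  exact: cst_continuous.
move=> /compact_bounded[M [_ HM]]; exists (`|M| + 1); first by rewrite addr_ge0.
move=> t x tT; rewrite -[drift D t x](subrK (drift D t 0)) addrC.
apply: le_trans (ler_normD _ _) _; apply: lerD.
  apply: (HM (`|M| + 1)); first by rewrite (le_lt_trans (ler_norm _))// ltrDl.
  exists t => //; rewrite tau_id//.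
by apply: le_trans (A_lip _ _ tT) _; rewrite subr0.
Qed.

Lemma ctrl_bound : exists2 CB, 0 <= CB & forall t, t \in `[0, T] -> `|ctrl D t| <= CB.
Proof.
have : compact ((fun s => ctrl D (tau s)) @` `[0, T]%classic).
  apply: continuous_compact; last exact: segment_compact.
  by apply: continuous_subspaceT; exact: ctrl_continuous.
move=> /compact_bounded[M [_ HM]]; exists (`|M| + 1); first by rewrite addr_ge0.
move=> t tT; apply: (HM (`|M| + 1)); first by rewrite (le_lt_trans (ler_norm _))// ltrDl.
by exists t => //; rewrite tau_id.
Qed.

(** With X the inverse at t0, the solution v of B1(t) v = w satisfies v = X w - X (B1(t) - B1(t0))
    v. Near t0 the last term is at most |v| / 2, hence |v| <= 2c |w|; compactness gives one
    constant. *)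
Lemma ctrl_inverse_bound : coordinates_ordered D ->
  exists2 CI, 0 <= CI & forall t (w : ctl), t \in `[0, T] ->
    `|invmx (B1 D t) *m w| <= CI * `|w|.
Proof.
move=> Hinv.
(* The constant is written [e^-1] so that weakening the bound means decreasing e. *)
pose P (e : R) (t : R) := t \in `[0, T] -> forall w : ctl, `|invmx (B1 D t) *m w| <= e^-1 * `|w|.
have [|||e e0 H] := @compact_uniform R R `[0, T]%classic (fun e t => 0 < e -> P e t).
- exact: segment_compact.
- move=> e e' t e'e Pe e'0 tT w; apply: le_trans (Pe (lt_le_trans e'0 e'e) tT w) _.
  by rewrite ler_wpM2r// lef_pV2 ?posrE// (lt_le_trans e'0).
- move=> t0 t0T.
  pose X := invmx (B1 D t0).
  pose c := r%:R * `|X| + 1.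
  have c0 : 0 < c by rewrite ltr_wpDl// mulr_ge0.
  pose eta := (2 * c * (r%:R + 1))^-1.
  have eta0 : 0 < eta by rewrite invr_gt0 !mulr_gt0// ltr_wpDl.
  have [del del0 Hd] := ctrl_modulus eta0.
  exists (2 * c)^-1; first by rewrite invr_gt0 mulr_gt0.
  near=> t => _ tT w; rewrite invrK.
  set v := invmx (B1 D t) *m w.
  have wE : w = B1 D t *m v by rewrite /v mulmxA mulmxV ?mul1mx// Hinv.
  have vE : v = X *m w - X *m ((B1 D t - B1 D t0) *m v).
    rewrite -mulmxBr mulmxBl -wE opprB addrCA subrr addr0 mulmxA mulVmx ?mul1mx//.
    by apply: Hinv.
  have h1 (u : ctl) : `|X *m u| <= c * `|u|.
    apply: le_trans (norm_mulmx _ _) _; rewrite ler_wpM2r// /c lerDl//.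
  have h2 : `|(B1 D t - B1 D t0) *m v| <= (r%:R + 1) * eta * `|v|.
    apply: le_trans (norm_mulmx _ _) _; rewrite ler_wpM2r// ler_pM// ?lerDl//.
    have -> : B1 D t - B1 D t0 = usubmx (ctrl D t - ctrl D t0).
      by apply/matrixP => i j; rewrite !mxE.
    apply: le_trans (norm_usubmx_mx _) _; apply: Hd; [exact: t0T|exact: tT|].
    by rewrite distrC; near: t; exact: (@cvgr_dist_lt _ _ _ (nbhs t0) _ id).
  have h3 : c * ((r%:R + 1) * eta * `|v|) = `|v| / 2.
    by rewrite /eta; field; rewrite !gt_eqF// ltr_wpDl.
  have : `|v| <= c * `|w| + `|v| / 2.
    rewrite {1}vE; apply: le_trans (ler_normB _ _) _; apply: lerD => //.
    by rewrite -h3; apply: le_trans (h1 _) _; rewrite ler_wpM2l// ltW.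
  by move=> ?; lra.
exists e^-1; first by rewrite invr_ge0 ltW.
by move=> t w tT; apply: H.
Unshelve. all: by end_near. Qed.

Definition field (u : R -> ctl) (s : R) (y : state) : state :=
  drift D (tau s) y + ctrl D (tau s) *m u s.

(** M depends on the control through its bound only, which makes the estimates on trajectories
    uniform over controls. *)
Lemma field_ode_bounded (M0 : R) : exists2 M, 0 <= M & forall u : R -> ctl,
  vbm u -> (forall s, `|u s| <= M0) -> ode_field LA M (field u).
Proof.
have [CA CA0 HA] := drift_growth; have [CB CB0 HB] := ctrl_bound.
exists (CA + r%:R * CB * `|M0|); first by rewrite addr_ge0// !mulr_ge0.
move=> u bu uM0; have uM s : `|u s| <= `|M0| by apply: le_trans (uM0 s) (ler_norm _).
split.
- move=> s y z; rewrite /field opprD addrACA subrr addr0.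
  by apply: A_lip; exact: tau_in.
- move=> s; apply: le_trans (ler_normD _ _) _; apply: lerD.
    by have := HA (tau s) 0 (tau_in _); rewrite normr0 mulr0 addr0.
  apply: le_trans (norm_mulmx _ _) _; apply: ler_pM => //.
  by rewrite ler_wpM2l// HB// tau_in.
- move=> gam cg i.
  under eq_fun do rewrite mxE.
  apply: measurable_funD.
    apply: continuous_measurable_fun; apply: continuous_coord.
    exact: drift_continuous_along.
  under eq_fun do rewrite mxE.
  apply: measurable_sum => j; apply: measurable_funM.
    by apply: continuous_measurable_fun; apply: continuous_coord; exact: ctrl_continuous.
  by have [] := bu j.
Qed.

Lemma field_ode (u : R -> ctl) : vbm u -> exists2 M, 0 <= M & ode_field LA M (field u).
Proof.
move=> bu; have [K K0 uK] := vbm_bounded bu; have [M M0 HM] := field_ode_bounded K.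
by exists M => //; exact: HM.
Qed.

End drift_and_control.

End data.

(** * Differentiation of vector-valued primitives *)

Section derivative_from_components.
Context {R : realType}.

Lemma is_derive_of_linear_bound (V : normedModType R) (h : R -> V) (c : R) (v : V) :
  (forall e, 0 < e -> exists2 eta, 0 < eta & forall s, `|s - c| < eta ->
    `|h s - h c - (s - c) *: v| <= e * `|s - c|) ->
  is_derive c (1 : R) h v.
Proof.
move=> H.
have cv : (k^-1 *: (h (k *: 1 + c) - h c)) @[k --> (0 : R)^'] --> v.
  apply/cvgrPdist_le => e e0; have [eta eta0 He] := H e e0.
  near=> k.
  have k0 : k != 0 by near: k; exact: nbhs_dnbhs_neq.
  have : `|k *: 1 + c - c| < eta.
    rewrite addrK [_ *: 1]mulr1; near: k.
    apply/nbhs_ballP; exists eta => // y /=.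
    by rewrite -ball_normE /ball_ /= sub0r normrN.
  move=> /He; rewrite addrK [k *: 1]mulr1 => hk.
  have -> : v - k^-1 *: (h (k + c) - h c) = - (k^-1 *: (h (k + c) - h c - k *: v)).
    by rewrite [in RHS]scalerBr scalerA mulVf// scale1r opprB.
  by rewrite normrN normrZ normfV mulrC ler_pdivrMr ?normr_gt0.
split; first by apply/cvg_ex; exists v.
exact: cvg_lim.
Unshelve. all: by end_near. Qed.

Lemma primitive_derive n (t T c : R) (f gam : R -> 'cV[R]_n) x :
  t < c < T -> (forall s, t <= s <= T -> gam s = x + vint t s f) ->
  (forall i, is_derive c (1 : R) (fun s => Int t s (fun u => f u i 0)) (f c i 0)) ->
  is_derive c (1 : R) gam (f c).
Proof.
move=> /andP[tc cT] gE df; apply: is_derive_of_linear_bound => e e0.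
have Hn : \forall s \near c, forall i,
    `|Int t s (fun u => f u i 0) - Int t c (fun u => f u i 0) - (s - c) * f c i 0|
     <= e * `|s - c|.
  apply: (@filter_forall _ _ _ (nbhs c) (nbhs_filter c)) => i.
  have [eta eta0 H] := is_derive_linear_bound (df i) e0.
  by apply/nbhs_ballP; exists eta => // s; rewrite -ball_normE /ball_ /= distrC; exact: H.
have : \forall s \near c, (t <= s <= T) /\ forall i,
    `|Int t s (fun u => f u i 0) - Int t c (fun u => f u i 0) - (s - c) * f c i 0|
     <= e * `|s - c|.
  near=> s; split; last by near: s.
  apply/andP; split; apply/ltW; near: s; [exact: lt_nbhsr|exact: lt_nbhsl].
move=> /nbhs_ballP[eta /= eta0 H]; exists eta => // s sc.
have [tsT Hs] : (t <= s <= T) /\ forall i,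
    `|Int t s (fun u => f u i 0) - Int t c (fun u => f u i 0) - (s - c) * f c i 0|
     <= e * `|s - c| by apply: H; rewrite -ball_normE /ball_ /= distrC.
rewrite gE// gE ?(ltW tc) ?(ltW cT)// opprD addrACA subrr add0r.
apply: cV_norm_le => [|i]; first by rewrite mulr_ge0// ltW.
by rewrite !mxE.
Unshelve. all: by end_near. Qed.

End derivative_from_components.

Section clampv_continuity.
Context {R : realType}.

Lemma clampv_continuous n (rho : R -> R) (f : R -> 'cV[R]_n) :
  continuous rho -> continuous f -> continuous (fun s => clampv (rho s) (f s)).
Proof.
move=> crho cf; apply: cV_continuous => i s; under eq_fun do rewrite mxE.
apply: (@continuous_max _ _ (fun s => - rho s) (fun s => Num.min (rho s) (f s i 0)) s).
  by apply: cvgN; exact: crho.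
apply: (@continuous_min _ _ rho (fun s => f s i 0) s); first exact: crho.
by have := @continuous_coord _ _ _ _ f i 0 cf s.
Qed.

Lemma clampv_measurable n (rho : R -> R) (f : R -> 'cV[R]_n) :
  measurable_fun setT rho -> (forall i, measurable_fun setT (fun s => f s i 0)) ->
  forall i, measurable_fun setT (fun s => clampv (rho s) (f s) i 0).
Proof.
move=> mrho mf i; under eq_fun do rewrite mxE.
apply: measurable_maxr; first exact: measurableT_comp.
exact: measurable_minr.
Qed.

Lemma Int_ae_eq (a b : R) (f g : R -> R) (N : set R) : bm f -> bm g ->
  measurable N -> @lebesgue_measure R N = 0%E -> (forall s, ~ N s -> f s = g s) ->
  Int a b f = Int a b g.
Proof.
move=> bf bg mN N0 fg; rewrite /Int /Rintegral; congr fine.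
apply: ae_eq_integral => //.
- by apply/measurable_EFinP; have [mf _] := bf; exact: measurable_funTS.
- by apply/measurable_EFinP; have [mg _] := bg; exact: measurable_funTS.
- exists N; split => // s /= /not_implyP[_ fgs]; apply: contrapT => Ns.
  by apply: fgs; rewrite fg.
Qed.

End clampv_continuity.

(** * The scheme on one grid *)

Section finite_sums.
Context {R : realType}.

(* A sum with infinite support is 0 by convention, so that the weights must
   have finite support. *)
Lemma convex_sumE (V : choiceType) (E : set V) (b : V -> R) : \sum_(x \in E) b x = 1 ->
  exists2 X : seq V, (forall x, x \in X -> E x) & \sum_(x <- X) b x = 1 /\
    forall phi : V -> R, \sum_(x \in E) b x * phi x = \sum_(x <- X) b x * phi x.
Proof.
have [fin b1|infin] := pselect (finite_set (E `&` b @^-1` [set~ 0])); last first.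
  by rewrite no_finite_support// big_nil => /esym/eqP; rewrite oner_eq0.
pose X := finite_support 0 E b.
have inX x : x \in X -> E x by rewrite in_finite_support// => /set_mem[].
have notinX x : E x -> x \notin X -> b x = 0.
  move=> Ex; rewrite in_finite_support//; apply: contraNeq => /eqP bx.
  exact: mem_set.
have sumE (f : V -> R) : (forall x, E x -> x \notin X -> f x = 0) ->
    \sum_(x \in E) f x = \sum_(x <- X) f x.
  move=> f0; rewrite -(@fsbig_widen _ _ 0 +%R [set` X])//; last first.
    by move=> x [Ex /negP Xx]; exact: f0.
  by rewrite -fsbig_seq//; exact: finite_support_uniq.
exists X => //; split; first by rewrite -sumE.
by move=> phi; apply: sumE => x Ex xX; rewrite notinX// mul0r.
Qed.

Lemma convex_sum_le (V : choiceType) (E : set V) (b phi : V -> R) (c : R) :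
  (forall x, E x -> 0 <= b x) -> \sum_(x \in E) b x = 1 ->
  (forall x, E x -> phi x <= c) -> \sum_(x \in E) b x * phi x <= c.
Proof.
move=> b0 /convex_sumE[X XE [b1 ->]] phic.
rewrite -[leRHS]mul1r -b1 mulr_suml big_seq [leRHS]big_seq.
by apply: ler_sum => x /XE Ex; apply: ler_wpM2l; [exact: b0|exact: phic].
Qed.

(** If every value exceeded the average, all weights would vanish. The vertex found here is the one
    to which the path extracted from the scheme moves. *)
Lemma convex_sum_ge (V : choiceType) (E : set V) (b phi : V -> R) :
  (forall x, E x -> 0 <= b x) -> \sum_(x \in E) b x = 1 ->
  exists2 x, E x & phi x <= \sum_(x \in E) b x * phi x.
Proof.
move=> b0 /convex_sumE[X XE [b1 ->]]; set I := \sum_(x <- X) _.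
apply: contrapT => H.
have lt x : x \in X -> I < phi x.
  by move=> xX; rewrite ltNge; apply/negP => h; apply: H; exists x => //; exact: XE.
have : \sum_(x <- X | x \in X) b x * (phi x - I) == 0.
  rewrite -big_seq; under eq_bigr do rewrite mulrBr.
  by rewrite sumrB -mulr_suml b1 mul1r subrr.
rewrite psumr_eq0 => [/allP H0|x xX]; last first.
  by rewrite mulr_ge0 ?b0 ?subr_ge0 ?(ltW (lt x xX))//; exact: XE.
move: b1; rewrite big_seq big1 => [/esym/eqP|x xX]; first by rewrite oner_eq0.
have := H0 x xX; rewrite xX /= mulf_eq0 subr_eq0 => /orP[/eqP//|/eqP pE].
by have := lt x xX; rewrite pE ltxx.
Qed.

(** Rules out the default value 0 of [minimum]. *)
Lemma minimumP (E : set R) : finite_set E -> E !=set0 ->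
  E (minimum E) /\ lbound E (minimum E).
Proof.
move=> /finite_seqP[X ->] [x0 /= x0X].
have [z zX zmin] : exists2 z, z \in X & forall y, y \in X -> z <= y.
  elim: X x0 {x0X} (x0X) => // a s ih x0 _.
  case: s ih => [_|b s ih]; first by exists a; [exact: mem_head|move=> y /[!inE] /eqP ->].
  have [z zs zm] := ih b (mem_head b s).
  have [az|/ltW za] := leP a z.
    exists a; first exact: mem_head.
    by move=> y; rewrite inE => /predU1P[->//|/zm]; exact: le_trans.
  exists z; first by rewrite inE zs orbT.
  by move=> y; rewrite inE => /predU1P[->//|/zm].
rewrite /minimum.
exact: (@xgetPex _ 0 [set z | [set` X] z /\ lbound [set` X] z] (ex_intro _ z (conj zX zmin))).
Qed.

Lemma grid_ball_finite n (dx M : R) : 0 < dx ->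
  finite_set (@grid R n dx `&` [set y | `|y| <= M]).
Proof.
move=> dx0; pose K := Num.bound `|M / dx|.
apply: (@sub_finite_set _ _ ((fun f : {ffun 'I_n -> 'I_(K + K).+1} =>
  (\col_j (dx * ((f j : nat)%:R - K%:R)) : 'cV[R]_n)) @` setT)); last first.
  by apply: finite_image; exact: finite_finset.
move=> y [[i _ <-] /= yM].
exists [ffun j => inord (absz (i j 0 + K%:Z))] => //.
apply/colP => j; rewrite !mxE ffunE; congr (_ * _).
have iK : `|i j 0| <= K%:Z.
  rewrite -(ler_int R) intr_norm; apply/ltW.
  apply: le_lt_trans (archi_boundP (normr_ge0 (M / dx))).
  apply: le_trans _ (ler_norm _); rewrite ler_pdivlMr// mulrC.
  apply: le_trans yM; rewrite -{1}(gtr0_norm dx0) -normrM.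
  by have := mx_norm_coord (dx *: map_mx intr i) j 0; rewrite !mxE.
move: iK; rewrite ler_norml => /andP[iK1 iK2].
have iK0 : 0 <= i j 0 + K%:Z by rewrite -lerBlDr sub0r.
rewrite inordK; last first.
  by rewrite ltnS -lez_nat gez0_abs// PoszD lerD2r.
rewrite -[_%:R]/((Posz _)%:~R) gez0_abs// rmorphD /= addrK//.
Qed.

Lemma grid_round n (dx : R) (v : 'cV[R]_n) : 0 < dx ->
  exists2 y, grid dx y & `|y - v| <= dx.
Proof.
move=> dx0; exists (dx *: map_mx intr (\col_j Num.floor (v j 0 / dx))); first by eexists.
apply: cV_norm_le => [|j]; first exact: ltW.
rewrite !mxE; have /andP[h1 h2] := floor_itv (v j 0 / dx).
move: h1 h2; rewrite intrD ler_pdivlMr// ltr_pdivrMr// mulrDl mul1r (mulrC dx).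
by rewrite distrC => h1 h2; rewrite ler_norml; apply/andP; split; lra.
Qed.

(** Induction step of the discrete Gronwall inequality: 1 + b <= e^b takes care of the factor, and
    the new c is absorbed because the exponential is at least 1. *)
Lemma gronwall_step (b c E X : R) (k : nat) : 0 <= b -> 0 <= c -> 0 <= E ->
  X <= (1 + b) * (expR (b * k%:R) * (E + k%:R * c)) + c ->
  X <= expR (b * k.+1%:R) * (E + k.+1%:R * c).
Proof.
move=> b0 c0 E0 /le_trans; apply.
have h1 : 1 <= expR (b * k.+1%:R) by rewrite -expR0 ler_expR mulr_ge0.
have -> : expR (b * k.+1%:R) * (E + k.+1%:R * c) =
    expR (b * k.+1%:R) * (E + k%:R * c) + expR (b * k.+1%:R) * c.
  by rewrite -natr1; ring.
apply: lerD; last by rewrite -{1}[c]mul1r; exact: ler_wpM2r.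
have -> : expR (b * k.+1%:R) = expR b * expR (b * k%:R).
  by rewrite -natr1 mulrDr mulr1 expRD mulrC.
rewrite -mulrA; apply: ler_wpM2r.
  by rewrite mulr_ge0 ?expR_ge0// addr_ge0 ?mulr_ge0.
exact: expR_ge1Dx.
Qed.

End finite_sums.

(** * Consistency of one step and bounds on the grids *)

Section scheme_facts.
Context (R : realType) (r q : nat) (D : control_data R r q).
Local Notation T := (horizon D).
Local Notation state := 'cV[R]_(r + q).
Local Notation ctl := 'cV[R]_r.
Context (T0 : 0 < T) (Hord : coordinates_ordered D).
Context (Cb Cstar CI : R) (Cb0 : 0 < Cb) (Cstar0 : 0 < Cstar) (CI0 : 0 < CI).

Section one_grid.
Context (beta : 'cV[R]_q -> 'cV[R]_q -> R) (Nt Ns : nat).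
Context (Nt0 : (0 < Nt)%N) (NtNs : (Nt <= Ns)%N)
  (Hbeta : Q1_basis CI (space_step R Ns) beta).
Local Notation h := (time_step D Nt).
Local Notation dx := (space_step R Ns).
Local Notation tm := (time D Nt).

Lemma time_step_gt0 : 0 < h.
Proof. by rewrite divr_gt0// ltr0n. Qed.

Lemma space_step_gt0 : 0 < dx.
Proof. by rewrite divr_gt0// ltr0n (leq_trans Nt0). Qed.

Lemma time_last : tm Nt = T.
Proof. by rewrite /time mulrC divfK// pnatr_eq0 -lt0n. Qed.

Lemma timeS k : tm k.+1 = tm k + h.
Proof. by rewrite /time -natr1 mulrDl mul1r. Qed.

Lemma time_le j k : (j <= k)%N -> tm j <= tm k.
Proof. by move=> jk; rewrite ler_wpM2r ?ler_nat// ltW// time_step_gt0. Qed.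

Lemma time_ge0 k : 0 <= tm k.
Proof. by rewrite mulr_ge0// ltW// time_step_gt0. Qed.

Lemma time_leT k : (k <= Nt)%N -> tm k <= T.
Proof. by move=> kN; rewrite -[leRHS]time_last time_le. Qed.

Lemma time_in k : (k <= Nt)%N -> tm k \in `[0, T].
Proof. by move=> kN; rewrite in_itv /= time_ge0 time_leT. Qed.

Lemma space_stepE : dx = (Nt%:R / Ns%:R) * (h / T).
Proof.
rewrite /space_step /time_step; field.
by rewrite (gt_eqF T0) !pnatr_eq0 -!lt0n Nt0 (leq_trans Nt0).
Qed.

Lemma space_step_le : dx <= h / T.
Proof.
rewrite space_stepE -[leRHS]mul1r; apply: ler_wpM2r.
  by rewrite divr_ge0 ?ltW// time_step_gt0.
by rewrite ler_pdivrMr ?ltr0n ?(leq_trans Nt0)// mul1r ler_nat.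
Qed.

(** The vertices left out of [S2_] have weight 0, since the point lies outside their supports. *)
Lemma weights_sum k (x : state) y1 :
  \sum_(y2 \in S2_ D beta Nt Ns k x y1) beta y2 (y2_ D Nt k x y1) = 1.
Proof.
rewrite -(Q1_unity Hbeta (y2_ D Nt k x y1)); apply: fsbig_widen => [y []//|].
move=> y [gy /= /not_andP[//|ny]]; apply/eqP/negPn/negP => b0; apply: ny.
exact: subset_closure.
Qed.

Lemma weights_ge0 k (x : state) y1 y2 : S2_ D beta Nt Ns k x y1 y2 ->
  0 <= beta y2 (y2_ D Nt k x y1).
Proof. by move=> [gy _]; exact: (Q1_ge0 Hbeta). Qed.

Lemma interp_le k (x : state) y1 (phi : 'cV[R]_q -> R) c :
  (forall y2, S2_ D beta Nt Ns k x y1 y2 -> phi y2 <= c) ->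
  interp beta (S2_ D beta Nt Ns k x y1) phi (y2_ D Nt k x y1) <= c.
Proof.
by apply: convex_sum_le; [move=> y; exact: weights_ge0|exact: weights_sum].
Qed.

Lemma interp_ge k (x : state) y1 (phi : 'cV[R]_q -> R) :
  exists2 y2, S2_ D beta Nt Ns k x y1 y2 &
    phi y2 <= interp beta (S2_ D beta Nt Ns k x y1) phi (y2_ D Nt k x y1).
Proof.
by apply: convex_sum_ge; [move=> y; exact: weights_ge0|exact: weights_sum].
Qed.

Lemma control_alpha k (x : state) y1 : (k <= Nt)%N ->
  B1 D (tm k) *m alpha_ D Nt k x y1 = h^-1 *: (y1 - usubmx x) - A1 D (tm k) x.
Proof.
by move=> kN; rewrite /alpha_ mulmxA mulmxV ?mul1mx//; apply: Hord; exact: time_in.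
Qed.

(** The control is defined so that the first block of y is reached exactly; the second block is a
    vertex whose support contains the Euler point. *)
Lemma succ_consistency k (x y : state) : (k <= Nt)%N -> Ssucc D Cb beta Nt Ns k x y ->
  `|y - (x + h *: (drift D (tm k) x + ctrl D (tm k) *m alpha_ D Nt k x (usubmx y)))|
    <= CI * dx.
Proof.
move=> kN [_ [gy sy]]; set a := alpha_ _ _ _ _ _.
have h0 : h != 0 by rewrite gt_eqF// time_step_gt0.
apply: norm_split_le.
  have -> : usubmx (y - (x + h *: (drift D (tm k) x + ctrl D (tm k) *m a))) =
      usubmx y - usubmx x - h *: (A1 D (tm k) x + B1 D (tm k) *m a).
    rewrite /A1 /B1 mul_usub_mx; apply/colP => i; rewrite !mxE; ring.
  rewrite control_alpha// addrCA subrr addr0 scalerA divff// scale1r subrr normr0.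
  by rewrite mulr_ge0 ?ltW// space_step_gt0.
have -> : dsubmx (y - (x + h *: (drift D (tm k) x + ctrl D (tm k) *m a))) =
    dsubmx y - y2_ D Nt k x (usubmx y).
  rewrite /y2_ /A2 /B2 mul_dsub_mx -/a; apply/colP => i; rewrite !mxE; ring.
by rewrite distrC; exact: (Q1_supp Hbeta gy sy).
Qed.

Lemma S1_finite k (x : state) : (k <= Nt)%N -> finite_set (S1_ D Cb Nt Ns k x).
Proof.
move=> kN.
pose M := `|x| + h * (r%:R * `|B1 D (tm k)| * (Cb * (1 + `|x|)) + `|A1 D (tm k) x|).
apply: sub_finite_set (grid_ball_finite r M space_step_gt0) => y1 [gy ay]; split => //=.
have h0 : h != 0 by rewrite gt_eqF// time_step_gt0.
have -> : y1 = usubmx x + h *: (B1 D (tm k) *m alpha_ D Nt k x y1 + A1 D (tm k) x).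
  by rewrite control_alpha// subrK scalerA divff// scale1r addrC subrK.
apply: le_trans (ler_normD _ _) _; apply: lerD; first exact: norm_usubmx.
rewrite normrZ gtr0_norm ?time_step_gt0//; apply: ler_wpM2l; first by rewrite ltW// time_step_gt0.
apply: le_trans (ler_normD _ _) _; rewrite lerD2r.
by apply: le_trans (norm_mulmx _ _) _; apply: ler_wpM2l => //; rewrite mulr_ge0.
Qed.

Lemma schemeP m k (x : state) : (k < Nt)%N -> S1_ D Cb Nt Ns k x !=set0 ->
  let J y1 := h * ell D (tm k) (alpha_ D Nt k x y1) x (m (tm k)) +
    interp beta (S2_ D beta Nt Ns k x y1)
      (fun y2 => scheme D Cb beta Nt Ns m k.+1 (col_mx y1 y2)) (y2_ D Nt k x y1) in
  (exists2 y1, S1_ D Cb Nt Ns k x y1 & scheme D Cb beta Nt Ns m k x = J y1) /\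
  (forall y1, S1_ D Cb Nt Ns k x y1 -> scheme D Cb beta Nt Ns m k x <= J y1).
Proof.
move=> kN [y0 Sy0] J; rewrite scheme_rec//.
have [[y1 Sy1 e1] lb] := @minimumP R (J @` S1_ D Cb Nt Ns k x)
  (finite_image _ (S1_finite x (ltnW kN))) (ex_intro _ _ (ex_intro2 _ _ y0 Sy0 erefl)).
by split; [exists y1|move=> y Sy; apply: lb; exists y].
Qed.

(** Replacing the target of a by a grid point within dx changes the control by at most
    [Cinv * (dx / h)]; the margin in the hypothesis keeps it admissible. *)
Lemma control_rounding (Cinv : R) k (x : state) (a : ctl) : (k <= Nt)%N -> 0 <= Cinv ->
  (forall t (w : ctl), t \in `[0, T] -> `|invmx (B1 D t) *m w| <= Cinv * `|w|) ->
  `|a| + Cinv * (dx / h) <= Cb * (1 + `|x|) ->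
  exists2 y1, S1_ D Cb Nt Ns k x y1 & `|alpha_ D Nt k x y1 - a| <= Cinv * (dx / h).
Proof.
move=> kN Cinv0 Hinv ax.
have h0 : h != 0 by rewrite gt_eqF// time_step_gt0.
have [y1 gy yv] := grid_round (usubmx x + h *: (A1 D (tm k) x + B1 D (tm k) *m a)) space_step_gt0.
have aE : `|alpha_ D Nt k x y1 - a| <= Cinv * (dx / h).
  have -> : alpha_ D Nt k x y1 - a = invmx (B1 D (tm k)) *m
      (h^-1 *: (y1 - (usubmx x + h *: (A1 D (tm k) x + B1 D (tm k) *m a)))).
    rewrite opprD addrA scalerBr scalerA mulVf// scale1r opprD addrA mulmxBr.
    by rewrite mulKmx//; apply: Hord; exact: time_in.
  apply: le_trans (Hinv _ _ (time_in kN)) _; apply: ler_wpM2l => //.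
  rewrite normrZ normfV gtr0_norm ?time_step_gt0// mulrC.
  by apply: ler_wpM2r => //; rewrite invr_ge0 ltW// time_step_gt0.
exists y1 => //; split => //.
rewrite -[alpha_ _ _ _ _ _](subrK a) addrC; apply: le_trans (ler_normD _ _) _.
by apply: le_trans ax; rewrite lerD2l.
Qed.

End one_grid.

Context (LA : R) (LA0 : 0 < LA)
  (A_lip : forall t (x y : state), t \in `[0, T] ->
          `|drift D t x - drift D t y| <= LA * `|x - y|)
  (A_cont : {within [set z : (R * state)%type | z.1 \in `[0, T]],
        continuous (fun z : (R * state)%type => drift D z.1 z.2)})
  (B_cont : {within [set` `[0, T]], continuous (ctrl D)}).

(** Controls grow at most linearly with the state, so a step multiplies the norm by at most 1 + hb
    and adds at most hc. The constants do not see the grid: CI dx is at most h CI / T because Nt <=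
    Ns. *)
Lemma grids_bounded : exists2 Rb : R, 0 <= Rb & forall beta Nt Ns, (0 < Nt)%N ->
  (Nt <= Ns)%N -> Q1_basis CI (space_step R Ns) beta ->
  forall k x, (k <= Nt)%N -> S_ D Cb Cstar beta Nt Ns k x -> `|x| <= Rb.
Proof.
have [CA CA0 HA] := drift_growth T0 LA0 A_lip A_cont.
have [CB CB0 HB] := ctrl_bound T0 B_cont.
pose K := r%:R * CB * Cb.
have K0 : 0 <= K by rewrite !mulr_ge0// ltW.
pose b := LA + K; pose c := CA + K + CI / T.
have b0 : 0 <= b by rewrite addr_ge0// ltW.
have c0 : 0 <= c by rewrite !addr_ge0// divr_ge0// ltW.
exists (expR (b * T) * (Cstar + T * c)).
  by rewrite mulr_ge0 ?expR_ge0// addr_ge0 ?mulr_ge0// ltW.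
move=> beta Nt Ns Nt0 NtNs Hb k x kN Sx.
have h0 : 0 < time_step D Nt by exact: time_step_gt0.
have : `|x| <= expR (time_step D Nt * b * k%:R) * (Cstar + k%:R * (time_step D Nt * c)).
  elim: k x kN Sx => [|k ih] x kN /=.
    by move=> [_ /= xC]; rewrite mulr0 expR0 mul0r addr0 mul1r.
  move=> [y Sy yx].
  apply: (gronwall_step (mulr_ge0 (ltW h0) b0) (mulr_ge0 (ltW h0) c0) (ltW Cstar0)).
  have kT := time_in Nt0 (ltnW kN).
  have ih' := ih y (ltnW kN) Sy.
  apply: (@le_trans _ _ ((1 + time_step D Nt * b) * `|y| + time_step D Nt * c)); last first.
    by rewrite lerD2r; apply: ler_wpM2l => //; rewrite addr_ge0// mulr_ge0// ltW.
  have Hc := succ_consistency Nt0 NtNs Hb (ltnW kN) yx.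
  rewrite -[x in leLHS](subrK (y + time_step D Nt *: (drift D (time D Nt k) y +
    ctrl D (time D Nt k) *m alpha_ D Nt k y (usubmx x)))).
  apply: le_trans (ler_normD _ _) _; rewrite addrC.
  have h1 : CI * space_step R Ns <= time_step D Nt * (CI / T).
    rewrite [leRHS]mulrCA; apply: ler_wpM2l; first exact: ltW.
    exact: (space_step_le Nt0 NtNs).
  have [[_ aC] _] := yx.
  have h2 : `|drift D (time D Nt k) y + ctrl D (time D Nt k) *m alpha_ D Nt k y (usubmx x)|
      <= (CA + LA * `|y|) + r%:R * CB * (Cb * (1 + `|y|)).
    apply: le_trans (ler_normD _ _) _; apply: lerD; first exact: HA.
    apply: le_trans (norm_mulmx _ _) _; apply: ler_pM => //.
    by apply: ler_wpM2l => //; exact: HB.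
  apply: le_trans (lerD (ler_normD _ _) Hc) _.
  rewrite normrZ gtr0_norm//.
  apply: le_trans (lerD (lerD (lexx `|y|) (ler_wpM2l (ltW h0) h2)) h1) _.
  rewrite /b /c /K le_eqVlt; apply/orP; left; apply/eqP; ring.
move=> /le_trans; apply.
have kh : k%:R * time_step D Nt <= T by exact: (time_leT Nt0 kN).
apply: ler_pM.
- exact: expR_ge0.
- by rewrite addr_ge0 ?mulr_ge0// ltW.
- by rewrite ler_expR mulrAC mulrC; apply: ler_wpM2l => //; rewrite mulrC.
- by rewrite lerD2l mulrA; apply: ler_wpM2r.
Qed.

End scheme_facts.

(** * Extraction of an Euler path *)

Section discrete_path.
Context (R : realType) (r q : nat) (D : control_data R r q).
Local Notation T := (horizon D).
Local Notation state := 'cV[R]_(r + q).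
Local Notation ctl := 'cV[R]_r.
Context (T0 : 0 < T) (Hord : coordinates_ordered D).
Context (Cb Cstar CI : R) (CI0 : 0 < CI).
Context (beta : 'cV[R]_q -> 'cV[R]_q -> R) (Nt Ns : nat).
Context (Nt0 : (0 < Nt)%N) (NtNs : (Nt <= Ns)%N)
  (Hbeta : Q1_basis CI (space_step R Ns) beta).
Local Notation h := (time_step D Nt).
Local Notation dx := (space_step R Ns).
Local Notation tm := (time D Nt).

Lemma discrete_path m n k (x : state) : (k + n)%N = Nt ->
  (forall j y, (j < Nt)%N -> S1_ D Cb Nt Ns j y !=set0) ->
  S_ D Cb Cstar beta Nt Ns k x ->
  exists (X : nat -> state) (a : nat -> ctl), [/\ X k = x,
    forall j, (k <= j <= Nt)%N -> S_ D Cb Cstar beta Nt Ns j (X j),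
    forall j, (k <= j < Nt)%N -> `|a j| <= Cb * (1 + `|X j|) /\
      `|X j.+1 - (X j + h *: (drift D (tm j) (X j) + ctrl D (tm j) *m a j))| <= CI * dx &
    \sum_(k <= j < Nt) h * ell D (tm j) (a j) (X j) (m (tm j)) + gT D (X Nt) (m T)
      <= scheme D Cb beta Nt Ns m k x].
Proof.
move=> + S1n; elim: n k x => [|n ih] k x.
  rewrite addn0 => kN Sx; exists (fun=> x), (fun=> 0); split => //.
  - move=> j /andP[kj jN].
    by have -> : j = k by apply/eqP; rewrite eqn_leq kj kN jN.
  - by move=> j; rewrite kN ltnNge andbN.
  - by rewrite kN big_geq// add0r scheme_last.
move=> knN Sx.
have kN : (k < Nt)%N by rewrite -knN addnS ltnS leq_addr.
have [[y1 Sy1 ->] _] := schemeP T0 Hord beta Nt0 NtNs m kN (S1n k x kN).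
have [y2 Sy2 Hy2] := interp_ge D Nt Hbeta k x y1
  (fun y2 => scheme D Cb beta Nt Ns m k.+1 (col_mx y1 y2)).
have Sy : Ssucc D Cb beta Nt Ns k x (col_mx y1 y2).
  by split; rewrite col_mxKu ?col_mxKd.
have [||X [a [Xk XS Xa XV]]] := ih k.+1 (col_mx y1 y2).
- by rewrite addSnnS.
- by exists x.
exists (fun j => if (j <= k)%N then x else X j),
  (fun j => if (j <= k)%N then alpha_ D Nt k x y1 else a j); split.
- by rewrite leqnn.
- move=> j /andP[kj jN]; case: leqP => jk.
    by have -> : j = k by apply/eqP; rewrite eqn_leq jk.
  by apply: XS; rewrite jk.
- move=> j /andP[kj jN]; have [jk|jk] := leqP j k.
    have -> : j = k by apply/eqP; rewrite eqn_leq jk.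
    rewrite ltnn Xk; split; first by case: Sy1.
    have := succ_consistency T0 Hord CI0 Nt0 NtNs Hbeta (ltnW kN) Sy.
    by rewrite col_mxKu.
  by rewrite leqNgt (ltn_trans jk)//=; apply: Xa; rewrite jk.
- rewrite big_ltn// leqnn leqNgt kN -addrA lerD2l; apply: le_trans Hy2.
  apply: le_trans XV; rewrite lerD2r big_nat [leRHS]big_nat.
  by apply: ler_sum => j /andP[kj _]; rewrite leqNgt kj.
Qed.

End discrete_path.

(** * Step functions *)

Section step_functions.
Context {R : realType}.

(** The values [v 0] and [v n] are continued to the left and to the right. With n = Nt - 1 the final
    time therefore belongs to the last step. *)
Fixpoint stepf (V : Type) (h : R) (v : nat -> V) (n : nat) (s : R) : V :=
  if n is n'.+1 then if s < n%:R * h then stepf h v n' s else v n else v 0.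

Lemma stepfE (V : Type) (h : R) (v : nat -> V) n j s : 0 < h -> (j <= n)%N ->
  j%:R * h <= s -> ((j < n)%N -> s < j.+1%:R * h) -> stepf h v n s = v j.
Proof.
move=> h0; elim: n => [|n ih]; first by rewrite leqn0 => /eqP ->.
rewrite leq_eqVlt => /predU1P[->|]; first by move=> /= js _; rewrite ltNge js.
move=> jn js /(_ jn) sj /=; rewrite ifT.
  by apply: ih.
by apply: lt_le_trans sj _; rewrite ler_wpM2r ?ler_nat// ltW.
Qed.

Lemma stepf_map (V W : Type) (f : V -> W) (h : R) (v : nat -> V) n s :
  f (stepf h v n s) = stepf h (fun j => f (v j)) n s.
Proof. by elim: n => //= n <-; case: ifP. Qed.

Lemma stepf_measurable d (V : measurableType d) (h : R) (v : nat -> V) n :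
  measurable_fun setT (stepf h v n).
Proof.
elim: n => [|n ih] /=; first exact: measurable_cst.
apply: measurable_fun_ifT; [|exact: ih|exact: measurable_cst].
by apply: measurable_fun_ltr; [exact: measurable_id|exact: measurable_cst].
Qed.

Lemma stepf_norm (V : normedModType R) (h M : R) (v : nat -> V) n s :
  (forall j, (j <= n)%N -> `|v j| <= M) -> `|stepf h v n s| <= M.
Proof.
elim: n => [|n ih] vM /=; first exact: vM.
by case: ifP => _; [apply: ih => j jn; apply: vM; exact: leqW|exact: vM].
Qed.

Lemma step_index (h : R) n s : 0 < h -> 0 <= s -> s <= n.+1%:R * h ->
  exists j, [/\ (j <= n)%N, j%:R * h <= s, s <= j.+1%:R * h &
    (j < n)%N -> s < j.+1%:R * h].
Proof.
move=> h0 s0; elim: n => [|n ih] sn; first by exists 0; rewrite mul0r.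
have [sn'|ns] := ltP s (n.+1%:R * h); last by exists n.+1; rewrite ltnn.
have [j [jn js sj sj']] := ih (ltW sn'); exists j; split => //; first exact: leqW.
by rewrite ltnS leq_eqVlt => /predU1P[->//|/sj'].
Qed.

Lemma stepf_bm (h : R) (v : nat -> R) n : bm (stepf h v n).
Proof.
split; first exact: stepf_measurable.
exists (\sum_(j < n.+1) `|v j|) => s; apply: stepf_norm => j jn.
rewrite (bigD1 (Ordinal (jn : (j < n.+1)%N)))//= lerDl.
by apply: sumr_ge0.
Qed.

Lemma Int_stepf (h : R) (v : nat -> R) n k j : 0 < h -> (k <= j)%N -> (j <= n.+1)%N ->
  Int (k%:R * h) (j%:R * h) (stepf h v n) = \sum_(k <= i < j) h * v i.
Proof.
move=> h0; elim: j => [|j ih].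
  by rewrite leqn0 => /eqP -> _; rewrite big_geq// Int_aa//; exact: stepf_bm.
rewrite leq_eqVlt => /predU1P[->|kj] jn.
  by rewrite big_geq// Int_aa//; exact: stepf_bm.
have mono a b : (a <= b)%N -> a%:R * h <= b%:R * h by move=> ab; rewrite ler_wpM2r ?ler_nat// ltW.
rewrite (@Int_chasles _ _ (j%:R * h)) ?mono//; last exact: stepf_bm.
rewrite big_nat_recr//= ih ?(ltnW jn)//; congr (_ + _).
have := @Int_dev _ (j%:R * h) (j.+1%:R * h) (v j) 0 (stepf h v n) (mono _ _ (leqnSn j)) (stepf_bm _ _ _).
rewrite mulr0 normr_le0 subr_eq0.
have -> : j.+1%:R * h - j%:R * h = h by rewrite -natr1; ring.
move=> H; apply/eqP/H => s /andP[js sj].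
by rewrite (@stepfE _ h v n j)// subrr normr0.
Qed.

End step_functions.

Lemma add_quarters (R : realFieldType) (a b c d : R) : 0 < d ->
  a < d / 4 -> c < d / 4 -> b <= d / 4 -> a + b + c < d.
Proof. by move=> *; lra. Qed.

Lemma small_factor (R : realType) (c b : R) : 0 <= c -> 0 < b ->
  exists2 y, 0 < y & c * y <= b.
Proof.
move=> c0 b0; have c1 : 0 < c + 1 by rewrite ltr_wpDl.
exists (b / (c + 1)); first by rewrite divr_gt0.
by rewrite mulrA ler_pdivrMr// mulrC; apply: ler_wpM2l; [exact: ltW|rewrite lerDl].
Qed.

Lemma near_small_factor (R : realType) (c b : R) : 0 <= c -> 0 < b ->
  \forall y \near 0^'+, c * y < b.
Proof.
move=> c0 b0; have c1 : 0 < c + 1 by rewrite ltr_wpDl.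
near=> y.
have y0 : 0 < y by near: y; exact: nbhs_right_gt.
apply: (@le_lt_trans _ _ ((c + 1) * y)); first by apply: ler_wpM2r; [exact: ltW|rewrite lerDl].
rewrite mulrC -ltr_pdivlMr//; near: y; apply: nbhs_right_lt.
by rewrite divr_gt0.
Unshelve. all: by end_near. Qed.

Lemma tube_sum (R : realFieldType) (d a1 a2 a3 a4 a5 : R) : 0 < d -> a1 <= d / 8 -> a2 < d / 8 ->
  a3 <= d / 8 -> a4 <= d / 8 + d / 8 + d / 8 -> a5 < d / 8 -> a1 + a2 + a3 + a4 + a5 < d.
Proof. by move=> *; lra. Qed.

Lemma tube_slack (R : realFieldType) (d dl a t : R) : 0 < d -> a + d <= dl / 4 -> 0 < dl ->
  t <= d / 8 + d / 8 + d / 8 -> a + t < dl.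
Proof. by move=> *; lra. Qed.

(** * Near-optimal controls *)

Section cost.
Context (R : realType) (r q : nat) (D : control_data R r q).
Local Notation T := (horizon D).
Local Notation state := 'cV[R]_(r + q).
Local Notation ctl := 'cV[R]_r.
Local Notation leb := (@lebesgue_measure R).
Local Notation tm := (time D).
Context (mu : R -> P1 state) (p : R).
Context (T0 : 0 < T) (mu_cont : continuous_flow T mu) (p1 : 1 < p)
  (cell : ell_continuous D) (cgT : gT_continuous D).
Context (Cl1 Cl2 Cl3 Cl4 Cg1 Cg2 Cg3 : R)
  (Cl10 : 0 < Cl1) (Cl20 : 0 < Cl2) (Cl30 : 0 < Cl3)
  (growth : growth_bounds D p Cl1 Cl2 Cl3 Cl4 Cg1 Cg2 Cg3).
Context (LA : R) (LA0 : 0 < LA)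
  (A_lip : forall t (x y : state), t \in `[0, T] ->
          `|drift D t x - drift D t y| <= LA * `|x - y|)
  (A_cont : {within [set z : (R * state)%type | z.1 \in `[0, T]],
        continuous (fun z : (R * state)%type => drift D z.1 z.2)})
  (B_cont : {within [set` `[0, T]], continuous (ctrl D)}).

Definition running (s : R) (a : ctl) (x : state) : R :=
  ell D (tau D s) a x (mu (tau D s)).

Lemma running_ge s a x : - Cl2 <= running s a x.
Proof.
have [H _ _] := growth.1 (tau D s) a x x (mu (tau D s)) (tau_in T0 s).
by apply: le_trans H; rewrite lerDr mulr_ge0 ?powR_ge0// ltW.
Qed.

Definition running_max (M : R) : R := Cl3 * (1 + M `^ p + M `^ p).

Lemma running_le s a x M : `|a| <= M -> `|x| <= M -> running s a x <= running_max M.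
Proof.
move=> aM xM.
have [_ H _] := growth.1 (tau D s) a x x (mu (tau D s)) (tau_in T0 s).
apply: le_trans H _; rewrite ler_wpM2l ?(ltW Cl30)//.
have p0 : 0 <= p by rewrite ltW// (lt_trans _ p1).
have M0 : 0 <= M by exact: le_trans aM.
by rewrite !lerD//; apply: ge0_ler_powR; rewrite ?nnegrE.
Qed.

Lemma running_continuous (c : R -> ctl) (gam : R -> state) :
  continuous c -> continuous gam -> continuous (fun s => running s (c s) (gam s)).
Proof.
move=> cc cg s; apply/cvgrPdist_lt => e e0.
have [del del0 H] := ell_modulus mu_cont cell (`|c s| + `|gam s|) e0.
near=> u; rewrite distrC; apply: H; rewrite ?lerDl ?lerDr//; try exact: tau_in.
- apply: le_lt_trans (tau_lip _ _ _) _; rewrite distrC; near: u.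
  exact: (@cvgr_dist_lt _ _ _ (nbhs s) _ id).
- by rewrite distrC; near: u; have /cvgrPdist_lt := cc s; apply.
- by rewrite distrC; near: u; have /cvgrPdist_lt := cg s; apply.
- by apply: (d1_self mu_cont) => //; exact: tau_in.
Unshelve. all: by end_near. Qed.

Lemma running_bm (c : R -> ctl) (gam : R -> state) : cb c -> cb gam ->
  bm (fun s => running s (c s) (gam s)).
Proof.
move=> [cc [M cM]] [cg [N gN]]; apply: bm_continuous; first exact: running_continuous.
exists (Num.max Cl2 (running_max (Num.max M N))) => s.
rewrite ler_norml; apply/andP; split.
  by apply: le_trans (running_ge _ _ _); rewrite lerN2 le_max lexx.
rewrite le_max; apply/orP; right.
by apply: running_le; rewrite le_max ?cM ?gN ?orbT.
Qed.

Definition borel_measurable (u : R -> ctl) := measurable_fun setT (u : R -> borel ctl).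

Lemma continuous_borel_measurable (u : R -> ctl) : continuous u -> borel_measurable u.
Proof.
move=> /continuousP cu.
apply: (@measurability _ _ _ (borel ctl) setT (u : R -> borel ctl) open); first by [].
move=> _ [U oU <-]; rewrite setTI; apply: open_measurable; exact: cu.
Qed.

(* The running cost itself need not be integrable: it is only bounded by h. *)
Lemma value_le (t : R) (x : state) (u : R -> ctl) (gam : R -> state) (h : R -> R) :
  t \in `[0, T] -> vbm u -> borel_measurable u ->
  sol (field D u) t T x gam -> bm h ->
  (forall s, t <= s <= T -> running s (u s) (gam s) <= h s) ->
  (value D p mu t x <= (Int t T h + gT D (gam T) (mu T))%:E)%E.
Proof.
move=> tT bu mu_ [cg gE] bh Hh.
move: (tT); rewrite in_itv /= => /andP[t0 tT'].
have tau_s s : t <= s <= T -> tau D s = s.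
  by move=> /andP[ts sT]; apply: tau_id; rewrite sT (le_trans t0).
have [M M0 HF] := field_ode T0 LA0 A_lip A_cont B_cont bu.
have bF := ode_vbm (ltW LA0) HF cg.
have [N N0 FN] := vbm_bounded bF.
apply: (@le_trans _ _ (cost D mu t u gam)).
  apply: ereal_inf_lbound; exists u, gam; split => //.
  - split; first exact: measurable_funTS.
    have [K K0 uK] := vbm_bounded bu.
    apply: (@le_lt_trans _ _ (\int[leb]_(s in [set` `[t, T]]) (K `^ p)%:E)%E).
      apply: le_integral_nonmeasurable => s _; rewrite lee_fin.
      by apply: ge0_ler_powR => //; rewrite ?nnegrE// ltW// (lt_trans _ p1).
    rewrite integral_cst//= lebesgue_measure_itv /=.
    by case: ifPn => _; rewrite ?mule0 ?ltry// -EFinB -EFinM ltry.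
  - split.
    (* The trajectory is Lipschitz with constant N. *)
    + move=> e e0; exists (e / (N + 1)); first by rewrite divr_gt0// ltr_wpDl.
      move=> k a b ab _; rewrite ltr_pdivlMr ?ltr_wpDl// => Hs.
      apply: le_lt_trans Hs; rewrite mulr_suml; apply: ler_sum => i _.
      have [ta [ab' bT]] := ab i.
      rewrite gE ?(le_trans ta)// gE ?ta ?(le_trans ab')//.
      rewrite opprD addrACA subrr add0r.
      apply: le_trans (vint_lipschitz bF FN ta ab') _; rewrite mulrC.
      by rewrite ler_wpM2l ?subr_ge0// lerDl.
    + have : \forall s \ae leb, forall i, t < s -> is_derive s (1 : R)
          (fun s => Int t s (fun v => field D u v (gam v) i 0)) (field D u s (gam s) i 0).
        apply: (@filter_forall _ _ _ _ (ae_filter_ringOfSetsType leb)) => i; exact: Int_derive.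
      apply: filterS; first exact: (ae_filter_ringOfSetsType leb).
      move=> s Hs; rewrite in_itv /= => /andP[ts sT].
      have -> : drift D s (gam s) + ctrl D s *m u s = field D u s (gam s).
        by rewrite /field tau_s// (ltW ts) (ltW sT).
      apply: (@primitive_derive _ _ t T s (fun v => field D u v (gam v)) gam x) => //.
        by rewrite ts.
      by move=> i; exact: Hs.
    + by rewrite gE ?lexx// vint_aa// addr0.
rewrite /cost EFinD; apply: leeD => //.
rewrite /Int /Rintegral fineK; last first.
  by apply: integrable_fin_num => //; exact: bm_integrable.
apply: le_integral_nonmeasurable => s /=; rewrite in_itv /= => sT.
by have := Hh s sT; rewrite /running tau_s// lee_fin.
Qed.

Context (Cb : R) (Cb0 : 0 < Cb) (HCb : control_bound D p Cb).

Lemma ac_clamp_cb (t : R) (g0 : R -> state) : t <= T ->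
  absolutely_continuous t T g0 -> cb (fun s => g0 (clamp t T s)).
Proof.
move=> tT ac0.
have cg : continuous (fun s => g0 (clamp t T s)).
  move=> s; apply/cvgrPdist_lt => e e0.
  have [del del0 H] := ac0 e e0.
  have H1 u w : t <= u -> u <= w -> w <= T -> w - u < del -> `|g0 w - g0 u| < e.
    move=> tu uw wT uwd; have := H 1%N (fun=> u) (fun=> w); rewrite !big_ord1; apply => //.
    by apply/trivIsetP => i j _ _; rewrite !ord1 eqxx.
  near=> u.
  have su : `|s - u| < del by near: u; exact: (@cvgr_dist_lt _ _ _ (nbhs s) _ id).
  have /andP[s1 s2] := clamp_itv s tT; have /andP[u1 u2] := clamp_itv u tT.
  have cl : `|clamp t T s - clamp t T u| < del by apply: le_lt_trans (clamp_lip _ _ _ _) su.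
  have [le1|/ltW le1] := leP (clamp t T u) (clamp t T s).
    by apply: H1 => //; apply: le_lt_trans (ler_norm _) cl.
  by rewrite distrC; apply: H1 => //; apply: le_lt_trans (ler_norm _) _; rewrite distrC.
split=> //.
have : compact ((fun s => g0 (clamp t T s)) @` `[t, T]%classic).
  apply: continuous_compact; last exact: segment_compact.
  exact: continuous_subspaceT.
move=> /compact_bounded[M [_ HM]]; exists (`|M| + 1) => s.
apply: (HM (`|M| + 1)); first by rewrite (le_lt_trans (ler_norm _))// ltrDl.
by exists (clamp t T s); [exact: clamp_in|rewrite clamp_id// clamp_itv].
Unshelve. all: by end_near. Qed.

(** Extending the optimal control by zero and truncating it at its feedback bound gives a control
    [a] that is bounded and measurable on the line. The value keeps [al]: exchanging the two inside
    the integral would require a measurable running cost. *)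
Lemma optimal_pair (t : R) (x : state) : t \in `[0, T] ->
  exists (al a : R -> ctl) (gam : R -> state),
  [/\ vbm a, exists N : set R, [/\ measurable N, leb N = 0%E &
        forall s, t <= s <= T -> ~ N s -> a s = al s],
      sol (field D a) t T x gam,
      forall s, `|a s| <= Cb * (1 + `|gam s|) &
      value D p mu t x = (\int[leb]_(s in [set` `[t, T]]) (running s (al s) (gam s))%:E
        + (gT D (gam T) (mu T))%:E)%E].
Proof.
move=> tT; move: (tT); rewrite in_itv /= => /andP[t0 tT'].
have [al [g0 [[mal _] [ac0 dg0 g0t] costE [N [mN N0 HN]]]]] := HCb.2 mu t x mu_cont tT.
pose gam s := g0 (clamp t T s).
have cg : cb gam by exact: ac_clamp_cb.
have [cgc [G gG]] := cg.
pose rho s := Cb * (1 + `|gam s|).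
have rho0 s : 0 <= rho s by rewrite mulr_ge0 ?addr_ge0// ltW.
have brho : bm rho.
  by apply: bmM; [exact: bm_cst|apply: bmD; [exact: bm_cst|apply: vbm_norm; exact: cb_vbm]].
pose al0 s : ctl := \col_i ((fun s => al s i 0) \_ `[t, T]%classic) s.
have mal0 i : measurable_fun setT (fun s => al0 s i 0).
  under eq_fun do rewrite mxE.
  apply/(measurable_restrictT (fun s => al s i 0)); first exact: measurable_itv.
  have mc : measurable_fun setT ((fun v : ctl => v i 0) : borel ctl -> R).
    by apply: continuous_measurable_real => v; exact: coord_continuous.
  exact: (measurableT_comp mc mal).
pose a s := clampv (rho s) (al0 s).
have arho s : `|a s| <= rho s by exact: norm_clampv.
have ba : vbm a.
  move=> i; split; first by apply: clampv_measurable => //; case: brho.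
  have [_ [K rhoK]] := brho; exists K => s.
  apply: le_trans (mx_norm_coord _ _ _) _; apply: le_trans (arho s) _.
  exact: le_trans (ler_norm _) (rhoK s).
have aE s : t <= s <= T -> ~ N s -> a s = al s.
  move=> sT Ns; have al0E : al0 s = al s.
    apply/colP => i; rewrite mxE patchE ifT//.
    by rewrite inE /= in_itv.
  rewrite /a clampv_id al0E//.
  have : ~ ~ (s \in `[t, T] -> `|al s| <= Cb * (1 + `|g0 s|)) by move=> H; apply: Ns; exact: HN.
  move=> /contrapT; rewrite in_itv /= sT => /(_ isT).
  by rewrite /rho /gam clamp_id.
have [M M0 HF] := field_ode T0 LA0 A_lip A_cont B_cont ba.
have bF := ode_vbm (ltW LA0) HF cg.
exists al, a, gam; split => //.
- by exists N.
- split => // s /andP[ts sT]; rewrite /gam clamp_id ?ts// -g0t.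
  apply: (@ac_integral R _ t T g0) => //; last by rewrite ts.
  have aN : {ae leb, forall s : R, s \in `[t, T] -> a s = al s}.
    exists N; split => // u /= /not_implyP[uT nE]; apply: contrapT => Nu.
    by apply: nE; apply: aE => //; move: uT; rewrite in_itv.
  apply: (@filterS2 _ _ (ae_filter_ringOfSetsType leb) _ _ _ _ dg0 aN).
  move=> u du au uT; move: (uT); rewrite in_itv /= => /andP[tu uT'].
  have utT : t <= u <= T by rewrite (ltW tu) (ltW uT').
  have -> : field D a u (gam u) = drift D u (g0 u) + ctrl D u *m al u.
    rewrite /field tau_id ?(ltW uT') ?(le_trans t0 (ltW tu))// au ?in_itv//.
    by rewrite /gam clamp_id.
  exact: du.
- rewrite -costE /cost; congr (_ + _)%E.
    apply: eq_integral => s; rewrite inE /= in_itv /= => /andP[ts sT].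
    by rewrite /running tau_id ?sT ?(le_trans t0)// /gam clamp_id ?ts.
  by rewrite /gam clamp_id// tT' lexx.
Qed.

Lemma feedback_bound (Rb : R) : 0 <= Rb -> exists2 R1, 0 <= R1 &
  forall (t : R) (x : state) (a : R -> ctl) (gam : R -> state), t \in `[0, T] ->
  `|x| <= Rb -> vbm a -> sol (field D a) t T x gam ->
  (forall s, `|a s| <= Cb * (1 + `|gam s|)) ->
  forall s, t <= s <= T -> `|gam s| <= R1.
Proof.
move=> Rb0.
have [CA CA0 HA] := drift_growth T0 LA0 A_lip A_cont.
have [CB CB0 HB] := ctrl_bound T0 B_cont.
pose k := r%:R * CB * Cb.
have k0 : 0 <= k by rewrite !mulr_ge0// ltW.
pose L := LA + k.
have L0 : 0 < L by rewrite ltr_wpDr.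
pose a0 := Rb + (CA + k) * T.
have a00 : 0 <= a0 by rewrite addr_ge0// mulr_ge0 ?addr_ge0// ltW.
exists (2 * a0 * expR (2 * L * T)); first by rewrite !mulr_ge0 ?expR_ge0.
move=> t x a gam; rewrite in_itv /= => /andP[t0 tT] xR ba [cg gE] aC s sT.
have bg := vbm_norm (cb_vbm cg).
have [M M0 HF] := field_ode T0 LA0 A_lip A_cont B_cont ba.
have bF := ode_vbm (ltW LA0) HF cg.
have /(_ s sT) : forall s, t <= s <= T -> `|gam s| <= 2 * a0 * expw (2 * L) t T s.
  apply: (@gronwall _ t T _ L (fun s => `|gam s|)) => // u /andP[tu uT].
  rewrite [in leLHS]gE ?tu// (le_trans (ler_normD _ _))//.
  apply: (@le_trans _ _ (Rb + Int t u (fun v => (CA + k) + L * `|gam v|))).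
    apply: lerD => //; apply: vint_le => //.
      by apply: bmD; [exact: bm_cst|apply: bmM => //; exact: bm_cst].
    move=> v _; rewrite /field; apply: le_trans (ler_normD _ _) _.
    have h1 := HA (tau D v) (gam v) (tau_in T0 v).
    have h2 : `|ctrl D (tau D v) *m a v| <= r%:R * CB * (Cb * (1 + `|gam v|)).
      apply: le_trans (norm_mulmx _ _) _; apply: ler_pM => //.
      by rewrite ler_wpM2l// HB// tau_in.
    apply: le_trans (lerD h1 h2) _.
    rewrite le_eqVlt; apply/orP; left; apply/eqP; rewrite /L /k; ring.
  rewrite IntD//; [|exact: bm_cst|by apply: bmM => //; exact: bm_cst].
  rewrite Int_cst// IntZ// addrA lerD2r /a0 lerD2l ler_wpM2l ?addr_ge0//.
  by rewrite (le_trans _ uT)// gerBl.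
move=> /le_trans; apply; rewrite ler_wpM2l ?mulr_ge0//.
apply: le_trans (expw_le _ _ _) _ => //; first by rewrite mulr_ge0// ltW.
by rewrite ler_expR ler_wpM2l ?mulr_ge0 ?(ltW L0)// gerBl.
Qed.

Lemma running_modulus (M e : R) : 0 < e -> exists2 del, 0 < del &
  forall s (a c : ctl) (y z : state), `|c| <= M -> `|z| <= M ->
   `|a - c| < del -> `|y - z| < del -> `|running s a y - running s c z| < e.
Proof.
move=> e0; have [del del0 H] := ell_modulus mu_cont cell M e0.
exists del => // s a c y z cM zM ac yz; apply: H => //; try exact: tau_in.
  by rewrite subrr normr0.
by apply: (d1_self mu_cont) => //; exact: tau_in.
Qed.

(* Far from c the lower growth bound on the running cost takes over, so that the
   inequality holds for every control value a. *)
Lemma running_lower (M e : R) : 0 <= M -> 0 < e -> exists K del, [/\ 0 <= K, 0 < del &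
  forall s (a c : ctl) (y z : state), `|c| <= M -> `|z| <= M -> `|y - z| < del ->
   running s c z - e - K * `|a - c| <= running s a y].
Proof.
move=> M0 e0; have [del del0 H] := running_modulus M e0.
pose X := `|running_max M| + Cl2.
have X0 : 0 <= X by rewrite addr_ge0// ltW.
exists (X / del), del; split => //; first by rewrite divr_ge0// ltW.
move=> s a c y z cM zM yz.
have [ac|ac] := ltP `|a - c| del.
  have := H s a c y z cM zM ac yz; rewrite ltr_norml => /andP[h _].
  have : 0 <= X / del * `|a - c| by rewrite mulr_ge0// divr_ge0// ltW.
  by move: h; set u := _ * _; move=> ? ?; lra.
have h1 : X <= X / del * `|a - c| by rewrite mulrAC ler_pdivlMr// ler_wpM2l.
have h2 := running_ge s a y; have h3 := running_le s cM zM.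
have h4 := ler_norm (running_max M).
move: h1; set u := _ * `|_|; rewrite /X => h1; lra.
Qed.

(** [M0] is fixed before e, t and x; the modulus of continuity of c is not. The bound on c has an
    extra e because c is truncated along the optimal trajectory and not along its own. *)
Lemma near_optimal_control (Rb : R) : 0 <= Rb -> exists2 M0, 0 <= M0 &
  forall e t (x : state), 0 < e -> t \in `[0, T] -> `|x| <= Rb ->
  exists (c : R -> ctl) (gam : R -> state),
  [/\ cb c, forall s, `|c s| <= M0, sol (field D c) t T x gam,
      forall s, t <= s <= T -> `|c s| <= Cb * (1 + `|gam s|) + e &
      ((Int t T (fun s => running s (c s) (gam s)) + gT D (gam T) (mu T))%:E
        <= value D p mu t x + e%:E)%E].
Proof.
move=> Rb0; have [R1 R10 HR1] := feedback_bound Rb0.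
pose M0 := Cb * (1 + R1).
have M00 : 0 <= M0 by rewrite mulr_ge0 ?addr_ge0// ltW.
exists M0 => // e t x e0 tT xR.
have [al [a [gst [ba [N [mN N0 aE]] sst aC valE]]]] := optimal_pair x tT.
have gR1 := HR1 t x a gst tT xR ba sst aC.
move: (tT); rewrite in_itv /= => /andP[t0 tT'].
have [CB CB0 HB] := ctrl_bound T0 B_cont.
pose Mb := M0 + (R1 + 1).
have Mb0 : 0 <= Mb by rewrite !addr_ge0.
have e3 : 0 < e / 3 by rewrite divr_gt0.
have e1 : 0 < e / 3 / (T + 1) by rewrite divr_gt0// ltr_wpDl// ltW.
have [K [d1_ [K0 d10 HK]]] := running_lower Mb0 e1.
have [d2 d20 Hd2] := gT_modulus T0 mu_cont cgT Mb e3.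
(* Distance allowed between the trajectories: [d1_] and [d2] serve the running and final costs, 1
   keeps the new curve in the ball of radius [Mb], and [e / Cb] is the slack of the feedback
   bound. *)
pose dd := Num.min (Num.min d1_ d2) (Num.min 1 (e / Cb)) / 2.
have dd0 : 0 < dd by rewrite divr_gt0// !lt_min d10 d20 ltr01 divr_gt0.
have ddl y : Num.min (Num.min d1_ d2) (Num.min 1 (e / Cb)) <= y -> 0 < y -> dd < y.
  move=> h y0; rewrite /dd ltr_pdivrMr//; apply: le_lt_trans h _.
  by rewrite ltr_pMr// ltr1n.
have dd1 : dd < d1_ by apply: ddl => //; rewrite !ge_min lexx.
have dd2 : dd < d2 by apply: ddl => //; rewrite !ge_min lexx orbT.
have dd3 : dd < 1 by apply: ddl => //; rewrite !ge_min lexx !orbT.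
have dd4 : dd < e / Cb by apply: ddl; rewrite ?divr_gt0// !ge_min lexx !orbT.
pose C1 := 2 * (r%:R * CB) * expR (2 * LA * T).
have C10 : 0 <= C1 by rewrite !mulr_ge0 ?expR_ge0.
(* Allowed L1 error of the control: the first term keeps the trajectories within [dd], the second
   bounds the penalty [K * |a - c|] of [running_lower]. *)
pose eta := Num.min (dd / (C1 + 1)) (e / 3 / (K + 1)).
have eta0 : 0 < eta.
  by rewrite lt_min; apply/andP; split; apply: divr_gt0 => //; rewrite ltr_wpDl.
have eta1 : C1 * eta <= dd.
  apply: (@le_trans _ _ ((C1 + 1) * (dd / (C1 + 1)))).
    by apply: ler_pM; rewrite ?lerDl ?(ltW eta0)// ge_min lexx.
  by rewrite mulrC divfK// gt_eqF// ltr_wpDl.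
have eta2 : K * eta <= e / 3.
  apply: (@le_trans _ _ ((K + 1) * (e / 3 / (K + 1)))).
    by apply: ler_pM; rewrite ?lerDl ?(ltW eta0)// ge_min lexx orbT.
  by rewrite mulrC divfK// gt_eqF// ltr_wpDl.
have [c0 cc0 Hc0] := vbm_approx t T ba eta0.
have rho0 s : 0 <= Cb * (1 + `|gst s|) by rewrite mulr_ge0 ?addr_ge0// ltW.
pose c s := clampv (Cb * (1 + `|gst (clamp t T s)|)) (c0 (clamp t T s)).
have cM0 s : `|c s| <= M0.
  apply: le_trans (norm_clampv _ _) _ => //; rewrite ler_wpM2l ?(ltW Cb0)// lerD2l.
  by apply: gR1; exact: clamp_itv.
have ccl (V : normedModType R) (f : R -> V) : continuous f -> continuous (fun s => f (clamp t T s)).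
  move=> cf s; apply: (@continuous_comp _ _ _ (clamp t T) f); first exact: clamp_continuous.
  exact: cf.
have cc : cb c.
  split; last by exists M0.
  apply: (@clampv_continuous R r (fun s => Cb * (1 + `|gst (clamp t T s)|))
    (fun s => c0 (clamp t T s))); last by apply: ccl; case: cc0.
  move=> s; apply: cvgM; first exact: cvg_cst.
  apply: cvgD; first exact: cvg_cst.
  apply: cvg_norm; apply: ccl; exact: sst.1.1.
have cE s : t <= s <= T -> c s = clampv (Cb * (1 + `|gst s|)) (c0 s).
  by move=> sT; rewrite /c clamp_id.
have ca s : t <= s <= T -> `|a s - c s| <= `|a s - c0 s|.
  by move=> sT; rewrite cE// distrC [leRHS]distrC; exact: clampv_dist.
have bc := cb_vbm cc.
have bac : bm (fun s => `|a s - c s|) by apply: vbm_norm; exact: vbmB.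
have Hca : Int t T (fun s => `|a s - c s|) <= eta.
  apply: le_trans Hc0; apply: Int_le => //.
  by apply: vbm_norm; apply: vbmB => //; exact: cb_vbm.
have [M MM HF] := field_ode T0 LA0 A_lip A_cont B_cont bc.
have [gam sgam] := @ode_exists R _ LA M (field D c) t T x LA0 tT' HF.
have bFg := ode_vbm (ltW LA0) HF sgam.1.
have bFs := ode_vbm (ltW LA0) HF sst.1.
have [Ma MMa HFa] := field_ode T0 LA0 A_lip A_cont B_cont ba.
have bFa := ode_vbm (ltW LA0) HFa sst.1.
have close s : t <= s <= T -> `|gam s - gst s| <= dd.
  move=> sT; apply: le_trans eta1.
  have -> : C1 * eta = 2 * (r%:R * CB * eta) * expR (2 * LA * T) by rewrite /C1; ring.
  have a0 : 0 <= r%:R * CB * eta by rewrite !mulr_ge0// ltW.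
  apply: (@le_trans _ _ (2 * (r%:R * CB * eta) * expR (2 * LA * (T - t)))); last first.
    apply: ler_wpM2l; first by rewrite mulr_ge0.
    by rewrite ler_expR; apply: ler_wpM2l; [rewrite mulr_ge0// ltW|rewrite gerBl].
  apply: (@sol_stable R _ LA M (field D c) t T gam gst (r%:R * CB * eta) LA0 tT' HF
    sgam.1 sst.1 a0 _ s sT) => u /[dup] uT /andP[tu uT'].
  rewrite (sgam.2 u uT) (sst.2 u uT) addrK.
  have -> : x - (x + vint t u (fun v => field D a v (gst v)) -
      vint t u (fun v => field D c v (gst v))) =
      - vint t u (fun v => field D a v (gst v) - field D c v (gst v)).
    by rewrite vintB//; apply/colP => i; rewrite !mxE; ring.
  rewrite normrN.
  apply: (@le_trans _ _ (Int t u (fun v => r%:R * CB * `|a v - c v|))).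
    apply: vint_le => //; first exact: vbmB.
      by apply: bmM => //; exact: bm_cst.
    move=> v _; rewrite /field opprD addrACA subrr add0r -mulmxBr.
    apply: le_trans (norm_mulmx _ _) _; rewrite ler_wpM2r// ler_wpM2l// HB//.
    exact: tau_in.
  rewrite IntZ// ler_wpM2l ?mulr_ge0//; apply: le_trans Hca.
  rewrite (@Int_chasles _ t u T)// lerDl.
  by apply: Rintegral_ge0 => v _.
have gMb s : t <= s <= T -> `|gam s| <= Mb.
  move=> sT; rewrite -[gam s](subrK (gst s)) addrC (le_trans (ler_normD _ _))//.
  have := close s sT; have := gR1 s sT; rewrite /Mb => h1 h2; lra.
have cMb s : `|c s| <= Mb by rewrite (le_trans (cM0 s))// lerDl addr_ge0.
exists c, gam; split => //.
- move=> s sT; rewrite cE//; apply: le_trans (norm_clampv _ (rho0 s)) _.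
  have h : `|gst s| <= `|gam s| + dd.
    rewrite -[gst s](subrK (gam s)) addrC (le_trans (ler_normD _ _))// lerD2l.
    by rewrite distrC; exact: close.
  apply: (@le_trans _ _ (Cb * (1 + (`|gam s| + dd)))).
    by rewrite ler_wpM2l ?(ltW Cb0)// lerD2l.
  rewrite addrA mulrDr lerD2l mulrC -ler_pdivlMr//; exact: ltW.
rewrite valE.
pose f s := running s (c s) (gam s).
have bf : bm f by apply: running_bm => //; exact: sgam.1.
pose h s := f s - e / 3 / (T + 1) - K * `|a s - c s|.
have bh : bm h.
  apply: bmB; first by apply: bmB => //; exact: bm_cst.
  by apply: bmM => //; exact: bm_cst.
(* On the null set N, where [al] may differ from [a], h gives way to the lower bound -Cl2 of the
   running cost: h' is below the running cost of [al] at every time and has the integral of h. *)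
pose h' s := h s * \1_(~` N) s + (- Cl2) * \1_N s.
have bind (A : set R) : measurable A -> bm (\1_A : R -> R).
  move=> mA; split; first exact: measurable_indic.
  by exists 1 => s; rewrite indicE; case: (s \in A); rewrite ?normr1 ?normr0.
have bh' : bm h'.
  apply: bmD; apply: bmM => //; [|exact: bm_cst|exact: bind].
  by apply: bind; exact: measurableC.
have hh' : Int t T h = Int t T h'.
  apply: (@Int_ae_eq _ t T h h' N) => // s Ns.
  by rewrite /h' !indicE in_setC !memNset// mulr1 mulr0 addr0.
have lower : ((Int t T h)%:E <= \int[leb]_(s in `[t, T]) (running s (al s) (gst s))%:E)%E.
  rewrite hh' /Int /Rintegral fineK; last first.
    by apply: integrable_fin_num => //; exact: bm_integrable.
  apply: le_integral_nonmeasurable => s /=; rewrite in_itv /= => sT.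
  rewrite lee_fin /h' !indicE in_setC; have [Ns|Ns] := boolP (s \in N).
    by rewrite mulr0 add0r mulr1; exact: running_ge.
  rewrite mulr1 mulr0 addr0 /h /f (aE s sT); last by move=> /mem_set; exact/negP.
  apply: HK => //; first exact: gMb.
  by rewrite distrC; apply: le_lt_trans (close s sT) dd1.
have gclose : gT D (gam T) (mu T) <= gT D (gst T) (mu T) + e / 3.
  have TT : t <= T <= T by rewrite tT' lexx.
  have := Hd2 (gam T) (gst T) (mu T) (gMb T TT).
  rewrite distrC => /(_ (le_lt_trans (close T TT) dd2)).
  have TI : T \in `[0, T] by rewrite in_itv /= (le_trans t0 tT') lexx.
  move=> /(_ (d1_self mu_cont TI d20)); rewrite ltr_norml => /andP[h1 h2].
  by move: h1; set u := gT D _ _; set v := gT D _ _; move=> h1; lra.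
have IntE : Int t T h = Int t T f - e / 3 / (T + 1) * (T - t) - K * Int t T (fun s => `|a s - c s|).
  rewrite /h IntB; [|by apply: bmB => //; exact: bm_cst|by apply: bmM => //; exact: bm_cst].
  by rewrite IntB//; [rewrite Int_cst// IntZ|exact: bm_cst].
have i1 : e / 3 / (T + 1) * (T - t) <= e / 3.
  rewrite mulrAC ler_pdivrMr; last by rewrite ltr_wpDl// ltW.
  by apply: ler_wpM2l; [exact: ltW|lra].
have i2 : K * Int t T (fun s => `|a s - c s|) <= e / 3.
  by apply: le_trans eta2; rewrite ler_wpM2l.
apply: (@le_trans _ _ ((Int t T h)%:E + (gT D (gst T) (mu T))%:E + e%:E)%E).
  rewrite -!EFinD lee_fin IntE -/f.
  move: i1 i2 gclose; set u := _ * (T - t); set v := K * _; set w := Int t T f.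
  by move=> *; lra.
by apply: leeD => //; apply: leeD.
Qed.

Lemma trajectory_bounds (M0 Rb : R) : 0 <= Rb -> exists R1 M2, [/\ 0 <= R1, 0 <= M2 &
  forall (u : R -> ctl) t (x : state) (gam : R -> state), vbm u -> (forall s, `|u s| <= M0) ->
    t \in `[0, T] -> `|x| <= Rb -> sol (field D u) t T x gam ->
    (forall s, t <= s <= T -> `|gam s| <= R1) /\
    (forall s s', t <= s -> s <= s' -> s' <= T -> `|gam s' - gam s| <= M2 * (s' - s))].
Proof.
move=> Rb0; have [M M00 HM] := field_ode_bounded T0 LA0 A_lip A_cont B_cont M0.
have [LA0' T0'] : 0 <= LA /\ 0 <= T by rewrite !ltW.
pose R1 := 2 * (Rb + M * T) * expR (2 * LA * T).
have R10 : 0 <= R1 by rewrite !mulr_ge0 ?expR_ge0// addr_ge0// mulr_ge0.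
exists R1, (M + LA * R1); split => //; first by rewrite addr_ge0// mulr_ge0.
move=> u t x gam bu uM0; rewrite in_itv /= => /andP[t0 tT] xR sg.
have HF := HM u bu uM0.
have gR s : t <= s <= T -> `|gam s| <= R1.
  move=> sT; apply: le_trans (sol_bound LA0 tT HF sg sT) _.
  apply: ler_pM; rewrite ?expR_ge0 ?mulr_ge0 ?addr_ge0 ?mulr_ge0 ?subr_ge0//.
    by apply: ler_wpM2l => //; apply: lerD => //; apply: ler_wpM2l => //; rewrite gerBl.
  by rewrite ler_expR; apply: ler_wpM2l; [rewrite mulr_ge0|rewrite gerBl].
split => // s s' ts ss' s'T.
have bF := ode_vbm LA0' HF sg.1.
rewrite !sg.2 ?ts ?(le_trans ts) ?(le_trans ss')// opprD addrACA subrr add0r.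
rewrite (@vint_chasles _ _ t s s')// addrAC subrr add0r.
apply: vint_bound_co => //; last by rewrite addr_ge0// mulr_ge0.
move=> v /andP[sv vs']; apply: le_trans (ode_growth HF _ _) _.
rewrite lerD2l; apply: ler_wpM2l => //; apply: gR.
by rewrite (le_trans ts)//= (le_trans _ s'T)// ltW.
Qed.

(** A control near-optimal for the later time t is defined on the whole line and can be applied from
    tb on; the additional cost on [tb, t] is small. *)
Lemma value_time_shift (Rb e : R) : 0 <= Rb -> 0 < e -> exists2 del, 0 < del &
  forall tb t (xb x : state), tb \in `[0, T] -> t \in `[0, T] -> tb <= t -> t - tb <= del ->
  `|x| <= Rb -> `|xb| <= Rb -> `|xb - x| <= del ->
  (value D p mu tb xb <= value D p mu t x + e%:E)%E.
Proof.
move=> Rb0 e0.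
have [M0 M00 HM0] := near_optimal_control Rb0.
have [R1 [M2 [R10 M20 HR]]] := trajectory_bounds M0 Rb0.
have [M MM HM] := field_ode_bounded T0 LA0 A_lip A_cont B_cont M0.
have [LA0' T0'] : 0 <= LA /\ 0 <= T by rewrite !ltW.
pose Mb := M0 + R1.
have M0b : M0 <= Mb by rewrite lerDl.
have R1b : R1 <= Mb by rewrite lerDr.
have e4 : 0 < e / 4 by rewrite divr_gt0.
have e4T : 0 < e / 4 / T by rewrite divr_gt0.
have [d1_ d10 Hd1] := running_modulus Mb e4T.
have [d2 d20 Hd2] := gT_modulus T0 mu_cont cgT Mb e4.
pose K := `|running_max Mb| + Cl2.
have K0 : 0 < K by rewrite ltr_wpDl.
(* At time t the trajectories differ by at most [(1 + M2) * del]: del from the initial points, M2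
   del from the motion on [tb, t]. The rest is the Gronwall factor. *)
pose C := 2 * (1 + M2) * expR (2 * LA * T).
have C0 : 0 < C by rewrite !mulr_gt0 ?expR_gt0// ltr_wpDr.
pose del := Num.min (e / 4 / K) (Num.min (d1_ / (2 * C)) (d2 / (2 * C))).
have del0 : 0 < del by rewrite !lt_min !divr_gt0// mulr_gt0.
have delK : K * del <= e / 4 by rewrite mulrC -ler_pdivlMr// ge_min lexx.
have half (y : R) : 0 < y -> del <= y / (2 * C) -> C * del < y.
  move=> y0 h; apply: (@le_lt_trans _ _ (y / 2)); last by rewrite ltr_pdivrMr// ltr_pMr// ltr1n.
  rewrite mulrC -ler_pdivlMr//; apply: le_trans h _.
  by rewrite -mulrA -invfM.
have delC1 : C * del < d1_ by apply: half; rewrite // !ge_min lexx !orbT.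
have delC2 : C * del < d2 by apply: half; rewrite // !ge_min lexx !orbT.
exists del => // tb t xb x tbT tT tbt ttb xR xbR xbx.
have [c [gam [cc cM0 sg _ opt]]] := HM0 _ t x e4 tT xR.
have bc := cb_vbm cc; have HF := HM c bc cM0.
move: (tT) (tbT); rewrite !in_itv /= => /andP[t0 tT'] /andP[tb0 tbT'].
have [gb sgb] := @ode_exists R _ LA M (field D c) tb T xb LA0 tbT' HF.
have [gR _] := HR c t x gam bc cM0 tT xR sg.
have [gbR gbL] := HR c tb xb gb bc cM0 tbT xbR sgb.
have bFb := ode_vbm LA0' HF sgb.1.
have close s : t <= s <= T -> `|gam s - gb s| <= C * del.
  move=> sT.
  have -> : C * del = 2 * ((1 + M2) * del) * expR (2 * LA * T) by rewrite /C; ring.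
  have a0 : 0 <= (1 + M2) * del by rewrite mulr_ge0 ?addr_ge0// ltW.
  apply: (@le_trans _ _ (2 * ((1 + M2) * del) * expR (2 * LA * (T - t)))); last first.
    apply: ler_wpM2l; first by rewrite mulr_ge0.
    by rewrite ler_expR; apply: ler_wpM2l; [rewrite mulr_ge0|rewrite gerBl].
  apply: (@sol_stable R _ LA M (field D c) t T gam gb _ LA0 tT' HF sg.1 sgb.1 a0 _ s sT).
  move=> u /[dup] uT /andP[tu uT'].
  rewrite (sg.2 u uT) addrK (sgb.2 u) ?uT' ?(le_trans tbt)//.
  rewrite (@vint_chasles _ _ tb t u)// addrA addrK.
  have := sgb.2 t; rewrite tbt tT' => /(_ isT) <-.
  rewrite -[x - _](subrKA xb) mulrDl mul1r; apply: le_trans (ler_normD _ _) _.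
  apply: lerD; first by rewrite distrC.
  have := sgb.2 tb; rewrite lexx tbT' => /(_ isT); rewrite vint_aa// addr0 => <-.
  rewrite distrC; apply: le_trans (gbL tb t _ _ _) _ => //.
  by apply: ler_wpM2l.
pose hh s := running s (c s) (gb s).
have bh : bm hh := running_bm cc sgb.1.
have bg := running_bm cc sg.1.
have hK s : tb <= s <= T -> `|hh s| <= K.
  move=> sT; rewrite ler_norml; apply/andP; split.
    apply: le_trans (running_ge _ _ _).
    by rewrite lerN2 lerDr.
  apply: le_trans (running_le s (le_trans (cM0 s) M0b) (le_trans (gbR s sT) R1b)) _.
  by apply: le_trans (ler_norm _) _; rewrite lerDl ltW.
apply: le_trans (value_le tbT bc _ sgb bh _) _.
- by apply: continuous_borel_measurable; case: cc.
- by move=> s _; exact: lexx.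
have i1 : Int tb t hh <= e / 4.
  apply: le_trans (ler_norm _) _; apply: le_trans (Int_bound tbt bh _) _.
    by move=> s /andP[ts st]; apply: hK; rewrite ts (le_trans st).
  by apply: le_trans delK; apply: ler_wpM2l => //; exact: ltW.
have i2 : Int t T hh <= Int t T (fun s => running s (c s) (gam s)) + e / 4.
  apply: (@le_trans _ _ (Int t T (fun s => running s (c s) (gam s) + e / 4 / T))).
    apply: Int_le => //; first by apply: bmD => //; exact: bm_cst.
    move=> s sT; rewrite -lerBlDl; apply: le_trans (ler_norm _) _; apply: ltW.
    apply: Hd1; rewrite ?subrr ?normr0//.
    + exact: le_trans (cM0 s) M0b.
    + exact: le_trans (gR s sT) R1b.
    + by rewrite distrC; exact: le_lt_trans (close s sT) delC1.
  rewrite IntD//; last exact: bm_cst.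
  rewrite lerD2l Int_cst// mulrAC ler_pdivrMr//; apply: ler_wpM2l; first exact: ltW.
  by rewrite gerBl.
have TT : t <= T <= T by rewrite tT' lexx.
have i3 : gT D (gb T) (mu T) <= gT D (gam T) (mu T) + e / 4.
  rewrite -lerBlDl; apply: le_trans (ler_norm _) _; apply: ltW; apply: Hd2.
  + exact: le_trans (gR T TT) R1b.
  + by rewrite distrC; exact: le_lt_trans (close T TT) delC2.
  + by apply: (d1_self mu_cont) => //; rewrite in_itv /= lexx T0'.
rewrite (@Int_chasles _ tb t T)//.
apply: (@le_trans _ _ ((Int t T (fun s => running s (c s) (gam s)) + gT D (gam T) (mu T) + 3 * (e / 4))%:E)).
  rewrite lee_fin; move: i1 i2 i3.
  set z1 := Int _ _ _; set z2 := Int _ _ _; set z3 := Int _ _ _; set z4 := gT _ _ _.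
  by set z5 := gT _ _ _; move=> *; lra.
rewrite EFinD; apply: le_trans (leeD2r _ opt) _.
rewrite -addeA; apply: leeD => //; rewrite -EFinD lee_fin.
by have -> : e / 4 + 3 * (e / 4) = e by field.
Qed.

Context (Hord : coordinates_ordered D) (Cstar CI : R) (Cstar0 : 0 < Cstar) (CI0 : 0 < CI).

(** * Convergence *)

(** The error splits into propagation of the previous distance, motion of the trajectory during the
    step, time variation om of the data, and mismatch th of the controls. The lower bound uses th =
    0, the tube its truncation error. *)
Lemma euler_error (CB t s0 h th om Ua M2 : R) (x y : state) (a : ctl)
    (u : R -> ctl) (gam : R -> state) :
  vbm u -> sol (field D u) t T y gam -> 0 <= t -> t <= s0 -> 0 <= h -> s0 + h <= T ->
  (forall v, v \in `[0, T] -> `|ctrl D v| <= CB) ->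
  0 <= CB -> 0 <= th -> 0 <= om -> 0 <= M2 -> `|a| <= Ua ->
  (forall s, s0 <= s < s0 + h -> [/\ `|u s - a| <= th, `|gam s - gam s0| <= M2 * h,
    `|drift D s x - drift D s0 x| <= om & `|ctrl D s - ctrl D s0| <= om]) ->
  `|gam (s0 + h) - (x + h *: (drift D s0 x + ctrl D s0 *m a))| <=
    (1 + h * LA) * `|gam s0 - x| +
    h * (LA * (M2 * h) + om + r%:R * om * Ua + r%:R * CB * th).
Proof.
move=> bu [cg gE] t0 ts0 h0 shT HB CB0 th0 om0 M20 aUa H.
have Ua0 : 0 <= Ua by exact: le_trans aUa.
have [M MM HF] := field_ode T0 LA0 A_lip A_cont B_cont bu.
have bF := ode_vbm (ltW LA0) HF cg.
have s0T : s0 <= T by rewrite (le_trans _ shT)// lerDl.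
have s0h : s0 <= s0 + h by rewrite lerDl.
pose w := drift D s0 x + ctrl D s0 *m a.
pose K := LA * (M2 * h + `|gam s0 - x|) + om + r%:R * om * Ua + r%:R * CB * th.
have LA0' := ltW LA0.
have K0 : 0 <= K by rewrite !addr_ge0// !mulr_ge0// ?addr_ge0// mulr_ge0.
have dev : `|vint s0 (s0 + h) (fun v => field D u v (gam v)) - (s0 + h - s0) *: w|
    <= (s0 + h - s0) * K.
  apply: vint_dev => // s /andP[s0s ssh].
  have [h1 h2 h3 h4] := H s (introT andP (conj s0s ssh)).
  have sT : 0 <= s <= T by rewrite (le_trans t0 (le_trans ts0 s0s)) (le_trans (ltW ssh)).
  have sI : s \in `[0, T] by rewrite in_itv.
  rewrite /field tau_id//.
  have -> : drift D s (gam s) + ctrl D s *m u s - w =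
      (drift D s (gam s) - drift D s x) + (drift D s x - drift D s0 x) +
      (ctrl D s - ctrl D s0) *m a + ctrl D s *m (u s - a).
    rewrite /w mulmxBl mulmxBr; apply/colP => i; rewrite !mxE; ring.
  apply: le_trans (ler_normD _ _) _; apply: lerD; last first.
    by apply: le_trans (norm_mulmx _ _) _; apply: ler_pM => //; apply: ler_wpM2l => //; exact: HB.
  apply: le_trans (ler_normD _ _) _; apply: lerD; last first.
    by apply: le_trans (norm_mulmx _ _) _; apply: ler_pM => //; apply: ler_wpM2l.
  apply: le_trans (ler_normD _ _) _; apply: lerD => //.
  apply: le_trans (A_lip _ _ sI) _; apply: ler_wpM2l => //.
  rewrite -[gam s - x](subrKA (gam s0)); apply: le_trans (ler_normD _ _) _.
  by rewrite lerD2r.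
have gS : gam (s0 + h) = gam s0 + vint s0 (s0 + h) (fun v => field D u v (gam v)).
  rewrite gE ?shT ?(le_trans ts0)// (@vint_chasles _ _ t s0)// addrA -gE//.
  by rewrite ts0.
rewrite addrAC subrr add0r in dev.
have -> : gam (s0 + h) - (x + h *: w) = (gam s0 - x) +
    (vint s0 (s0 + h) (fun v => field D u v (gam v)) - h *: w).
  by rewrite gS opprD addrACA.
apply: le_trans (ler_normD _ _) _; apply: le_trans (lerD (lexx _) dev) _.
rewrite le_eqVlt; apply/orP; left; apply/eqP; rewrite /K; ring.
Qed.

(** All smallness requirements in one number: estimates are stated for eta near 0+, and the limits
    in n serve only to reach a given eta. *)
Record fine_scheme (eta : R) (beta : 'cV[R]_q -> 'cV[R]_q -> R) (Nt Ns : nat)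
    (m : R -> P1 state) : Prop := FineScheme {
  fine_Nt : (0 < Nt)%N ;
  fine_Ns : (Nt <= Ns)%N ;
  fine_basis : Q1_basis CI (space_step R Ns) beta ;
  fine_step : time_step D Nt < eta ;
  fine_ratio : Nt%:R / Ns%:R < eta ;
  fine_flow : forall t, t \in `[0, T] -> (d1 (m t) (mu t) < eta%:E)%E }.

Lemma rounding_small (Cinv b : R) : 0 <= Cinv -> 0 < b -> \forall eta \near 0^'+,
  forall beta Nt Ns m, fine_scheme eta beta Nt Ns m ->
    Cinv * (space_step R Ns / time_step D Nt) < b.
Proof.
move=> Cinv0 b0; near=> eta => beta Nt Ns m [Nt0 NtNs _ _ ratio _].
rewrite (space_stepE T0 Nt0 NtNs).
have h0 := time_step_gt0 T0 Nt0.
have -> : Nt%:R / Ns%:R * (time_step D Nt / T) / time_step D Nt = Nt%:R / Ns%:R / T :> R.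
  by field; rewrite (gt_eqF h0) (gt_eqF T0) pnatr_eq0 -lt0n (leq_trans Nt0).
apply: (@le_lt_trans _ _ (Cinv / T * eta)).
  rewrite [leRHS]mulrAC -[leRHS]mulrA; apply: ler_wpM2l => //.
  by apply: ler_wpM2r; [rewrite invr_ge0 ltW|exact: ltW].
by near: eta; apply: near_small_factor; rewrite // divr_ge0// ltW.
Unshelve. all: by end_near. Qed.

(** Rounding the zero control gives a control of size below Cb, which is admissible at every
    state. *)
Lemma successors_nonempty : \forall eta \near 0^'+, forall beta Nt Ns m,
  fine_scheme eta beta Nt Ns m ->
  forall k (x : state), (k < Nt)%N -> S1_ D Cb Nt Ns k x !=set0.
Proof.
have [Cinv Cinv0 Hinv] := ctrl_inverse_bound B_cont Hord.
near=> eta => beta Nt Ns m fine k x kN.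
have [|y1 Sy1 _] := @control_rounding _ _ _ _ T0 Hord Cb Nt Ns (fine_Nt fine) (fine_Ns fine) Cinv k x 0
  (ltnW kN) Cinv0 Hinv; last by exists y1.
rewrite normr0 add0r; apply: (@le_trans _ _ Cb).
  by apply/ltW; move: beta Nt Ns m {k x kN} fine; near: eta; exact: rounding_small.
by rewrite ler_peMr ?lerDl// ltW.
Unshelve. all: by end_near. Qed.

Lemma scheme_lower_bound (e : R) : 0 < e -> \forall eta \near 0^'+,
  forall beta Nt Ns m, fine_scheme eta beta Nt Ns m ->
  forall k x, (k <= Nt)%N -> S_ D Cb Cstar beta Nt Ns k x ->
  (value D p mu (tm Nt k) x <= (scheme D Cb beta Nt Ns m k x + e)%:E)%E.
Proof.
move=> e0.
have [Rb Rb0 HRb] := grids_bounded T0 Hord Cb0 Cstar0 CI0 LA0 A_lip A_cont B_cont.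
have [CB CB0 HB] := ctrl_bound T0 B_cont.
have [LA0' T0'] : 0 <= LA /\ 0 <= T by rewrite !ltW.
pose Ua := Cb * (1 + Rb).
have Ua0 : 0 <= Ua by rewrite mulr_ge0 ?addr_ge0// ltW.
have [R1 [M2 [R10 M20 HR]]] := trajectory_bounds Ua Rb0.
have [M MM HM] := field_ode_bounded T0 LA0 A_lip A_cont B_cont Ua.
pose Mb := Ua + R1.
have Uab : Ua <= Mb by rewrite lerDl.
have R1b : R1 <= Mb by rewrite lerDr.
have e2 : 0 < e / 2 by rewrite divr_gt0.
have e1 : 0 < e / 2 / T by rewrite divr_gt0.
have [d1_ d10 Hd1] := ell_modulus mu_cont cell Mb e1.
have [d2 d20 Hd2] := gT_modulus T0 mu_cont cgT Mb e2.
pose dl := Num.min d1_ d2.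
have dl0 : 0 < dl by rewrite lt_min d10.
have dl1 : dl <= d1_ by rewrite ge_min lexx.
have dl2 : dl <= d2 by rewrite ge_min lexx orbT.
have dl4 : 0 < dl / 4 by rewrite divr_gt0.
pose G := expR (LA * T).
have G0 : 0 <= G by exact: expR_ge0.
(* Three contributions to the distance, from om, from h and from CI dx, are each kept within dl /
   4. *)
have [om om0 omE] : exists2 om, 0 < om & G * T * (1 + r%:R * Ua) * om <= dl / 4.
  by apply: small_factor => //; rewrite !mulr_ge0// addr_ge0// mulr_ge0.
have [dA dA0 HA] := drift_modulus A_cont Rb om0.
have [dB dB0 HBm] := ctrl_modulus B_cont om0.
near=> eta => beta Nt Ns m fine.
have [Nt0 NtNs Hbeta heta reta deta] := fine.
have S1n : forall j (y : state), (j < Nt)%N -> S1_ D Cb Nt Ns j y !=set0.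
  by move: beta Nt Ns m fine {Nt0 NtNs Hbeta heta reta deta}; near: eta; exact: successors_nonempty.
have etad : eta < dl by near: eta; exact: nbhs_right_lt.
have etaA : eta < dA by near: eta; exact: nbhs_right_lt.
have etaB : eta < dB by near: eta; exact: nbhs_right_lt.
have etaM : (G * T * (LA * M2) + M2) * eta < dl / 4.
  by near: eta; apply: near_small_factor => //; rewrite addr_ge0 ?mulr_ge0.
have etaC : G * CI * eta < dl / 4.
  by near: eta; apply: near_small_factor => //; rewrite mulr_ge0// ltW.
move=> k x kN Sx.
have h0 := time_step_gt0 T0 Nt0; have dx0 := space_step_gt0 R Nt0 NtNs.
set h := time_step D Nt in heta h0.
have [X [a [Xk XS Xa XV]]] := discrete_path T0 Hord CI0 Nt0 NtNs Hbeta m (subnKC kN) S1n Sx.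
have XR j : (k <= j <= Nt)%N -> `|X j| <= Rb.
  by move=> /[dup] /andP[_ jN] /XS; exact: HRb.
pose a' j := if (k <= j < Nt)%N then a j else 0.
have a'U j : `|a' j| <= Ua.
  rewrite /a'; case: ifPn => [/andP[kj jN]|_]; last by rewrite normr0.
  have [+ _] := Xa j (introT andP (conj kj jN)); move=> /le_trans; apply.
  by apply: ler_wpM2l; [exact: ltW|rewrite lerD2l; apply: XR; rewrite kj ltnW].
pose u s := stepf h a' Nt.-1 s.
have uU s : `|u s| <= Ua by apply: stepf_norm => j _.
have bu : vbm u.
  move=> i; have -> : (fun s => u s i 0) = stepf h (fun j => a' j i 0) Nt.-1.
    by apply/funext => s; rewrite /u (@stepf_map _ _ _ (fun v : ctl => v i 0)).
  exact: stepf_bm.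
have mu_ : borel_measurable u by exact: stepf_measurable.
have kT := time_in T0 Nt0 kN.
move: (kT); rewrite in_itv /= => /andP[k0 kT'].
have xR : `|x| <= Rb by rewrite -Xk; apply: XR; rewrite leqnn.
have [gam sg] := @ode_exists R _ LA M (field D u) _ T x LA0 kT' (HM u bu uU).
have [gR gL] := HR u _ x gam bu uU kT xR sg.
have NtP : Nt.-1.+1 = Nt by rewrite prednK.
have uE j s : (k <= j < Nt)%N -> tm Nt j <= s -> (s < tm Nt j.+1 \/ j = Nt.-1) ->
    u s = a j.
  move=> kjN js sj; rewrite /u (@stepfE _ _ h a' Nt.-1 j)// /a' ?kjN//.
    by rewrite -ltnS NtP; case/andP: kjN.
  by case: sj => [//|->]; rewrite ltnn.
pose c := h * (LA * (M2 * h) + om + r%:R * om * Ua + r%:R * CB * 0) + CI * space_step R Ns.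
have c0 : 0 <= c.
  apply: addr_ge0; last by apply: mulr_ge0; exact: ltW.
  apply: mulr_ge0; first exact: ltW.
  rewrite mulr0 addr0; apply: addr_ge0; last first.
    by apply: mulr_ge0 => //; apply: mulr_ge0 => //; exact: ltW.
  apply: addr_ge0; last exact: ltW.
  by apply: mulr_ge0 => //; apply: mulr_ge0 => //; exact: ltW.
(* The absolute index k + i is what [gronwall_step] advances; the bound is generous but stays below
   [G * (Nt%:R * c)]. *)
have node i : (k + i <= Nt)%N -> `|gam (tm Nt (k + i)) - X (k + i)%N| <=
    expR (h * LA * (k + i)%:R) * (0 + (k + i)%:R * c).
  elim: i => [|i ih] kiN.
    rewrite addn0 Xk sg.2 ?lexx// vint_aa; last exact: ode_vbm (HM u bu uU) sg.1.
    by rewrite addr0 subrr normr0 mulr_ge0 ?expR_ge0// add0r mulr_ge0.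
  rewrite addnS in kiN *; set j := (k + i)%N in ih kiN *.
  have kj : (k <= j)%N by exact: leq_addr.
  have kjN : (k <= j < Nt)%N by rewrite kj.
  apply: gronwall_step => //; first by rewrite mulr_ge0// ltW.
  have [_ XE] := Xa j kjN.
  have jT := time_in T0 Nt0 (ltnW kiN).
  have tkj : tm Nt k <= tm Nt j by apply: time_le.
  have jhT : tm Nt j + h <= T by rewrite -timeS; exact: time_leT.
  have hyp s : tm Nt j <= s < tm Nt j + h -> [/\ `|u s - a j| <= 0,
      `|gam s - gam (tm Nt j)| <= M2 * h,
      `|drift D s (X j) - drift D (tm Nt j) (X j)| <= om &
      `|ctrl D s - ctrl D (tm Nt j)| <= om].
    move=> /andP[js sj].
    have sT : s \in `[0, T].
      by rewrite in_itv /= (le_trans (time_ge0 T0 Nt0 j) js) (le_trans (ltW sj)).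
    have sh : s - tm Nt j <= h by rewrite lerBlDl ltW.
    have sh' : `|s - tm Nt j| <= h by rewrite ger0_norm ?subr_ge0.
    split.
    - by rewrite (uE j)// ?subrr ?normr0//; left; rewrite timeS.
    - apply: le_trans (gL _ _ tkj js _) _; first exact: le_trans (ltW sj) jhT.
      by apply: ler_wpM2l.
    - apply: HA => //; first by apply: XR; rewrite kj ltnW.
      exact: le_lt_trans sh' (lt_trans heta etaA).
    - by apply: HBm => //; exact: le_lt_trans sh' (lt_trans heta etaB).
  have := euler_error bu sg k0 tkj (ltW h0) jhT HB CB0 (lexx 0) (ltW om0) M20 (a'U j) _.
  rewrite /a' kjN => /(_ (X j) hyp); rewrite -timeS => E.
  rewrite -[_ - X j.+1](subrKA (X j + h *: (drift D (tm Nt j) (X j) +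
    ctrl D (tm Nt j) *m a j))).
  apply: le_trans (ler_normD _ _) _; rewrite [X in _ + X]distrC.
  apply: le_trans (lerD E XE) _.
  rewrite -addrA; apply: lerD => //; apply: ler_wpM2l; last by apply: ih; exact: ltnW.
  by rewrite addr_ge0// mulr_ge0// ltW.
(* Over Nt steps, the Euler errors add up to T times a small quantity and the interpolation shifts
   to CI Nt / Ns. *)
have NE : Nt%:R * c <= T * (LA * M2 * eta + (1 + r%:R * Ua) * om) + CI * eta.
  have -> : Nt%:R * c = (Nt%:R * h) * (LA * M2 * h + (1 + r%:R * Ua) * om) +
    CI * (Nt%:R * space_step R Ns) by rewrite /c; ring.
  have -> : Nt%:R * h = T by exact: (time_last D Nt0).
  apply: lerD.
    apply: ler_wpM2l => //; rewrite lerD2r; apply: ler_wpM2l; first by rewrite mulr_ge0.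
    exact: ltW.
  by apply: ler_wpM2l; [exact: ltW|rewrite /space_step mul1r ltW].
(* The term [M2 * h] extends the estimate from the node to the whole step. *)
have close j : (k <= j <= Nt)%N -> `|gam (tm Nt j) - X j| + M2 * h < dl.
  move=> /andP[kj jN]; have := node (j - k)%N; rewrite subnKC// => /(_ jN) nd.
  have nd' : `|gam (tm Nt j) - X j| <= G * (Nt%:R * c).
    apply: le_trans nd _; rewrite add0r; apply: ler_pM; rewrite ?expR_ge0 ?mulr_ge0//.
      rewrite ler_expR mulrAC mulrC; apply: ler_wpM2l => //; rewrite mulrC.
      exact: (time_leT T0 Nt0 jN).
    by apply: ler_wpM2r => //; rewrite ler_nat.
  have M2h : M2 * h <= M2 * eta by apply: ler_wpM2l => //; exact: ltW.
  have GN := ler_wpM2l G0 NE.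
  apply: le_lt_trans (lerD (le_trans nd' GN) M2h) _.
  have -> : G * (T * (LA * M2 * eta + (1 + r%:R * Ua) * om) + CI * eta) + M2 * eta =
    (G * T * (LA * M2) + M2) * eta + G * T * (1 + r%:R * Ua) * om + G * CI * eta by ring.
  exact: add_quarters.
have closeg j s : (k <= j < Nt)%N -> tm Nt j <= s -> s <= tm Nt j.+1 ->
    `|X j - gam s| < dl.
  move=> /andP[kj jN] js sj.
  have tkj : tm Nt k <= tm Nt j by apply: time_le.
  have sT : s <= T by apply: le_trans sj _; exact: time_leT.
  apply: le_lt_trans (close j _); last by rewrite kj ltnW.
  rewrite distrC -[gam s - X j](subrKA (gam (tm Nt j))) addrC.
  apply: le_trans (ler_normD _ _) _; rewrite lerD2l; apply: le_trans (gL _ _ tkj js sT) _.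
  by apply: ler_wpM2l => //; rewrite lerBlDl -timeS.
have TT : tm Nt k <= T <= T by rewrite kT' lexx.
have gE : gT D (gam T) (mu T) <= gT D (X Nt) (m T) + e / 2.
  rewrite -lerBlDl; apply: le_trans (ler_norm _) _; rewrite distrC; apply/ltW/Hd2.
  - exact: le_trans (gR T TT) R1b.
  - rewrite distrC; have := close Nt; rewrite kN leqnn (time_last D Nt0) => /(_ isT) ll.
    by apply: lt_le_trans dl2; apply: le_lt_trans ll; rewrite lerDl mulr_ge0// ltW.
  - apply: lt_le_trans (deta T _) _; first by rewrite in_itv /= T0' lexx.
    by rewrite lee_fin; apply: le_trans dl2; exact: ltW.
(* The majorant required by [value_le] is a step function made of the discrete costs. *)
suff [hf [bh hfE hfI]] : exists hf : R -> R, [/\ bm hf,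
    forall s, tm Nt k <= s <= T -> running s (u s) (gam s) <= hf s &
    Int (tm Nt k) T hf <= \sum_(k <= j < Nt) h * ell D (tm Nt j) (a j) (X j) (m (tm Nt j)) + e / 2].
  apply: le_trans (value_le kT bu mu_ sg bh hfE) _.
  rewrite lee_fin; apply: le_trans (lerD hfI gE) _.
  by rewrite addrACA -splitr lerD2r.
(* At the final time the interval is a point and the sum is empty, so a constant majorant does. *)
have [Nk|kN'] := leqP Nt k.
  have kE : k = Nt by apply/eqP; rewrite eqn_leq kN.
  exists (fun=> running_max Mb); split; first exact: bm_cst.
    move=> s sT; apply: (running_le).
      exact: le_trans (uU s) Uab.
    exact: le_trans (gR s sT) R1b.
  rewrite kE (time_last D Nt0) Int_aa; last exact: bm_cst.
  by rewrite big_geq// add0r ltW.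
pose v j := ell D (tm Nt j) (a j) (X j) (m (tm Nt j)) + e / 2 / T.
exists (stepf h v Nt.-1); split; first exact: stepf_bm.
- move=> s /andP[ks sT]; have s0 := le_trans k0 ks.
  have [|j [jN js sj sj']] := @step_index _ h Nt.-1 s h0 s0.
    by rewrite NtP; apply: le_trans sT _; rewrite -[leLHS](time_last D Nt0).
  have jN' : (j < Nt)%N by rewrite -NtP ltnS.
  have kj : (k <= j)%N.
    move: jN; rewrite leq_eqVlt => /predU1P[->|/sj' sj2]; first by rewrite -ltnS NtP.
    rewrite -ltnS; have := le_lt_trans ks sj2; rewrite /time -/h ltr_pM2r// ltr_nat//.
  have kjN : (k <= j < Nt)%N by rewrite kj.
  rewrite (@stepfE _ _ h v Nt.-1 j)//.
  have -> : u s = a j.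
    by apply: uE => //; move: jN; rewrite leq_eqVlt => /predU1P[->|/sj']; [right|left].
  rewrite /running tau_id ?s0// /v -lerBlDl; apply: le_trans (ler_norm _) _.
  rewrite distrC; apply/ltW/Hd1.
  + by rewrite in_itv /= s0.
  + exact: time_in (ltnW jN').
  + by apply: le_trans Uab; have := a'U j; rewrite /a' kjN.
  + by apply: le_trans R1b; apply: gR; rewrite ks.
  + rewrite distrC ger0_norm ?subr_ge0//; apply: (@le_lt_trans _ _ h).
      by rewrite lerBlDl -timeS.
    exact: lt_trans heta (lt_le_trans etad dl1).
  + by rewrite subrr normr0.
  + by apply: lt_le_trans dl1; exact: closeg.
  + apply: lt_le_trans (deta _ (time_in T0 Nt0 (ltnW jN'))) _.
    by rewrite lee_fin; apply: le_trans dl1; exact: ltW.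
- have -> : Int (tm Nt k) T (stepf h v Nt.-1) = \sum_(k <= j < Nt) h * v j.
    by rewrite -[X in Int _ X _](time_last D Nt0) Int_stepf// NtP.
  under eq_bigr do rewrite mulrDr.
  rewrite big_split /= lerD2l sumr_const_nat -[leLHS]mulr_natl.
  have -> : (Nt - k)%:R * (h * (e / 2 / T)) = ((Nt - k)%:R * h) * (e / 2 / T) by ring.
  apply: (@le_trans _ _ (T * (e / 2 / T))); last by rewrite mulrC divfK// gt_eqF.
  apply: ler_wpM2r; first exact: ltW.
  by rewrite -[leRHS](time_last D Nt0); apply: ler_wpM2r; [exact: ltW|rewrite ler_nat leq_subr].
Unshelve. all: by end_near. Qed.

Lemma control_modulus (c : R -> ctl) (e : R) : continuous c -> 0 < e ->
  exists2 del, 0 < del & forall s s', s \in `[0, T] -> s' \in `[0, T] ->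
    `|s' - s| < del -> `|c s' - c s| <= e.
Proof.
move=> cc e0.
have [||del del0 H] := @within_modulus R _ _ c `[0, T]%classic `[0, T]%classic e
    (continuous_subspaceT cc) _ _ e0.
- exact: segment_compact.
- by [].
exists del => // s s' sT s'T ss'; apply: H => //.
by rewrite -ball_normE /ball_ /= distrC.
Qed.

(* The scheme can follow a given trajectory: the control c is truncated to the
   admissible size, then rounded so that the next point falls on the grid. *)
Lemma admissible_control k Nt Ns (x y : state) (v : ctl) (Cinv e0 : R) :
  (0 < Nt)%N -> (Nt <= Ns)%N -> (k <= Nt)%N -> 0 <= Cinv ->
  (forall t (w : ctl), t \in `[0, T] -> `|invmx (B1 D t) *m w| <= Cinv * `|w|) ->
  Cinv * (space_step R Ns / time_step D Nt) <= Cb -> 0 <= e0 ->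
  `|v| <= Cb * (1 + `|y|) + e0 ->
  exists2 y1, S1_ D Cb Nt Ns k x y1 & `|alpha_ D Nt k x y1 - v| <=
    Cb * `|y - x| + (2 * (Cinv * (space_step R Ns / time_step D Nt)) + e0).
Proof.
move=> Nt0 NtNs kN Cinv0 Hinv; set ka := Cinv * _ => kaC e00 vy.
have ka0 : 0 <= ka.
  rewrite mulr_ge0// divr_ge0//; first exact: ltW (space_step_gt0 _ Nt0 NtNs).
  exact: ltW (time_step_gt0 T0 Nt0).
pose rho := Cb * (1 + `|x|) - ka.
have rho0 : 0 <= rho.
  by rewrite subr_ge0; apply: le_trans kaC _; rewrite ler_peMr ?lerDl// ltW.
have [|y1 Sy1 ay] := @control_rounding _ _ _ _ T0 Hord Cb Nt Ns Nt0 NtNs Cinv k x (clampv rho v)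
  kN Cinv0 Hinv.
  by rewrite -lerBrDr; exact: norm_clampv.
exists y1 => //.
rewrite -[alpha_ _ _ _ _ _ - v](subrKA (clampv rho v)).
apply: le_trans (ler_normD _ _) _.
have yx : `|y| <= `|x| + `|y - x| by rewrite -{1}[y](subrK x) addrC ler_normD.
have vb : `|v| <= Cb * (1 + (`|x| + `|y - x|)) + e0.
  by apply: le_trans vy _; rewrite lerD2r; apply: ler_wpM2l; [exact: ltW|rewrite lerD2l].
have Cx : Cb * (1 + `|x|) <= Cb * (1 + (`|x| + `|y - x|)).
  by apply: ler_wpM2l; [exact: ltW|rewrite lerD2l lerDl].
have /(clampv_excess rho0 vb) cl : rho <= Cb * (1 + (`|x| + `|y - x|)) + e0.
  by apply: (@le_trans _ _ (Cb * (1 + `|x|))); [rewrite gerBl|apply: le_trans Cx _; rewrite lerDl].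
apply: le_trans (lerD ay cl) _; rewrite -/ka /rho.
rewrite le_eqVlt; apply/orP; left; apply/eqP; ring.
Qed.

(** [e0] and [E0] can be fixed before a trajectory is chosen; the threshold on eta cannot. The
    radius [rad k] grows just enough for every vertex used by the interpolation to lie in the next
    section; the interpolated value then inherits the bound by convexity. *)
Lemma scheme_tube (Rb M0 e : R) : 0 <= Rb -> 0 <= M0 -> 0 < e ->
  exists e0 E0, [/\ 0 < e0, 0 < E0 & forall tb (xb : state) (c : R -> ctl) (gam : R -> state),
    tb \in `[0, T] -> `|xb| <= Rb -> cb c -> (forall s, `|c s| <= M0) ->
    sol (field D c) tb T xb gam ->
    (forall s, tb <= s <= T -> `|c s| <= Cb * (1 + `|gam s|) + e0) ->
    \forall eta \near 0^'+, forall beta Nt Ns m, fine_scheme eta beta Nt Ns m ->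
      forall k (x : state), (k <= Nt)%N -> tb <= tm Nt k ->
      `|x - gam (tm Nt k)| <= E0 ->
      scheme D Cb beta Nt Ns m k x <=
        Int (tm Nt k) T (fun s => running s (c s) (gam s)) + gT D (gam T) (mu T) + e].
Proof.
move=> Rb0 M00 e_gt0.
have [CB CB0 HB] := ctrl_bound T0 B_cont.
have [Cinv Cinv0 Hinv] := ctrl_inverse_bound B_cont Hord.
have [LA0' T0'] : 0 <= LA /\ 0 <= T by rewrite !ltW.
have [R1 [M2 [R10 M20 HR]]] := trajectory_bounds M0 Rb0.
pose Mb := M0 + R1.
have M0b : M0 <= Mb by rewrite lerDl.
have R1b : R1 <= Mb by rewrite lerDr.
have e2 : 0 < e / 2 by rewrite divr_gt0.
have e1 : 0 < e / 2 / T by rewrite divr_gt0.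
have [d1_ d10 Hd1] := ell_modulus mu_cont cell Mb e1.
have [d2 d20 Hd2] := gT_modulus T0 mu_cont cgT Mb e2.
pose dl := Num.min d1_ d2.
have dl0 : 0 < dl by rewrite lt_min d10.
have dl1 : dl <= d1_ by rewrite ge_min lexx.
have dl2 : dl <= d2 by rewrite ge_min lexx orbT.
pose K := r%:R * CB.
have K0 : 0 <= K by rewrite mulr_ge0.
(* Expansion rate of the tube: LA from the drift, and K Cb because truncation makes the control
   error grow with the distance to the trajectory. *)
pose b := LA + K * Cb.
have b0 : 0 <= b by rewrite addr_ge0// mulr_ge0// ltW.
pose G := expR (b * T).
have G0 : 0 <= G by exact: expR_ge0.
have Cb0' := ltW Cb0.
(* Upper limit for the radius: the distance and the control error Cb ds that it causes must both fit
   in the modulus of the costs. *)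
have [ds ds0 dsE] : exists2 ds, 0 < ds & (1 + Cb) * ds <= dl / 4.
  by apply: small_factor; [rewrite addr_ge0|rewrite divr_gt0].
have ds8 : 0 < ds / 8 by rewrite divr_gt0.
have dsl : ds <= dl / 4 by apply: le_trans dsE; rewrite ler_peMl ?lerDl// ltW.
have [E0 E00 E0E] := small_factor G0 ds8.
(* The 1 lets a bound on [F * th] control th itself as well as its accumulated effect
   [G * T * K * th]. *)
pose F := G * T * K + 1.
have F0 : 0 <= F by rewrite addr_ge0// !mulr_ge0.
have F1 y : 0 <= y -> y <= F * y by move=> y0; rewrite ler_peMl// lerDr !mulr_ge0.
have [e0 e00 e0E] := small_factor F0 ds8.
exists e0, E0; split => // tb xb c gam tbT xbR cc cM0 sg cC.
have bc := cb_vbm cc.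
have [gR gL] := HR c tb xb gam bc cM0 tbT xbR sg.
have [oc oc0 ocE] := small_factor F0 ds8.
(* The source of a threshold that depends on the control. *)
have [dc dc0 Hdc] := control_modulus cc.1 oc0.
pose Ua := M0 + dl.
have Ua0 : 0 <= Ua by rewrite addr_ge0// ltW.
have [om om0 omE] : exists2 om, 0 < om & G * T * (1 + r%:R * Ua) * om <= ds / 8.
  by apply: small_factor => //; rewrite !mulr_ge0// addr_ge0// mulr_ge0.
have [dA dA0 HA] := drift_modulus A_cont (R1 + dl) om0.
have [dB dB0 HBm] := ctrl_modulus B_cont om0.
have [k0 k00 k0E] : exists2 k0, 0 < k0 & F * 2 * k0 <= ds / 8.
  by apply: small_factor => //; rewrite mulr_ge0.
near=> eta => beta Nt Ns m fn.
have [Nt0 NtNs Hbeta heta reta deta] := fn.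
have kaK : Cinv * (space_step R Ns / time_step D Nt) < k0.
  by move: beta Nt Ns m fn {Nt0 NtNs Hbeta heta reta deta}; near: eta; exact: rounding_small.
have kaC : Cinv * (space_step R Ns / time_step D Nt) < Cb.
  by move: beta Nt Ns m fn {Nt0 NtNs Hbeta heta reta deta kaK}; near: eta; exact: rounding_small.
have etad : eta < dl by near: eta; exact: nbhs_right_lt.
have etaA : eta < dA by near: eta; exact: nbhs_right_lt.
have etaB : eta < dB by near: eta; exact: nbhs_right_lt.
have etac : eta < dc by near: eta; exact: nbhs_right_lt.
have etaM : (G * T * (LA * M2) + M2) * eta < ds / 8.
  by near: eta; apply: near_small_factor => //; rewrite addr_ge0 ?mulr_ge0.
have etaC : G * CI * eta < ds / 8.
  by near: eta; apply: near_small_factor => //; rewrite mulr_ge0// ltW.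
have h0 := time_step_gt0 T0 Nt0; have dx0 := space_step_gt0 R Nt0 NtNs.
set h := time_step D Nt in heta h0 kaK kaC.
set ka := Cinv * _ in kaK kaC.
have ka0 : 0 <= ka by rewrite mulr_ge0// divr_ge0 ?ltW.
(* Control error not proportional to the distance: the rounding and the margin kept for it, the
   slack of the feedback bound, and the variation of c during a step. *)
pose th := 2 * ka + e0 + oc.
have th0 : 0 <= th.
  by apply: addr_ge0; [apply: addr_ge0; [exact: mulr_ge0|exact: ltW]|exact: ltW].
have Fth : F * th <= ds / 8 + ds / 8 + ds / 8.
  rewrite /th !mulrDr; apply: lerD => //; apply: lerD => //.
  by apply: le_trans k0E; rewrite mulrA; apply: ler_wpM2l; [rewrite mulr_ge0|exact: ltW].
pose w := h * (LA * (M2 * h) + om + r%:R * om * Ua + K * th) + CI * space_step R Ns.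
have w0 : 0 <= w.
  apply: addr_ge0; last by apply: mulr_ge0; exact: ltW.
  apply: mulr_ge0; first exact: ltW.
  apply: addr_ge0; last exact: mulr_ge0.
  apply: addr_ge0; last by apply: mulr_ge0 => //; apply: mulr_ge0 => //; exact: ltW.
  apply: addr_ge0; last exact: ltW.
  by apply: mulr_ge0 => //; apply: mulr_ge0 => //; exact: ltW.
pose rad k := expR (h * b * k%:R) * (E0 + k%:R * w).
have radE k : (k <= Nt)%N -> rad k + M2 * h < ds.
  move=> kN.
  have NE : k%:R * w <= T * (LA * M2 * eta + (1 + r%:R * Ua) * om + K * th) + CI * eta.
    have -> : k%:R * w = (k%:R * h) * (LA * M2 * h + (1 + r%:R * Ua) * om + K * th) +
      CI * (k%:R * space_step R Ns) by rewrite /w; ring.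
    apply: lerD; last first.
      apply: ler_wpM2l; first exact: ltW.
      apply: le_trans (ltW reta); rewrite /space_step mul1r; apply: ler_wpM2r.
        by rewrite invr_ge0.
      by rewrite ler_nat.
    apply: ler_pM.
    - by apply: mulr_ge0 => //; exact: ltW.
    - apply: addr_ge0; last exact: mulr_ge0.
      apply: addr_ge0; first by apply: mulr_ge0; [exact: mulr_ge0|exact: ltW].
      by apply: mulr_ge0; [rewrite addr_ge0// mulr_ge0|exact: ltW].
    - exact: (time_leT T0 Nt0 kN).
    - by rewrite !lerD2r; apply: ler_wpM2l; [exact: mulr_ge0|exact: ltW].
  have M2h : M2 * h <= M2 * eta by apply: ler_wpM2l => //; exact: ltW.
  have rG : rad k <= G * (E0 + (T * (LA * M2 * eta + (1 + r%:R * Ua) * om + K * th) + CI * eta)).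
    apply: ler_pM; rewrite ?expR_ge0//.
    - by apply: addr_ge0; [exact: ltW|exact: mulr_ge0].
    - rewrite ler_expR mulrAC mulrC; apply: ler_wpM2l => //; rewrite mulrC.
      exact: (time_leT T0 Nt0 kN).
    - by rewrite lerD2l.
  apply: le_lt_trans (lerD rG M2h) _.
  have Gth : G * T * K * th <= F * th by apply: ler_wpM2r => //; rewrite lerDl.
  have -> : G * (E0 + (T * (LA * M2 * eta + (1 + r%:R * Ua) * om + K * th) + CI * eta)) +
      M2 * eta = G * E0 + (G * T * (LA * M2) + M2) * eta + G * T * (1 + r%:R * Ua) * om +
      G * T * K * th + G * CI * eta by ring.
  exact: tube_sum ds0 E0E etaM omE (le_trans Gth Fth) etaC.
have radd k : (k <= Nt)%N -> rad k < ds.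
  by move=> /radE; apply: le_lt_trans; rewrite lerDl mulr_ge0// ltW.
have ds_dl : ds < dl by apply: le_lt_trans dsl _; rewrite ltr_pdivrMr// ltr_pMr// ltr1n.
have bf := running_bm cc sg.1.
set f := (fun s => running s (c s) (gam s)) in bf *.
(* The allowance decreases with the remaining time: [e / 2 / T] per unit of time for the running
   cost, and [e / 2] for the final cost. *)
suff main n k x : (k + n)%N = Nt -> tb <= tm Nt k -> `|x - gam (tm Nt k)| <= rad k ->
    scheme D Cb beta Nt Ns m k x <= Int (tm Nt k) T f + gT D (gam T) (mu T) +
      (e / 2 / T * (T - tm Nt k) + e / 2).
  move=> k x kN tbk xg; apply: le_trans (main (Nt - k)%N k x (subnKC kN) tbk _) _.
    apply: le_trans xg _; rewrite /rad -[leLHS]mul1r; apply: ler_pM => //; first exact: ltW.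
      by rewrite -expR0 ler_expR !mulr_ge0// ltW.
    by rewrite lerDl mulr_ge0.
  rewrite lerD2l [X in _ <= X](splitr e) lerD2r mulrAC ler_pdivrMr//; apply: ler_wpM2l; first exact: ltW.
  by rewrite gerBl time_ge0.
elim: n k x => [|n ih] k x.
  rewrite addn0 => kE tbk xg; rewrite kE scheme_last (time_last D Nt0) Int_aa//.
  rewrite subrr mulr0 !add0r -lerBlDl; apply: le_trans (ler_norm _) _; apply/ltW/Hd2.
  - by apply: le_trans (gR T _) R1b; rewrite lexx andbT; move: tbT; rewrite in_itv => /andP[].
  - move: xg; rewrite kE (time_last D Nt0) => /le_lt_trans; apply.
    by apply: lt_le_trans (lt_trans (radd _ (leqnn _)) ds_dl) dl2.
  - apply: lt_le_trans (deta T _) _; first by rewrite in_itv /= T0' lexx.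
    by rewrite lee_fin; apply: le_trans dl2; exact: ltW.
move=> knN tbk xg.
have kN : (k < Nt)%N by rewrite -knN addnS ltnS leq_addr.
have kN' := ltnW kN.
have dist := le_lt_trans xg (radd k kN').
have tT := time_in T0 Nt0 kN'.
have tT1 : tm Nt k <= T by exact: time_leT.
move: (tbT); rewrite in_itv /= => /andP[tb0 tbT'].
have [y1 Sy1] := admissible_control x Nt0 NtNs kN' Cinv0 Hinv (ltW kaC) (ltW e00)
  (cC (tm Nt k) (introT andP (conj tbk tT1))).
rewrite -/h -/ka (distrC (gam _)).
set al := alpha_ D Nt k x y1; set dd := `|_ - gam _| in xg dist * => ay.
have thd : Cb * dd + th < dl.
  apply: (tube_slack ds0 _ dl0 (le_trans (F1 _ th0) Fth)).
  apply: le_trans dsE; rewrite mulrDl mul1r addrC lerD2l; apply: ler_wpM2l => //.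
  exact: ltW.
have ay' : `|al - c (tm Nt k)| + oc <= Cb * dd + th.
  by rewrite /th addrA -/ka; rewrite lerD2r.
have alU : `|al| <= Ua.
  rewrite -[al](subrK (c (tm Nt k))) addrC; apply: le_trans (ler_normD _ _) _.
  apply: lerD => //; apply: (@le_trans _ _ (Cb * dd + th)); last exact: ltW.
  by apply: le_trans ay'; rewrite lerDl ltW.
have jhT : tm Nt k + h <= T by rewrite -timeS; exact: time_leT.
have window s : tm Nt k <= s < tm Nt k + h -> [/\ s \in `[0, T],
    `|s - tm Nt k| <= h & `|gam s - gam (tm Nt k)| <= M2 * h].
  move=> /andP[ks sk].
  have sT : s <= T by apply: le_trans (ltW sk) _.
  have sh : s - tm Nt k <= h by rewrite lerBlDl ltW.
  split.
  - by rewrite in_itv /= sT (le_trans (time_ge0 T0 Nt0 k) ks).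
  - by rewrite ger0_norm ?subr_ge0.
  - by apply: le_trans (gL _ _ tbk ks sT) _; apply: ler_wpM2l.
have cal s : tm Nt k <= s < tm Nt k + h -> `|c s - al| <= Cb * dd + th.
  move=> /window[sI sh _]; apply: le_trans ay'.
  rewrite -[c s - al](subrKA (c (tm Nt k))) addrC; apply: le_trans (ler_normD _ _) _.
  rewrite distrC lerD2l; apply: Hdc => //.
  exact: le_lt_trans sh (lt_trans heta etac).
have xR : `|x| <= R1 + dl.
  rewrite -[x](subrK (gam (tm Nt k))) addrC; apply: le_trans (ler_normD _ _) _.
  apply: lerD; last by apply: ltW; exact: lt_trans dist ds_dl.
  by apply: gR; rewrite tbk.
have succ y2 : S2_ D beta Nt Ns k x y1 y2 ->
    scheme D Cb beta Nt Ns m k.+1 (col_mx y1 y2) <= Int (tm Nt k.+1) T f +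
      gT D (gam T) (mu T) + (e / 2 / T * (T - tm Nt k.+1) + e / 2).
  move=> Sy2.
  have Sy : Ssucc D Cb beta Nt Ns k x (col_mx y1 y2).
    by split; rewrite col_mxKu ?col_mxKd.
  apply: ih.
  - by rewrite addSnnS.
  - by apply: le_trans tbk _; exact: time_le.
  - have XE := succ_consistency T0 Hord CI0 Nt0 NtNs Hbeta kN' Sy.
    rewrite col_mxKu -/al -/h in XE.
    have thd0 : 0 <= Cb * dd + th.
      by apply: addr_ge0 => //; apply: mulr_ge0 => //; exact: normr_ge0.
    have hyp s : tm Nt k <= s < tm Nt k + h -> [/\ `|c s - al| <= Cb * dd + th,
        `|gam s - gam (tm Nt k)| <= M2 * h,
        `|drift D s x - drift D (tm Nt k) x| <= om &
        `|ctrl D s - ctrl D (tm Nt k)| <= om].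
      move=> sk; have [sI sh gs] := window s sk; split => //.
      - exact: cal.
      - by apply: HA => //; exact: le_lt_trans sh (lt_trans heta etaA).
      - by apply: HBm => //; exact: le_lt_trans sh (lt_trans heta etaB).
    have E := euler_error bc sg tb0 tbk (ltW h0) jhT HB CB0
      thd0 (ltW om0) M20 alU hyp.
    apply: gronwall_step => //; [by rewrite mulr_ge0// ltW|exact: ltW|].
    rewrite -timeS in E.
    rewrite -[_ - gam _](subrKA (x + h *: (drift D (tm Nt k) x +
      ctrl D (tm Nt k) *m al))) addrC.
    apply: le_trans (ler_normD _ _) _; rewrite [X in X + _]distrC.
    apply: le_trans (lerD E XE) _; rewrite [X in _ * X]distrC -/dd.
    apply: (@le_trans _ _ ((1 + h * b) * dd + w)).
      rewrite /b /w /K le_eqVlt; apply/orP; left; apply/eqP; ring.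
    by rewrite lerD2r; apply: ler_wpM2l => //; rewrite addr_ge0// mulr_ge0// ltW.
have [_ /(_ y1 Sy1) le1] := schemeP T0 Hord beta Nt0 NtNs m kN (ex_intro _ y1 Sy1).
apply: le_trans le1 _; rewrite -/al -/h.
have le2 := interp_le Hbeta succ.
have tk1 : tm Nt k <= tm Nt k.+1 by exact: time_le.
have tk1T : tm Nt k.+1 <= T by exact: time_leT.
have le3 : h * ell D (tm Nt k) al x (m (tm Nt k)) <=
    Int (tm Nt k) (tm Nt k.+1) f + h * (e / 2 / T).
  have hE : tm Nt k.+1 - tm Nt k = h by rewrite timeS addrAC subrr add0r.
  have := @Int_dev _ _ _ (ell D (tm Nt k) al x (m (tm Nt k))) (e / 2 / T) f tk1 bf.
  rewrite hE => dev; rewrite -lerBlDl; apply: le_trans (ler_norm _) _; rewrite distrC.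
  apply: dev => s; rewrite timeS => sk; have [sI sh gs] := window s sk.
  move: (sI); rewrite in_itv /= => sI'.
  rewrite /f /running tau_id// distrC; apply/ltW/Hd1 => //.
  + exact: le_trans (cM0 s) M0b.
  + apply: le_trans R1b; apply: gR; case/andP: sk => ks _.
    by rewrite (le_trans tbk ks); case/andP: sI'.
  + rewrite distrC; apply: le_lt_trans sh _; exact: lt_trans heta (lt_le_trans etad dl1).
  + rewrite distrC; apply: le_lt_trans (cal s sk) _; exact: lt_le_trans thd dl1.
  + apply: (@le_lt_trans _ _ (rad k + M2 * h)).
      rewrite -[x - gam s](subrKA (gam (tm Nt k))); apply: le_trans (ler_normD _ _) _.
      by apply: lerD => //; rewrite distrC.
    exact: lt_le_trans (lt_trans (radE k kN') ds_dl) dl1.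
  + apply: lt_le_trans (deta _ tT) _.
    by rewrite lee_fin; apply: le_trans dl1; exact: ltW.
rewrite (@Int_chasles _ (tm Nt k) (tm Nt k.+1) T)//.
apply: le_trans (lerD le3 le2) _.
rewrite timeS -/h; set z1 := Int _ _ _; set z2 := Int _ _ _; set z3 := gT _ _ _.
rewrite le_eqVlt; apply/orP; left; apply/eqP; ring.
Unshelve. all: by end_near. Qed.

Lemma fine_scheme_le (eta eta' : R) beta Nt Ns m : eta' <= eta ->
  fine_scheme eta' beta Nt Ns m -> fine_scheme eta beta Nt Ns m.
Proof.
move=> ee [Nt0 NtNs Hb hs hr hd]; split => //.
- exact: lt_le_trans hs ee.
- exact: lt_le_trans hr ee.
- by move=> t tT; apply: lt_le_trans (hd t tT) _; rewrite lee_fin.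
Qed.

(* By compactness of the set of initial data, it suffices to follow one
   near-optimal trajectory for each member of a finite net. *)
Lemma scheme_upper_bound (e : R) : 0 < e -> \forall eta \near 0^'+,
  forall beta Nt Ns m, fine_scheme eta beta Nt Ns m ->
  forall k x, (k <= Nt)%N -> S_ D Cb Cstar beta Nt Ns k x ->
  ((scheme D Cb beta Nt Ns m k x)%:E <= value D p mu (tm Nt k) x + e%:E)%E.
Proof.
move=> e_gt0.
have [Rb Rb0 HRb] := grids_bounded T0 Hord Cb0 Cstar0 CI0 LA0 A_lip A_cont B_cont.
(* Points near a center of the net may lie slightly outside the ball of radius [Rb]. *)
have Rb1 : 0 <= Rb + 1 by rewrite addr_ge0.
have [M0 M00 HM0] := near_optimal_control Rb0.
have [R1 [M2 [R10 M20 HR]]] := trajectory_bounds M0 Rb0.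
have [M _ HM] := field_ode_bounded T0 LA0 A_lip A_cont B_cont M0.
have e4 : 0 < e / 4 by rewrite divr_gt0.
have [e0 [E0 [e00 E00 Htube]]] := scheme_tube Rb0 M00 e4.
have [del del0 Hshift] := value_time_shift Rb1 e4.
have [d0 d00 [d0E d0del d0C d01]] : exists2 d0, 0 < d0 &
    [/\ (1 + M2 * 2) * d0 < E0, 2 * d0 < del, Cl2 * 2 * d0 < e / 4 & d0 < 1].
  near (0 : R)^'+ => d0; exists d0; first by near: d0; exact: nbhs_right_gt.
  split; near: d0; try exact: near_small_factor; last exact: nbhs_right_lt.
    by apply: near_small_factor => //; rewrite addr_ge0// mulr_ge0.
  by apply: near_small_factor => //; rewrite mulr_ge0// ltW.
(* Arbitrary points are allowed, not only grid points, since [scheme] is a function on the whole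
   space; the compact set is thus independent of the grid. *)
pose P (eta : R) (z : R * state) := forall beta Nt Ns m, fine_scheme eta beta Nt Ns m ->
  forall k, (k <= Nt)%N -> tm Nt k = z.1 ->
  ((scheme D Cb beta Nt Ns m k z.2)%:E <= value D p mu z.1 z.2 + e%:E)%E.
have [|||eta eta0 Heta] := @compact_uniform R _
    (`[0, T]%classic `*` [set x : state | `|x| <= Rb]) P.
- by apply: compact_setX; [exact: segment_compact|exact: cV_ball_compact].
- by move=> d d' z d'd Pd beta Nt Ns m /(fine_scheme_le d'd); exact: Pd.
- move=> [tc xc] [/= tcT xcR].
  (* An early start puts all times of [[0, T]] close to tc after the beginning of the tube. *)
  pose tb := Num.max 0 (tc - d0).
  have tbT : tb \in `[0, T].
    rewrite in_itv /= le_max lexx ge_max (ltW T0) /=.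
    by move: tcT; rewrite in_itv /= => /andP[_]; apply: le_trans; rewrite gerBl ltW.
  have e0' : 0 < Num.min e0 (e / 4) by rewrite lt_min e00.
  have [c [gam [cc cM0 sg cC opt]]] := HM0 _ tb xc e0' tbT xcR.
  have [gR gL] := HR c tb xc gam (cb_vbm cc) cM0 tbT xcR sg.
  have cC' s : tb <= s <= T -> `|c s| <= Cb * (1 + `|gam s|) + e0.
    by move=> /cC /le_trans; apply; rewrite lerD2l ge_min lexx.
  have Hnear := Htube tb xc c gam tbT xcR cc cM0 sg cC'.
  near (0 : R)^'+ => eta.
  have tube : forall beta Nt Ns m, fine_scheme eta beta Nt Ns m ->
      forall k (x : state), (k <= Nt)%N -> tb <= tm Nt k ->
      `|x - gam (tm Nt k)| <= E0 ->
      scheme D Cb beta Nt Ns m k x <= Int (tm Nt k) T (fun s =>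
        running s (c s) (gam s)) + gT D (gam T) (mu T) + e / 4.
    by near: eta.
  exists eta; first by near: eta; exact: nbhs_right_gt.
  near=> z => beta Nt Ns m fn k kN tkE.
  have [zt zx] : `|z.1 - tc| < d0 /\ `|z.2 - xc| < d0.
    near: z; exists (ball tc d0, ball xc d0); first by split; exact: nbhsx_ballx.
    by move=> [u v] [/= h1 h2]; move: h1 h2; rewrite -!ball_normE /ball_ /= !(distrC tc) !(distrC xc).
  have tT := time_in T0 (fine_Nt fn) kN; rewrite tkE in tT.
  move: (tT) (tbT); rewrite !in_itv /= => /andP[t0 tT'] /andP[tb0 tbT'].
  have tbt : tb <= z.1.
    by rewrite ge_max t0 lerBlDr -lerBlDl; apply: le_trans (ltW zt); rewrite distrC ler_norm.
  have ttb : z.1 - tb <= 2 * d0.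
    rewrite lerBlDr -lerBlDl; apply: (@le_trans _ _ (tc - d0)); last by rewrite le_max lexx orbT.
    rewrite (_ : z.1 - 2 * d0 = z.1 - tc - d0 + (tc - d0)); last by ring.
    by rewrite gerDr subr_le0; apply: le_trans (ler_norm _) (ltW zt).
  have bf := running_bm cc sg.1.
  have xg : `|z.2 - gam z.1| <= E0.
    rewrite -[z.2 - _](subrKA xc); apply: le_trans (ler_normD _ _) _.
    apply: le_trans (ltW d0E); rewrite mulrDl mul1r; apply: lerD; first exact: ltW.
    have -> : xc = gam tb.
      rewrite sg.2 ?lexx// vint_aa ?addr0//.
      exact: ode_vbm (ltW LA0) (HM c (cb_vbm cc) cM0) sg.1.
    rewrite distrC; apply: le_trans (gL _ _ (lexx tb) tbt tT') _.
    by rewrite -mulrA; apply: ler_wpM2l.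
  have := tube _ _ _ _ fn k z.2 kN; rewrite tkE => /(_ tbt xg) up.
  have low : - (e / 4) <= Int tb z.1 (fun s => running s (c s) (gam s)).
    apply: (@le_trans _ _ (Int tb z.1 (fun=> - Cl2))); last first.
      apply: Int_le => //; first exact: bm_cst.
      by move=> s _; exact: (running_ge).
    rewrite Int_cst// mulNr lerN2; apply: le_trans (ltW d0C).
    by rewrite -mulrA; apply: ler_wpM2l; first exact: ltW.
  have shift : (value D p mu tb xc <= value D p mu z.1 z.2 + (e / 4)%:E)%E.
    apply: Hshift => //.
    - exact: le_trans ttb (ltW d0del).
    - rewrite -[z.2](subrK xc) addrC; apply: le_trans (ler_normD _ _) _.
      by apply: lerD => //; apply: ltW; exact: lt_trans zx d01.
    - by apply: le_trans xcR _; rewrite lerDl.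
    - rewrite distrC; apply: le_trans (ltW zx) (le_trans _ (ltW d0del)).
      by rewrite ler_peMl ?ler1n// ltW.
  have min4 : ((Num.min e0 (e / 4))%:E <= (e / 4)%:E)%E.
    by rewrite lee_fin ge_min lexx orbT.
  rewrite (@Int_chasles _ tb z.1 T)// in opt.
  set f := (fun s => running s (c s) (gam s)) in up low opt.
  have up' : scheme D Cb beta Nt Ns m k z.2 <=
      Int tb z.1 f + Int z.1 T f + gT D (gam T) (mu T) + (e / 4 + e / 4).
    apply: le_trans up _.
    rewrite (_ : _ + (e / 4 + e / 4) = Int z.1 T f + gT D (gam T) (mu T) + e / 4 +
      (Int tb z.1 f + e / 4)); last by ring.
    by rewrite lerDl -lerBlDr sub0r.
  apply: (@le_trans _ _ (Int tb z.1 f + Int z.1 T f + gT D (gam T) (mu T) + (e / 4 + e / 4))%:E).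
    by rewrite lee_fin.
  rewrite EFinD; apply: le_trans (leeD2r _ (le_trans opt (leeD shift min4))) _.
  rewrite -!addeA -!EFinD leeD2l// lee_fin le_eqVlt; apply/orP; left; by apply/eqP; field.
near=> eta' => beta Nt Ns m fn k x kN Sx.
have ee : eta' <= eta by near: eta'; exact: nbhs_right_le.
have tkT := time_in T0 (fine_Nt fn) kN.
apply: (Heta (tm Nt k, x) _ beta Nt Ns m (fine_scheme_le ee fn) k kN erefl).
split; first exact: tkT.
exact: HRb (fine_Nt fn) (fine_Ns fn) (fine_basis fn) k x kN Sx.
Unshelve. all: by end_near. Qed.

End cost.

(** The two one-sided bounds also rule out an infinite w. *)
Lemma abse_dist_le (R : realType) (v e : R) (w : \bar R) :
  (w <= (v + e)%:E)%E -> (v%:E <= w + e%:E)%E -> (`|v%:E - w| <= e%:E)%E.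
Proof.
case: w => [w||]//=; rewrite -?EFinD !lee_fin => h1 h2.
by rewrite ler_norml; apply/andP; split; lra.
Qed.

Theorem proposition3p2 (R : realType) (r q : nat) (D : control_data R r q)
  (p Cb Cstar CI : R) (beta : nat -> 'cV[R]_q -> 'cV[R]_q -> R)
  (Nt Ns : nat -> nat) (m : nat -> R -> P1 'cV[R]_(r + q))
  (mstar : R -> P1 'cV[R]_(r + q)) :
  0 < horizon D ->
  growth_condition D p ->
  dynamics_condition D ->
  coordinates_ordered D ->
  control_bound D p Cb ->
  0 < Cstar ->
  0 < CI ->
  (forall N, (0 < N)%N -> Q1_basis CI (space_step R N) (beta N)) ->
  (forall n, (0 < Nt n)%N /\ (Nt n <= Ns n)%N) ->
  (forall n, continuous_flow (horizon D) (m n)) ->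
  continuous_flow (horizon D) mstar ->
  Nt n @[n --> \oo] --> \oo ->
  Ns n @[n --> \oo] --> \oo ->
  ((Nt n)%:R / (Ns n)%:R : R) @[n --> \oo] --> (0 : R) ->
  dC (horizon D) (m n) mstar @[n --> \oo] --> 0%E ->
  ereal_sup [set e | exists k x,
    [/\ (k <= Nt n)%N, S_ D Cb Cstar (beta (Ns n)) (Nt n) (Ns n) k x &
        e = `|(scheme D Cb (beta (Ns n)) (Nt n) (Ns n) (m n) k x)%:E
              - value D p mstar (time D (Nt n) k) x|%E]]
    @[n --> \oo] --> 0%E.
Proof.
move=> T0 [p1 cell cgT [Cl1 [Cl2 [Cl3 [Cl4 [Cg1 [Cg2 [Cg3 [[Cl10 Cl20 Cl30 _] _ growth]]]]]]]]].
move=> [A_cont B_cont [LA LA0 A_lip] _] Hord HCb Cstar0 CI0 Hbeta HN _ mu_cont NtE _ ratioE dCE.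
have Cb0 : 0 < Cb by case: HCb.
have fine_near (eta : R) : 0 < eta -> \forall n \near \oo,
    fine_scheme D mstar CI eta (beta (Ns n)) (Nt n) (Ns n) (m n).
  move=> eta0; near=> n; have [Nt0 NtNs] := HN n; split => //.
  - by apply: Hbeta; exact: leq_trans Nt0 NtNs.
  - rewrite /time_step ltr_pdivrMr ?ltr0n// mulrC -ltr_pdivrMr//.
    apply: (@lt_le_trans _ _ (Num.bound (horizon D / eta))%:R).
      by apply: archi_boundP; rewrite divr_ge0// ltW.
    rewrite ler_nat; near: n.
    exact: (NtE _ (nbhs_infty_ge (Num.bound (horizon D / eta)))).
  - apply: le_lt_trans (ler_norm _) _; rewrite -normrN -sub0r; near: n.
    by have /cvgrPdist_lt := ratioE; apply.
  - move=> t tT; apply: (@le_lt_trans _ _ (dC (horizon D) (m n) mstar)).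
      by apply: ereal_sup_ubound; exists t.
    by near: n; exact: cvge0_lt.
have bound (e : R) : 0 < e -> \forall n \near \oo, forall k x, (k <= Nt n)%N ->
    S_ D Cb Cstar (beta (Ns n)) (Nt n) (Ns n) k x ->
    (`|(scheme D Cb (beta (Ns n)) (Nt n) (Ns n) (m n) k x)%:E
       - value D p mstar (time D (Nt n) k) x| <= e%:E)%E.
  move=> e0.
  have lower := scheme_lower_bound T0 mu_cont p1 cell cgT Cl30 growth LA0 A_lip A_cont B_cont
    Cb0 Hord Cstar0 CI0 e0.
  have upper := scheme_upper_bound T0 mu_cont p1 cell cgT Cl10 Cl20 Cl30 growth LA0 A_lip
    A_cont B_cont Cb0 HCb Hord Cstar0 CI0 e0.
  (* A single eta serves both bounds; every large n then gives a scheme that fine. *)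
  have [eta [[lo up] eta0]] := @filter_ex R (0 : R)^'+ (at_right_proper_filter 0) _
    (filterI (filterI lower upper) (nbhs_right_gt 0)).
  apply: filterS (fine_near eta eta0) => n fn k x kN Sx.
  by apply: abse_dist_le; [exact: lo fn k x kN Sx|exact: up fn k x kN Sx].
set s := (fun n => ereal_sup _).
(* The supremum of an empty set would be -oo; the origin always belongs to the initial grid. *)
have s0 n : (0 <= s n)%E.
  apply: (@le_trans _ _ `|(scheme D Cb (beta (Ns n)) (Nt n) (Ns n) (m n) 0 0)%:E
    - value D p mstar (time D (Nt n) 0) 0|%E); first exact: abse_ge0.
  apply: ereal_sup_ubound; exists 0%N, 0; split => //; split => /=.
    by exists 0 => //; apply/matrixP => i j; rewrite !mxE mulr0.
  by rewrite normr0 ltW.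
have s_le (e : R) : 0 < e -> \forall n \near \oo, (s n <= e%:E)%E.
  move=> /bound; apply: filterS => n H; apply: ub_ereal_sup => _ [k [x [kN Sx ->]]].
  exact: H.
have s_fin n (e : R) : (s n <= e%:E)%E -> s n \is a fin_num.
  by move=> sn; rewrite ge0_fin_numE//; apply: le_lt_trans sn _; rewrite ltry.
apply/fine_cvgP; split.
  by apply: filterS (s_le 1 ltr01) => n; exact: s_fin.
apply/cvgrPdist_le => e e0; apply: filterS (s_le e e0) => n sn.
rewrite sub0r normrN ger0_norm; last exact: fine_ge0.
by rewrite -lee_fin fineK//; exact: s_fin sn.
Unshelve. all: by end_near. Qed.
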